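(* For each dimension $d$, consider the Metropolis–Hastings algorithm with $$\text{target } N(A^{-1}b,A^{-1}),\qquad \text{proposal } y=Gx+M^{-1}\beta+(\mathcal{A}^{-1}-G\mathcal{A}^{-1}G^T)^{1/2}\xi,\quad \xi\sim N(0,I),$$ where $\mathcal{A}=M-N$, $G=M^{-1}N$. Suppose that $M$ and $N$ are functions of $A$, and that the Markov chain is in equilibrium, i.e. $x\sim N(A^{-1}b,A^{-1})$, with $x'$ the next state of the chain. Let $\lambda_k^2$, $\tilde\lambda_k^2$ and $G_k$ ($\lambda_k,\tilde\lambda_k>0$) be the eigenvalues of $A$, $\mathcal{A}$ and $G$ respectively for the common normalized eigenvectors $q_k$, $k=1,\dots,d$. Define $$\tilde g_k:=1-G_k,\quad g_k:=1-G_k^2,\quad m_k:=q_k^TA^{-1}b,\quad \tilde m_k:=q_k^T\mathcal{A}^{-1}\beta,$$ $$r_k:=\frac{\lambda_k^2-\tilde\lambda_k^2}{\lambda_k^2},\qquad \tilde r_k:=\frac{\lambda_k^2-\tilde\lambda_k^2}{\tilde\lambda_k^2},\qquad \hat r_k:=m_k-\tilde m_k,$$ $$T_{0k}:=\hat r_k^2\lambda_k^2(\tfrac12 r_kg_k-\tilde g_k),\qquad T_{1k}:=\hat r_k\lambda_k(r_kg_k-\tilde g_k),$$ $$T_{2k}:=\hat r_k\lambda_k g_k^{1/2}(1+\tilde r_k)^{1/2}(1-r_kG_k),\qquad T_{3k}:=\tfrac12 r_kg_k,$$ $$T_{4k}:=-\tfrac12 r_kg_k(1+\tilde r_k),\qquad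 T_{5k}:=-r_kG_kg_k^{1/2}(1+\tilde r_k)^{1/2},$$ $$\mu_k:=T_{0k}+T_{3k}+T_{4k},\qquad \sigma_k^2:=T_{1k}^2+T_{2k}^2+2T_{3k}^2+2T_{4k}^2+T_{5k}^2 .$$ Suppose there exists $\delta>0$ such that $$\lim_{d\to\infty}\frac{\sum_{k=1}^d|T_{jk}|^{2+\delta}}{\big(\sum_{k=1}^d|T_{jk}|^2\big)^{1+\delta/2}}=0\qquad\text{for } j=1,2,3,4,5 .$$ Fix $i$, and put $\mu^-:=\sum_{j=1,j\ne i}^d\mu_j$ and $(\sigma^-)^2:=\sum_{j=1,j\neq i}^d\sigma_j^2$ (with $\sigma^->0$ for all large $d$). Then, as $d\to\infty$, $$\mathrm{E}[(q_i^T(x'-x))^2]\to U_1U_2+U_3,$$ in the sense that $\mathrm{E}[(q_i^T(x'-x))^2]=U_1(U_2+o(1))+U_3$, where $$U_1=\tilde g_i^2\hat r_i^2+\frac{\tilde g_i^2}{\lambda_i^2}+\frac{g_i}{\tilde\lambda_i^2},\qquad U_2=\Phi\big(\tfrac{\mu^-}{\sigma^-}\big)+e^{\mu^-+(\sigma^-)^2/2}\,\Phi\big(-\sigma^--\tfrac{\mu^-}{\sigma^-}\big),$$ and $U_3$ is a real number (depending on $d$) satisfying $$|U_3|\le(\sigma_i^2+\mu_i^2)^{1/2}\Big(\tilde g_i^4\hat r_i^4+3\frac{\tilde g_i^4}{\lambda_i^4}+3\frac{g_i^2}{\tilde\lambda_i^4}+6\frac{\tilde g_i^4\hat r_i^2}{\lambda_i^2}+6\frac{\tilde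 g_i^2g_i\hat r_i^2}{\tilde\lambda_i^2}+6\frac{\tilde g_i^2g_i}{\lambda_i^2\tilde\lambda_i^2}\Big)^{1/2}.$$
   Context: $N(m,C)$ is the normal distribution with mean $m$ and covariance $C$; $\Phi$ is the standard normal cumulative distribution function. For each $d$ the data are $A,M,N\in\mathbb{R}^{d\times d}$ and $b,\beta\in\mathbb{R}^d$ with $A$, $\mathcal{A}=M-N$ and $M^T+N$ symmetric positive definite and $M$ invertible (so $|G_k|<1$); all data and all quantities defined from them may depend on $d$, with this dependence suppressed in the notation. $A=Q\Lambda Q^T$ is a spectral decomposition with $Q$ orthogonal, $\Lambda=\operatorname{diag}(\lambda_1^2,\dots,\lambda_d^2)$, and $q_k$ is the $k$-th column of $Q$; ''$F$ is a function of $A$'' means $F=QF(\Lambda)Q^T$ with $F(\Lambda)$ obtained by applying a scalar function to the diagonal entries of $\Lambda$. In the Metropolis–Hastings algorithm with target density $\pi$ and proposal density $q(x,\cdot)$, given $x$ one draws $y\sim q(x,\cdot)$ and sets $x'=y$ with probability $\alpha(x,y)=1\wedge\frac{\pi(y)q(y,x)}{\pi(x)q(x,y)}$, and $x'=x$ otherwise. *)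

(* Defs.v *)
From HB Require Import structures.
From mathcomp Require Import all_boot all_order all_algebra.
From mathcomp Require Import all_classical all_reals all_analysis.

Set Implicit Arguments.
Unset Strict Implicit.
Unset Printing Implicit Defensive.

Import Order.TTheory GRing.Theory Num.Theory.
Import numFieldNormedType.Exports.

Local Open Scope classical_set_scope.
Local Open Scope ring_scope.

(* The Borel sigma-algebra of R^n, i.e. the one generated by the coordinates
   (same construction as the library's instance on n.-tuple R). *)
Section measurable_cV.
Context (R : realType) (n : nat).

Definition cV_coord (i : 'I_n) (v : 'cV[R]_n) : measurableTypeR R := v i 0.

Let cV_set0 : g_sigma_preimage cV_coord set0.
Proof. exact: sigma_algebra0. Qed.

Let cV_setC B : g_sigma_preimage cV_coord B -> g_sigma_preimage cV_coord (~` B).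
Proof. exact: sigma_algebraC. Qed.

Let cV_bigcup (F : (set 'cV[R]_n)^nat) :
  (forall i, g_sigma_preimage cV_coord (F i)) ->
  g_sigma_preimage cV_coord (\bigcup_i (F i)).
Proof. exact: sigma_algebra_bigcup. Qed.

HB.instance Definition _ := @isMeasurable.Build default_measure_display
  'cV[R]_n (g_sigma_preimage cV_coord) cV_set0 cV_setC cV_bigcup.

End measurable_cV.

Section matrices.
Context (R : realType) (n : nat).
Implicit Types C F Q S : 'M[R]_n.

Definition posdefmx C : Prop :=
  C \is symmetricmx /\ forall v : 'cV[R]_n, v != 0 -> 0 < (v^T *m C *m v) 0 0.

Definition possemidefmx C : Prop :=
  C \is symmetricmx /\ forall v : 'cV[R]_n, 0 <= (v^T *m C *m v) 0 0.

(* S = C^(1/2) *)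
Definition is_sqrtmx S C : Prop := possemidefmx S /\ S *m S = C.

(* F is a function of Q diag(l) Q^T *)
Definition is_function_of Q (l : 'I_n -> R) F : Prop :=
  exists f : R -> R, F = Q *m diag_mx (\row_k f (l k)) *m Q^T.

End matrices.

Section normal_vectors.
Context (R : realType) (d : measure_display) (T : measurableType d)
  (P : probability T R).

(* Phi *)
Definition normal_cdf (t : R) : R := fine (normal_prob 0 1 `]-oo, t]%classic).

Definition independent_RV d1 d2 (T1 : measurableType d1) (T2 : measurableType d2)
    (X : {RV P >-> T1}) (Y : {RV P >-> T2}) : Prop :=
  forall (A : set T1) (B : set T2), measurable A -> measurable B ->
    P (X @^-1` A `&` Y @^-1` B) = (P (X @^-1` A) * P (Y @^-1` B))%E.

(* The coordinates of Z are independent N(0, 1) variables. *)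
Definition is_std_normal n (Z : {RV P >-> 'cV[R]_n}) : Prop :=
  forall B : 'I_n -> set (measurableTypeR R), (forall k, measurable (B k)) ->
    P [set w | forall k, B k (Z w k 0)] = (\prod_k normal_prob 0 1 (B k))%E.

(* X ~ N(m, C): X is an affine image m + L Z of a standard normal vector, with
   L L^T = C.  When C is invertible, Z is determined by X and L, so requiring
   it to live on the same sample space is no restriction. *)
Definition is_normal n (X : {RV P >-> 'cV[R]_n}) (m : 'cV[R]_n) (C : 'M[R]_n) :
    Prop :=
  exists (L : 'M[R]_n) (Z : {RV P >-> 'cV[R]_n}),
    [/\ L *m L^T = C, is_std_normal Z & forall w, X w = m + L *m Z w].

(* Lebesgue density of N(m, C), C positive definite *)
Definition mvnormal_pdf n (m : 'cV[R]_n) (C : 'M[R]_n) (x : 'cV[R]_n) : R :=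
  (Num.sqrt ((2 * pi) ^+ n * \det C))^-1 *
  expR (- (((x - m)^T *m invmx C *m (x - m)) 0 0) / 2).

End normal_vectors.

Section metropolis_hastings.
Context (R : realType) (d : measure_display) (T : measurableType d)
  (P : probability T R) (d' : measure_display) (E : measurableType d').

Definition MH_accept (target : E -> R) (q : E -> E -> R) (x y : E) : R :=
  Num.min 1 (target y * q y x / (target x * q x y)).

(* acc is the event that the proposal y is accepted; the last clause says that
   its conditional probability given (x, y) is MH_accept target q x y. *)
Definition MH_step (target : E -> R) (q : E -> E -> R)
    (x y x' : {RV P >-> E}) : Prop :=
  exists acc : set T,
    [/\ measurable acc,
        forall w, acc w -> x' w = y w,
        forall w, ~ acc w -> x' w = x w
      & forall B : set (E * E), measurable B ->
          P (acc `&` [set w | B (x w, y w)]) =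
          (\int[P]_(w in [set w | B (x w, y w)])
             (MH_accept target q (x w) (y w))%:E)%E].

End metropolis_hastings.

Record ar_data (R : realType) (d : nat) := ARData {
  dA : 'M[R]_d;
  dM : 'M[R]_d;
  dN : 'M[R]_d;
  db : 'cV[R]_d;
  dbeta : 'cV[R]_d;
  dQ : 'M[R]_d;          (* orthonormal eigenvectors q_k, as columns *)
  dlam : 'I_d -> R;      (* lambda_k *)
  dlamt : 'I_d -> R;     (* tilde lambda_k *)
  dGk : 'I_d -> R        (* G_k *)
}.

Section ar_process.
Context (R : realType) (d : nat) (D : ar_data R d).
Local Notation A := (dA D).
Local Notation M := (dM D).
Local Notation N := (dN D).
Local Notation b := (db D).
Local Notation beta := (dbeta D).

Definition calA : 'M[R]_d := M - N.
Definition itG : 'M[R]_d := invmx M *m N.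
Definition prop_mean (x : 'cV[R]_d) : 'cV[R]_d := itG *m x + invmx M *m beta.
Definition prop_cov : 'M[R]_d := invmx calA - itG *m invmx calA *m itG^T.

Definition target_pdf : 'cV[R]_d -> R := mvnormal_pdf (invmx A *m b) (invmx A).
Definition proposal_pdf (x : 'cV[R]_d) : 'cV[R]_d -> R :=
  mvnormal_pdf (prop_mean x) prop_cov.

Definition eigvec (k : 'I_d) : 'cV[R]_d := col k (dQ D).

Record splitting_hyp : Prop := {
  A_posdef : posdefmx A;
  calA_posdef : posdefmx calA;
  MTN_posdef : posdefmx (M^T + N);
  M_unit : M \in unitmx
}.

Record spectral_hyp : Prop := {
  Q_orth : (dQ D)^T *m dQ D = 1%:M;
  lam_gt0 : forall k, 0 < dlam D k;
  lamt_gt0 : forall k, 0 < dlamt D k;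
  A_spectral : A = dQ D *m diag_mx (\row_k dlam D k ^+ 2) *m (dQ D)^T;
  M_fun : is_function_of (dQ D) (fun k => dlam D k ^+ 2) M;
  N_fun : is_function_of (dQ D) (fun k => dlam D k ^+ 2) N;
  calA_eig : forall k, calA *m eigvec k = dlamt D k ^+ 2 *: eigvec k;
  itG_eig : forall k, itG *m eigvec k = dGk D k *: eigvec k
}.

(* y = G x + M^-1 beta + (calA^-1 - G calA^-1 G^T)^(1/2) xi, with xi ~ N(0, I)
   drawn independently of the current state x *)
Definition is_proposal d' (T : measurableType d') (P : probability T R)
    (x y : {RV P >-> 'cV[R]_d}) : Prop :=
  exists (S : 'M[R]_d) (xi : {RV P >-> 'cV[R]_d}),
    [/\ is_sqrtmx S prop_cov, is_normal xi 0 1%:M, independent_RV x xi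
      & forall w, y w = prop_mean (x w) + S *m xi w].

Definition g_tilde k : R := 1 - dGk D k.
Definition g_ k : R := 1 - dGk D k ^+ 2.
Definition m_ k : R := ((eigvec k)^T *m invmx A *m b) 0 0.
Definition m_tilde k : R := ((eigvec k)^T *m invmx calA *m beta) 0 0.
Definition r_ k : R := (dlam D k ^+ 2 - dlamt D k ^+ 2) / dlam D k ^+ 2.
Definition r_tilde k : R := (dlam D k ^+ 2 - dlamt D k ^+ 2) / dlamt D k ^+ 2.
Definition r_hat k : R := m_ k - m_tilde k.

Definition T0 k : R := r_hat k ^+ 2 * dlam D k ^+ 2 * (2^-1 * r_ k * g_ k - g_tilde k).
Definition T1 k : R := r_hat k * dlam D k * (r_ k * g_ k - g_tilde k).
Definition T2 k : R := r_hat k * dlam D k * Num.sqrt (g_ k) *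
  Num.sqrt (1 + r_tilde k) * (1 - r_ k * dGk D k).
Definition T3 k : R := 2^-1 * r_ k * g_ k.
Definition T4 k : R := - (2^-1 * r_ k * g_ k * (1 + r_tilde k)).
Definition T5 k : R :=
  - (r_ k * dGk D k * Num.sqrt (g_ k) * Num.sqrt (1 + r_tilde k)).

Definition mu k : R := T0 k + T3 k + T4 k.
Definition sigma2 k : R :=
  T1 k ^+ 2 + T2 k ^+ 2 + 2 * T3 k ^+ 2 + 2 * T4 k ^+ 2 + T5 k ^+ 2.

(* for t one of T1, ..., T5; equal to 0 when t is identically 0 *)
Definition lyapunov_ratio (delta : R) (t : 'I_d -> R) : R :=
  (\sum_(k < d) `|t k| `^ (2 + delta)) /
  (\sum_(k < d) `|t k| ^+ 2) `^ (1 + delta / 2).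

Definition mu_minus (i : 'I_d) : R := \sum_(j < d | j != i) mu j.
Definition sigma_minus (i : 'I_d) : R :=
  Num.sqrt (\sum_(j < d | j != i) sigma2 j).

Definition U1 i : R :=
  g_tilde i ^+ 2 * r_hat i ^+ 2 + g_tilde i ^+ 2 / dlam D i ^+ 2 + g_ i / dlamt D i ^+ 2.

Definition U2 i : R :=
  normal_cdf (mu_minus i / sigma_minus i) +
  expR (mu_minus i + sigma_minus i ^+ 2 / 2) *
    normal_cdf (- sigma_minus i - mu_minus i / sigma_minus i).

Definition U3_bound i : R :=
  Num.sqrt (sigma2 i + mu i ^+ 2) *
  Num.sqrt (g_tilde i ^+ 4 * r_hat i ^+ 4
    + 3 * (g_tilde i ^+ 4 / dlam D i ^+ 4)
    + 3 * (g_ i ^+ 2 / dlamt D i ^+ 4)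
    + 6 * (g_tilde i ^+ 4 * r_hat i ^+ 2 / dlam D i ^+ 2)
    + 6 * (g_tilde i ^+ 2 * g_ i * r_hat i ^+ 2 / dlamt D i ^+ 2)
    + 6 * (g_tilde i ^+ 2 * g_ i / (dlam D i ^+ 2 * dlamt D i ^+ 2))).

End ar_process.

(* Main.v *)
Require Import Defs.
From HB Require Import structures.
From mathcomp Require Import all_boot all_order all_algebra.
From mathcomp Require Import all_classical all_reals all_analysis.
From mathcomp Require Import measurable_realfun.
From mathcomp Require Import ring lra.

Set Implicit Arguments.
Unset Strict Implicit.
Unset Printing Implicit Defensive.

Import Order.TTheory GRing.Theory Num.Theory.
Import numFieldNormedType.Exports.

Local Open Scope classical_set_scope.
Local Open Scope ring_scope.

(** In the eigenbasis of A everything decouples. The standardised coordinates of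
the current state and of the proposal noise along the q_k form a family of
independent pairs of independent N(0, 1) variables ([iid_coords]); this rests on
the invariance of the Gaussian law under orthogonal matrices
([orthogonal_stable]). In these coordinates the logarithm of the
Metropolis-Hastings ratio is a sum over k of quadratic polynomials in the k-th
pair, with coefficients T_0k, ..., T_5k ([MH_acceptE]), and the proposed
displacement along q_k is affine in the k-th pair ([coef_jump]). Hence the mean
squared jump along q_i is the expectation of (proposed displacement)^2 times
(acceptance probability) ([MH_expectation]).

Drop the i-th term from the log-ratio inside the acceptance probability. What is
lost is U_3: since s |-> min(1, e^s) is 1-Lipschitz, the loss is at most the
expectation of the squared displacement times the absolute value of the i-th
term, and Cauchy-Schwarz together with exact Gaussian moments gives the stated
bound ([remainder_bound]). What remains is a product of two independent factors,
whose expectations are U_1 and the expected acceptance probability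
E[min(1, e^S)], where S is the sum of the other terms ([MH_expectation_split]).

It remains to see that E[min(1, e^S)] - U_2 tends to 0. If S were exactly
N(mu^-, (sigma^-)^2) the expectation would be U_2 ([gauss_accept_fun]). The
summands of S have means mu_j and variances sigma_j^2, and their third absolute central
moments are at most a universal constant times sigma_j^3, because a quadratic
polynomial is dominated by its standard deviation times a fixed polynomial
([centred_le]). Lindeberg's replacement argument ([lindeberg]) then bounds the
distance between (S - mu^-) / sigma^- and N(0, 1), tested on smooth functions, by
a constant times the largest sigma_j / sigma^- ([rest_noise_close]). The
Lyapunov condition on each of the five families makes this ratio small
([lyapunov_max_share], [sigma2_max_share]). A logistic smoothing of indicators
turns closeness on smooth functions into closeness of distribution functions,
with a modulus that depends on nothing else ([kolmogorov_close]). Finally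
min(1, e^(m + s x)) is monotone in x with values in [0, 1], so its expectation is
an average of tail probabilities and is controlled uniformly in m and s
([accept_fun_close]). *)

(** * Integration against densities and laws *)

Section density.
Local Open Scope ereal_scope.
Context d1 d2 (T : measurableType d1) (E : measurableType d2) (R : realType).
Variables (P : {measure set T -> \bar R}) (nu : {measure set E -> \bar R}).
Variables (V : T -> E) (mV : measurable_fun setT V).
Variables (a : T -> R) (ma : measurable_fun setT a) (a0 : forall t, (0 <= a t)%R).
Hypothesis nuE : forall B, measurable B -> nu B = \int[P]_(t in V @^-1` B) (a t)%:E.

Import HBNNSimple.

Let mpre B : measurable B -> measurable (V @^-1` B).
Proof. by move=> mB; rewrite -(setTI (_ @^-1` _)); exact: mV. Qed.

Let integral_density_nnsfun (h : {nnsfun E >-> R}) :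
  \int[nu]_y (h y)%:E = \int[P]_t ((h (V t))%:E * (a t)%:E).
Proof.
have mha r : measurable_fun setT
    ((fun t => (r * \1_(h @^-1` [set r]) (V t))%:E * (a t)%:E) : T -> \bar R).
  apply: emeasurable_funM; last exact/measurable_EFinP.
  by apply/measurable_EFinP/measurable_funM => //; exact: measurableT_comp.
transitivity (\int[nu]_y
    (\sum_(r \in range h) (r * \1_(h @^-1` [set r]) y)%:E)).
  by apply: eq_integral => y _; rewrite fimfunE -fsumEFin.
rewrite ge0_integral_fsum//; last 2 first.
  - by move=> r; exact/measurable_EFinP/measurable_funM.
  - by move=> r y _; exact: nnfun_muleindic_ge0.
transitivity (\int[P]_t
    (\sum_(r \in range h) (r * \1_(h @^-1` [set r]) (V t))%:E * (a t)%:E)).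
  rewrite ge0_integral_fsum//; last first.
    move=> r t _; rewrite mule_ge0 ?lee_fin//.
    exact: nnfun_muleindic_ge0.
  apply: eq_fsbigr => r /[!inE] -[y _ hy].
  have r0 : (0 <= r)%R by rewrite -hy.
  rewrite integralZl_indic_nnsfun// integral_indic// setIT nuE//.
  rewrite integral_mkcond -ge0_integralZl//=; last 2 first.
  - apply: (iffLR (measurable_restrictT _ _)); first exact: mpre.
    by apply: measurable_funTS; exact/measurable_EFinP.
  - by move=> t _; rewrite patchE; case: ifP => // _; rewrite lee_fin.
  apply: eq_integral => t _; rewrite patchE EFinM -muleA; congr *%E.
  rewrite indicE; have [tA|tA] := boolP (t \in V @^-1` (h @^-1` [set r])).
    by rewrite (_ : V t \in _ = true) ?mul1e//; exact: mem_set (set_mem tA).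
  rewrite (_ : V t \in _ = false) ?mul0e//; apply/negbTE.
  by rewrite notin_setE => ht; move: tA; rewrite notin_setE; apply.
apply: eq_integral => t _.
rewrite -ge0_mule_fsuml; last by move=> r; exact: nnfun_muleindic_ge0.
by rewrite fsumEFin// -fimfunE.
Qed.

(** A weight known on events only determines integrals, by approximation with
simple functions. It serves twice: for the normal density, and for the acceptance
event, whose indicator and whose conditional probability are two weights of the
same measure. *)
Lemma ge0_integral_density (F : E -> \bar R) :
  measurable_fun setT F -> (forall y, 0 <= F y) ->
  \int[nu]_y F y = \int[P]_t (F (V t) * (a t)%:E).
Proof.
move=> mF F0; pose h := nnsfun_approx measurableT mF.
have hF y : (EFin \o h ^~ y) @ \oo --> F y by exact: cvg_nnsfun_approx.
have -> : \int[nu]_y F y = limn (fun n => \int[nu]_y (h n y)%:E).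
  rewrite -monotone_convergence//.
  - by apply: eq_integral => y _; apply/esym/cvg_lim => //; exact: hF.
  - by move=> n; exact/measurable_EFinP.
  - by move=> n y _; rewrite lee_fin.
  - by move=> y _ m n mn; rewrite lee_fin; exact/lefP/nd_nnsfun_approx.
under eq_fun do rewrite integral_density_nnsfun.
rewrite -monotone_convergence//.
- apply: eq_integral => t _; apply/cvg_lim => //; apply: cvgeZr => //.
  exact: hF.
- move=> n; apply: emeasurable_funM; apply/measurable_EFinP => //.
  exact: measurableT_comp.
- by move=> n t _; rewrite mule_ge0 ?lee_fin.
- move=> t _ m n mn; rewrite lee_wpmul2r ?lee_fin//.
  exact/lefP/nd_nnsfun_approx.
Qed.

End density.

Section transfer.
Local Open Scope ereal_scope.
Context d1 d2 (T : measurableType d1) (E : measurableType d2) (R : realType).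
Variables (P : {measure set T -> \bar R}) (Q : {measure set E -> \bar R}).
Variables (phi : T -> E) (mphi : measurable_fun setT phi).
Hypothesis PQ : forall F : E -> \bar R, measurable_fun setT F ->
  (forall y, 0 <= F y) -> \int[P]_t F (phi t) = \int[Q]_y F y.

Lemma integrable_transfer (f : E -> R) :
  Q.-integrable setT (EFin \o f) ->
  P.-integrable setT (EFin \o (fun t => f (phi t))).
Proof.
move=> /integrableP[mf fi]; have /measurable_EFinP mf' := mf.
apply/integrableP; split.
  by apply/measurable_EFinP; exact: (measurableT_comp mf').
rewrite (PQ (F := fun y => `|(f y)%:E|))//.
exact: measurableT_comp.
Qed.

Lemma Rintegral_transfer (f : E -> R) :
  Q.-integrable setT (EFin \o f) ->
  (\int[P]_t f (phi t) = \int[Q]_y f y)%R.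
Proof.
move=> fi; have mf := measurable_int _ fi; congr fine.
rewrite integralE [RHS]integralE; congr (_ - _).
  rewrite -(PQ (F := (EFin \o f)^\+))//.
    by apply: eq_integral => t _; rewrite !funeposE.
  exact: measurable_funepos.
rewrite -(PQ (F := (EFin \o f)^\-))//.
  by apply: eq_integral => t _; rewrite !funenegE.
exact: measurable_funeneg.
Qed.

End transfer.

Section product_integral.
Context d1 d2 (T1 : measurableType d1) (T2 : measurableType d2) (R : realType).
Variables (m1 : probability T1 R) (m2 : probability T2 R).
Variables (f : T1 -> R) (g : T2 -> R).
Hypotheses (fi : m1.-integrable setT (EFin \o f))
  (gi : m2.-integrable setT (EFin \o g)).

Lemma integrable_prodM :
  (m1 \x m2)%E.-integrable setT (EFin \o (fun z => f z.1 * g z.2)).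
Proof.
have /integrableP[/measurable_EFinP mf fy] := fi.
have /integrableP[/measurable_EFinP mg gy] := gi.
apply/integrable12ltyP.
  by apply/measurable_EFinP/measurable_funM; exact: measurableT_comp.
under eq_integral => x _.
  under eq_integral do rewrite /= normrM EFinM.
  rewrite ge0_integralZl//=; last exact/measurable_EFinP/measurableT_comp.
  over.
rewrite ge0_integralZr//=.
- by rewrite lte_mul_pinfty// ?integral_ge0// ge0_fin_numE// integral_ge0.
- exact/measurable_EFinP/measurableT_comp.
- exact: integral_ge0.
Qed.

Lemma Rintegral_prodM :
  \int[(m1 \x m2)%E]_z (f z.1 * g z.2) = (\int[m1]_x f x) * (\int[m2]_y g y).
Proof.
rewrite /Rintegral -(integral12_prod_meas1 integrable_prodM)/= /fubini_F/=.
have gfin : (\int[m2]_y (g y)%:E)%E \is a fin_num by exact: integrable_fin_num.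
under eq_integral => x _.
  rewrite (_ : (fun y => (f x * g y)%:E) = (fun y => (f x)%:E * (g y)%:E)%E)//.
  rewrite integralZl// -(fineK gfin).
  over.
by rewrite integralZr//= fineM// integrable_fin_num.
Qed.

End product_integral.

Section integrable_real.
Context d (T : measurableType d) (R : realType) (P : probability T R).
Local Notation "'rint' f" := (P.-integrable setT (EFin \o f)) (at level 10, f at level 9).
Implicit Types f g : T -> R.

Lemma rintegrable_cst (k : R) : rint (fun=> k).
Proof. exact: finite_measure_integrable_cst. Qed.

Lemma rintegrableZ (k : R) f : rint f -> rint (fun t => k * f t).
Proof. by move=> fi; exact: (integrableZl measurableT k fi). Qed.

Lemma rintegrableD f g : rint f -> rint g -> rint (fun t => f t + g t).
Proof. by move=> fi gi; exact: (integrableD measurableT fi gi). Qed.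

Lemma rintegrableB f g : rint f -> rint g -> rint (fun t => f t - g t).
Proof. by move=> fi gi; exact: (integrableB measurableT fi gi). Qed.

Lemma rintegrable_le f g : measurable_fun setT f ->
  (forall t, `|f t| <= g t) -> rint g -> rint f.
Proof.
move=> mf fg gi; apply: (le_integrable measurableT _ _ gi).
  exact/measurable_EFinP.
by move=> t _ /=; rewrite lee_fin (le_trans (fg t))// ler_norm.
Qed.

Lemma rintegrable_bounded (B : R) f : measurable_fun setT f ->
  (forall t, `|f t| <= B) -> rint f.
Proof.
by move=> mf fB; apply: (rintegrable_le mf fB); exact: rintegrable_cst.
Qed.

Lemma Rintegral_probability_cst (k : R) : \int[P]_t k = k.
Proof. by rewrite Rintegral_cst// [X in fine X]probability_setT mulr1. Qed.

Lemma ler_Rintegral f g : rint f -> rint g -> (forall t, f t <= g t) ->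
  \int[P]_t f t <= \int[P]_t g t.
Proof. by move=> fi gi fg; apply: le_Rintegral => // t _; exact: fg. Qed.

Lemma ler_norm_Rintegral (B : R) f : rint f -> (forall t, `|f t| <= B) ->
  `|\int[P]_t f t| <= B.
Proof.
move=> fi fB; apply: le_trans (le_normr_Rintegral measurableT fi) _.
rewrite -[leRHS]Rintegral_probability_cst.
apply: ler_Rintegral => //; last exact: rintegrable_cst.
exact: integrable_norm.
Qed.

Lemma EFin_Rintegral f : rint f -> (\int[P]_t (f t)%:E)%E = (\int[P]_t f t)%:E.
Proof. by move=> fi; rewrite fineK//; exact: integrable_fin_num. Qed.

End integrable_real.

Section fubini_bounded.
Context d1 d2 (T1 : measurableType d1) (T2 : measurableType d2) (R : realType).
Variables (m1 : probability T1 R) (m2 : probability T2 R).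
Variables (f : T1 * T2 -> R) (B : R).
Hypotheses (mf : measurable_fun setT f) (fB : forall z, `|f z| <= B).

Let fi : (m1 \x m2)%E.-integrable setT (EFin \o f).
Proof. exact: rintegrable_bounded mf fB. Qed.

Let fxi x : m2.-integrable setT (EFin \o (fun y => f (x, y))).
Proof.
apply: (@rintegrable_bounded _ _ _ _ B) => //.
exact: measurableT_comp.
Qed.

Lemma measurable_Rintegral_snd : measurable_fun setT (fun x => \int[m2]_y f (x, y)).
Proof.
have := measurable_fubini_F fi; rewrite /fubini_F => H.
by apply: measurableT_comp H; exact: fine_measurable.
Qed.

Lemma Rintegral_fubini_bounded :
  \int[m1]_x \int[m2]_y f (x, y) = \int[(m1 \x m2)%E]_z f z.
Proof.
rewrite /Rintegral -(integral12_prod_meas1 fi) /fubini_F; congr fine.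
apply: eq_integral => x _.
by rewrite (EFin_Rintegral (fxi x)).
Qed.

End fubini_bounded.

(** * Independent families and partial sums *)

Section joint_law.
Local Open Scope ereal_scope.
Context d d1 d2 (T : measurableType d) (T1 : measurableType d1)
  (T2 : measurableType d2) (R : realType) (P : probability T R)
  (mu1 : probability T1 R) (mu2 : probability T2 R).
Variables (X : T -> T1) (Y : T -> T2).
Hypotheses (mX : measurable_fun setT X) (mY : measurable_fun setT Y).

Let mXY : measurable_fun setT (fun t => (X t, Y t)).
Proof. exact: measurable_fun_pair. Qed.

Let XY : {mfun T >-> (T1 * T2)%type} := mfun_Sub (mem_set mXY).

(** The event [A] carries whatever is known about the other variables; given [A],
rectangles determine the law of the pair by uniqueness of the product measure. *)
Lemma joint_law_on_event (A : set T) : measurable A ->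
    (forall B C, measurable B -> measurable C ->
      P (A `&` (X @^-1` B `&` Y @^-1` C)) = P A * (mu1 B * mu2 C)) ->
  forall D, measurable D ->
    P (A `&` [set t | D (X t, Y t)]) = P A * (mu1 \x mu2) D.
Proof.
move=> mA H D mD.
have PAfin : P A \is a fin_num by exact: fin_num_measure.
have mXYD D' : measurable D' -> measurable [set t | D' (X t, Y t)].
  by move=> mD'; rewrite -[X in measurable X]setTI; exact: mXY.
have [PA0|PA0] := eqVneq (P A) 0.
  rewrite PA0 mul0e; apply/eqP; rewrite eq_le measure_ge0 andbT -PA0.
  by apply: le_measure; rewrite ?inE//; apply: measurableI => //; exact: mXYD.
have p0 : (0 < fine (P A))%R.
  by rewrite fine_gt0// ltey_eq PAfin andbT lt0e PA0 measure_ge0.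
have q0 : (0 <= (fine (P A))^-1)%R by rewrite invr_ge0 ltW.
pose push := pushforward (mrestr P mA) XY : {measure set (T1 * T2) -> \bar R}.
pose m' : {measure set (T1 * T2) -> \bar R} := mscale (NngNum q0) (push mXY).
have m'E B : m' B = (fine (P A))^-1%:E * P ([set t | B (X t, Y t)] `&` A) by [].
rewrite (@product_measure_unique _ _ _ _ _ mu1 mu2 m')// => [|B C mB mC].
  by rewrite m'E muleA -{1}(fineK PAfin) -EFinM divff ?gt_eqF// mul1e setIC.
rewrite m'E setIC (_ : [set t | _] = X @^-1` B `&` Y @^-1` C)//.
by rewrite H// muleA -{2}(fineK PAfin) -EFinM mulVf ?gt_eqF// mul1e.
Qed.

Hypothesis XYindep : forall B C, measurable B -> measurable C ->
  P (X @^-1` B `&` Y @^-1` C) = mu1 B * mu2 C.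

Lemma joint_lawE D : measurable D ->
  P [set t | D (X t, Y t)] = (mu1 \x mu2) D.
Proof.
move=> mD; rewrite -[X in P X]setTI joint_law_on_event//.
  by rewrite probability_setT mul1e.
by move=> B C mB mC; rewrite setTI probability_setT mul1e XYindep.
Qed.

Lemma ge0_integral_joint_law (F : T1 * T2 -> \bar R) :
  measurable_fun setT F -> (forall z, 0 <= F z) ->
  \int[P]_t F (X t, Y t) = \int[mu1 \x mu2]_z F z.
Proof.
move=> mF F0; rewrite -[LHS](@ge0_integral_distribution _ _ _ _ _ P XY F mF F0).
by apply: eq_measure_integral => D mD _; exact: joint_lawE.
Qed.

Lemma independent_prodM (f : T1 -> R) (g : T2 -> R) :
  mu1.-integrable setT (EFin \o f) -> mu2.-integrable setT (EFin \o g) ->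
  P.-integrable setT (EFin \o (fun t => f (X t) * g (Y t))%R) /\
  (\int[P]_t (f (X t) * g (Y t)) = (\int[mu1]_x f x) * (\int[mu2]_y g y))%R.
Proof.
move=> fi gi; have fgi := integrable_prodM fi gi; split.
  exact: (integrable_transfer mXY ge0_integral_joint_law fgi).
by rewrite -(Rintegral_prodM fi gi) -(Rintegral_transfer ge0_integral_joint_law fgi).
Qed.

End joint_law.

Section iid.
Local Open Scope ereal_scope.
Context d d' (T : measurableType d) (E : measurableType d') (R : realType)
  (P : probability T R) (mu : probability E R).

Definition iid (I : finType) (V : I -> T -> E) :=
  forall B : I -> set E, (forall j, measurable (B j)) ->
    P [set t | forall j, B j (V j t)] = \prod_j mu (B j).

Context (I : finType) (V : I -> T -> E).
Hypotheses (mV : forall j, measurable_fun setT (V j)) (iidV : iid V).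

Let mVpre j B : measurable B -> measurable (V j @^-1` B).
Proof. by move=> mB; rewrite -(setTI (_ @^-1` _)); exact: mV. Qed.

Lemma measurable_iid_box (B : I -> set E) (p : pred I) :
  (forall j, measurable (B j)) ->
  measurable [set t | forall j, p j -> B j (V j t)].
Proof.
move=> mB; rewrite (_ : mkset _ = \bigcap_(j in [set j | p j]) (V j @^-1` B j))//.
by apply: fin_bigcap_measurable => // j _; exact: mVpre.
Qed.

Lemma iid_sub (B : I -> set E) (p : pred I) : (forall j, measurable (B j)) ->
  P [set t | forall j, p j -> B j (V j t)] = \prod_(j | p j) mu (B j).
Proof.
move=> mB; rewrite [RHS]big_mkcond/=.
transitivity (P [set t | forall j, (if p j then B j else setT) (V j t)]).
  congr (P _); apply/seteqP; split => t H j.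
    by case: ifP => // /H.
  by move=> pj; have := H j; rewrite pj.
rewrite (iidV (B := fun j => if p j then B j else setT)); last first.
  by move=> j; case: ifP.
by apply: eq_bigr => j _; case: ifP; rewrite ?probability_setT.
Qed.

Lemma iid_law i B : measurable B -> P (V i @^-1` B) = mu B.
Proof.
move=> mB; rewrite (_ : V i @^-1` B = [set t | forall j, j == i -> B (V j t)]).
  by rewrite (@iid_sub (fun=> B) (pred1 i))// big_pred1_eq.
by apply/seteqP; split => t /=; [move=> ? j /eqP ->|exact].
Qed.

Variable psi : I -> E -> R.
Hypothesis mpsi : forall j, measurable_fun setT (psi j).
Definition psum (r : seq I) t : R := (\sum_(j <- r) psi j (V j t))%R.

Lemma measurable_psum r : measurable_fun setT (psum r).
Proof.
by apply: measurable_sum => j; exact: measurableT_comp.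
Qed.

Let S r : {mfun T >-> R} := mfun_Sub (mem_set (measurable_psum r)).

(** The next summand is absorbed one at a time: on the event that the remaining
variables lie in a box, the pair (partial sum, next variable) has a product law.
The box is what makes the induction go through. *)
Lemma psum_box r (A : set R) (B : I -> set E) :
  uniq r -> measurable A -> (forall j, measurable (B j)) ->
  P ([set t | forall j, j \notin r -> B j (V j t)] `&` psum r @^-1` A) =
  P (psum r @^-1` A) * \prod_(j | j \notin r) mu (B j).
Proof.
elim: r A B => [|i r IH] A B /=.
  move=> _ mA mB; have [A0|A0] := pselect (A 0%R).
    have -> : psum [::] @^-1` A = setT.
      by apply/seteqP; split=> // t _; rewrite /psum /= big_nil.
    by rewrite setIT probability_setT mul1e (@iid_sub B (fun j => j \notin [::])).
  have -> : psum [::] @^-1` A = set0.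
    by apply/seteqP; split=> // t; rewrite /psum /= big_nil.
  by rewrite setI0 measure0 mul0e.
move=> /andP[ir ur] mA mB.
pose D := [set z : R * E | A (psi i z.2 + z.1)%R].
have mD : measurable D.
  rewrite -[X in measurable X]setTI.
  have : measurable_fun [set: R * E] (fun z => (psi i z.2 + z.1)%R).
    apply: measurable_funD => //.
    exact: measurableT_comp.
  by apply.
have psumE t : A (psum (i :: r) t) = D (psum r t, V i t).
  by rewrite /D /psum /= big_cons.
have key (B' : I -> set E) : (forall j, measurable (B' j)) ->
   P ([set t | forall j, j \notin i :: r -> B' j (V j t)] `&` psum (i :: r) @^-1` A) =
   P [set t | forall j, j \notin i :: r -> B' j (V j t)] *
   (distribution P (S r) \x mu) D.
  move=> mB'.
  rewrite (_ : psum (i :: r) @^-1` A = [set t | D (psum r t, V i t)]); last first.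
    by apply/seteqP; split => t /=; rewrite psumE.
  apply: joint_law_on_event => //; first exact: measurable_psum.
    exact: (@measurable_iid_box B' (fun j => j \notin i :: r)).
  move=> B1 C mB1 mC.
  rewrite (@iid_sub B' (fun j => j \notin i :: r))//.
  pose B2 j := if j == i then C else B' j.
  transitivity (P ([set t | forall j, j \notin r -> B2 j (V j t)] `&` psum r @^-1` B1)).
    congr (P _); apply/seteqP; split => t /=.
      move=> [H [SB VC]]; split => // j jr; rewrite /B2; case: eqVneq => [->//|ji].
      by apply: H; rewrite inE negb_or ji.
    move=> [H SB]; split.
      move=> j; rewrite inE negb_or => /andP[ji jr].
      by have := H j jr; rewrite /B2 (negbTE ji).
    by split => //; have := H i ir; rewrite /B2 eqxx.
  rewrite IH//; last by move=> j; rewrite /B2; case: ifP.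
  rewrite (bigD1 i)//= {1}/B2 eqxx muleA [RHS]muleC; congr (_ * _).
  apply: eq_big => [j|j /andP[_ ji]]; first by rewrite inE negb_or andbC.
  by rewrite /B2 (negbTE ji).
have PD : P (psum (i :: r) @^-1` A) = (distribution P (S r) \x mu) D.
  have := key (fun=> setT) (fun=> measurableT).
  rewrite (_ : [set t | _] = setT); last by apply/seteqP; split.
  by rewrite setTI probability_setT mul1e.
by rewrite key// PD muleC (@iid_sub B (fun j => j \notin i :: r)).
Qed.

Lemma psum_indep r i (A : set R) (C : set E) :
  uniq r -> i \notin r -> measurable A -> measurable C ->
  P (psum r @^-1` A `&` V i @^-1` C) = P (psum r @^-1` A) * mu C.
Proof.
move=> ur ir mA mC; pose B j := if j == i then C else setT.
have mB j : measurable (B j) by rewrite /B; case: ifP.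
rewrite setIC (_ : V i @^-1` C = [set t | forall j, j \notin r -> B j (V j t)]).
  rewrite psum_box//; congr (_ * _); rewrite (bigD1 i)//= {1}/B eqxx.
  rewrite big1 ?mule1// => j /andP[_ ji].
  by rewrite /B (negbTE ji) probability_setT.
apply/seteqP; split => t /=.
  by move=> Ct j jr; rewrite /B; case: eqP => [->|].
by move=> /(_ i ir); rewrite /B eqxx.
Qed.

End iid.

Section iid_pair.
Local Open Scope ereal_scope.
Context d d1 d2 (T : measurableType d) (E1 : measurableType d1)
  (E2 : measurableType d2) (R : realType)
  (P : probability T R) (mu1 : probability E1 R) (mu2 : probability E2 R).
Context (I : finType) (X : I -> T -> E1) (Y : I -> T -> E2).
Hypotheses (mX : forall j, measurable_fun setT (X j))
  (mY : forall j, measurable_fun setT (Y j)).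
Hypothesis boxXY : forall B C,
  (forall j, measurable (B j)) -> (forall j, measurable (C j)) ->
  P [set t | forall j, B j (X j t) /\ C j (Y j t)] =
  \prod_j (mu1 (B j) * mu2 (C j)).

(** Boxes in each coordinate of the pair are traded for arbitrary events of the
product space, one index at a time. *)
Lemma iid_pair : iid P (mu1 \x mu2)%E (fun j t => (X j t, Y j t)).
Proof.
move=> D mD.
suff H (r : seq I) B C : uniq r ->
    (forall j, measurable (B j)) -> (forall j, measurable (C j)) ->
    P [set t | forall j, (if j \in r then D j else B j `*` C j) (X j t, Y j t)] =
    \prod_j (if j \in r then (mu1 \x mu2) (D j) else mu1 (B j) * mu2 (C j)).
  have := H (enum I) (fun=> setT) (fun=> setT) (enum_uniq _)
    (fun=> measurableT) (fun=> measurableT).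
  under eq_bigr do rewrite mem_enum/=; move=> <-; congr (P _).
  by apply/seteqP; split => t H' j; have := H' j; rewrite mem_enum.
elim: r B C => [|i r IH] B C /=; first by move=> _; exact: boxXY.
move=> /andP[ir ur] mB mC.
pose A := [set t | forall j, j != i ->
  (if j \in r then D j else B j `*` C j) (X j t, Y j t)].
have mA : measurable A.
  apply: (@measurable_iid_box _ _ _ _ _ (fun j t => (X j t, Y j t)) _
    (fun j => if j \in r then D j else B j `*` C j) (fun j => j != i)).
    by move=> j; exact: measurable_fun_pair.
  by move=> j; case: ifP => // _; exact: measurableX.
have step B' C' : measurable B' -> measurable C' ->
  P (A `&` (X i @^-1` B' `&` Y i @^-1` C')) =
  (mu1 B' * mu2 C') * \prod_(j | j != i)
    (if j \in r then (mu1 \x mu2) (D j) else mu1 (B j) * mu2 (C j)).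
  move=> mB' mC'.
  have := IH (fun j => if j == i then B' else B j) (fun j => if j == i then C' else C j) ur.
  rewrite (bigD1 i)//= eqxx (negbTE ir) => H.
  transitivity (P [set t | forall j, (if j \in r then D j
      else (if j == i then B' else B j) `*` (if j == i then C' else C j))
         (X j t, Y j t)]).
    congr (P _); apply/seteqP; split => t /=.
      move=> [At [Xt Yt]] j; case: (eqVneq j i) => [->|ji].
        by rewrite (negbTE ir).
      by have := At j ji.
    move=> H'; split.
      by move=> j ji; have := H' j; rewrite (negbTE ji).
    by have := H' i; rewrite (negbTE ir) eqxx => -[].
  rewrite H; [|by move=> j; case: ifP|by move=> j; case: ifP].
  congr (_ * _); apply: eq_bigr => j ji; case: ifP => // _.
  by rewrite (negbTE ji).
have PA : P A = \prod_(j | j != i)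
    (if j \in r then (mu1 \x mu2) (D j) else mu1 (B j) * mu2 (C j)).
  have := step setT setT measurableT measurableT.
  by rewrite !preimage_setT !setIT !probability_setT !mul1e.
transitivity (P (A `&` [set t | D i (X i t, Y i t)])).
  congr (P _); apply/seteqP; split => t /=.
    move=> H; split; last by have := H i; rewrite inE eqxx.
    by move=> j ji; have := H j; rewrite inE (negbTE ji).
  move=> [At Dt] j; case: (eqVneq j i) => [->|ji]; first by rewrite inE eqxx.
  by rewrite inE (negbTE ji); exact: At.
rewrite (joint_law_on_event (mu1 := mu1) (mu2 := mu2))//.
  rewrite (bigD1 i)//= inE eqxx/= muleC PA; congr (_ * _).
  by apply: eq_bigr => j ji; rewrite inE (negbTE ji).
by move=> B' C' mB' mC'; rewrite step// PA muleC.
Qed.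

End iid_pair.

(** * The planar Gaussian law is rotation invariant *)

Section lebesgue_invariance.
Local Open Scope ereal_scope.
Context {R : realType}.
Local Notation mu := (@lebesgue_measure R).

Lemma lebesgue_measure_translate (t : R) (A : set R) : measurable A ->
  pushforward mu (fun x : measurableTypeR R => (x + t)%R : measurableTypeR R) A = mu A.
Proof.
have mt : measurable_fun setT (fun x : measurableTypeR R => (x + t)%R : measurableTypeR R).
  exact: measurable_funD.
move=> mA; pose m := pushforward mu (fun x : measurableTypeR R => (x + t)%R : measurableTypeR R)
  : {measure set (measurableTypeR R) -> \bar R}.
apply/esym; apply: (lebesgue_measure_unique (mu := m mt)) => //= _ [[a b]] _ <-.
rewrite /pushforward (_ : _ @^-1` _ = `](a - t)%R, (b - t)%R]%classic).
  rewrite !lebesgue_measure_itv/= !lte_fin ltrD2r; case: ifP => // _.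
  by rewrite -!EFinD; congr EFin; ring.
by apply/seteqP; split=> x /=; rewrite !in_itv/= ltrBlDr lerBrDr.
Qed.

Lemma ge0_integral_translate (t : R) (f : R -> \bar R) :
  measurable_fun setT f -> (forall x, 0 <= f x) ->
  \int[mu]_x f (x + t)%R = \int[mu]_x f x.
Proof.
move=> mf f0.
have mt : measurable_fun setT (fun x : measurableTypeR R => (x + t)%R : measurableTypeR R).
  exact: measurable_funD.
rewrite -[LHS](@ge0_integral_pushforward _ _ _ _ R _ mt mu setT)//.
by apply: eq_measure_integral => A mA _; exact: lebesgue_measure_translate.
Qed.

Lemma ge0_integral_opp (f : R -> \bar R) :
  measurable_fun setT f -> (forall x, 0 <= f x) ->
  \int[mu]_x f (- x)%R = \int[mu]_x f x.
Proof.
move=> mf f0.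
have mt : measurable_fun setT (-%R : measurableTypeR R -> measurableTypeR R) by [].
rewrite -[LHS](@ge0_integral_pushforward _ _ _ _ R _ mt mu setT)//.
by apply: eq_measure_integral => A mA _; exact: lebesgue_measureN.
Qed.

Definition int2 (F : R * R -> \bar R) := \int[mu]_x \int[mu]_y F (x, y).

Lemma int2C F : measurable_fun setT F -> (forall z, 0 <= F z) ->
  int2 F = int2 (fun z => F (z.2, z.1)).
Proof.
by move=> mF F0; rewrite /int2 (fubini_tonelli (m1 := mu) (m2 := mu)).
Qed.

Lemma int2_shear2 (a : R) F : measurable_fun setT F -> (forall z, 0 <= F z) ->
  int2 (fun z => F (z.1, z.2 + a * z.1)%R) = int2 F.
Proof.
move=> mF F0; apply: eq_integral => x _.
rewrite (ge0_integral_translate (a * x) (f := fun y => F (x, y)))//.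
exact: measurableT_comp.
Qed.

Lemma int2_shear1 (a : R) F : measurable_fun setT F -> (forall z, 0 <= F z) ->
  int2 (fun z => F (z.1 + a * z.2, z.2)%R) = int2 F.
Proof.
move=> mF F0; pose G z := F (z.2, z.1).
have mG : measurable_fun setT G.
  by apply: measurableT_comp => //; exact: measurable_fun_pair.
transitivity (int2 (fun z => G (z.1, z.2 + a * z.1)%R)).
  apply: int2C => //; apply: measurableT_comp => //.
  apply: measurable_fun_pair => //.
  by apply: measurable_funD => //; exact: measurable_funM.
have G0 z : 0 <= G z by exact: F0.
by rewrite (int2_shear2 a mG G0) (int2C mF F0).
Qed.

(** A rotation is a product of three shears, which preserve area by translation
invariance on each line. Their slopes are [-s] and the half-angle tangent
[(1 - c) / s], whence the hypothesis on [s]. *)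
Lemma int2_rotate (c s : R) F : (c ^+ 2 + s ^+ 2 = 1)%R -> s != 0%R ->
  measurable_fun setT F -> (forall z, 0 <= F z) ->
  int2 (fun z => F (c * z.1 + s * z.2, - s * z.1 + c * z.2)%R) = int2 F.
Proof.
move=> cs s0 mF F0; pose a := ((1 - c) / s)%R.
pose F1 z := F (z.1 + a * z.2, z.2)%R.
pose F2 z := F1 (z.1, z.2 + (- s) * z.1)%R.
have mF1 : measurable_fun setT F1.
  apply: measurableT_comp => //; apply: measurable_fun_pair => //.
  by apply: measurable_funD => //; exact: measurable_funM.
have mF2 : measurable_fun setT F2.
  apply: measurableT_comp => //; apply: measurable_fun_pair => //.
  by apply: measurable_funD => //; exact: measurable_funM.
have F10 z : 0 <= F1 z by exact: F0.
have F20 z : 0 <= F2 z by exact: F0.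
rewrite -(int2_shear1 a mF F0) -(int2_shear2 (- s)%R mF1 F10).
rewrite -(int2_shear1 a mF2 F20).
have as1 : (a * s = 1 - c)%R by rewrite /a divfK.
have as2 : (a * (1 + c) = s)%R.
  by apply: (mulIf s0); rewrite mulrAC as1; move: cs; rewrite !expr2; lra.
rewrite /F2 /F1 /int2; apply: eq_integral => x _; apply: eq_integral => y _ /=.
congr (F (_, _)).
  transitivity (x - (a * s) * x + (2 * a - a * (a * s)) * y)%R; last by ring.
  by rewrite as1 -[in LHS]as2; ring.
transitivity (y - s * x - (a * s) * y)%R; last by ring.
by rewrite as1; ring.
Qed.

End lebesgue_invariance.

(** The law N(m, s^2) on the Borel line, with the probability structure made
explicit so that products and integrals against it are found by unification. *)
Definition normalP {R : realType} (m s : R) : probability (measurableTypeR R) R :=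
  normal_prob m s.

Section normal_law.
Local Open Scope ereal_scope.
Context {R : realType}.
Local Notation mu := (@lebesgue_measure R).
Local Notation gam := (@normalP R 0 1).
Local Notation gam2 := (@normalP R 0 1 \x @normalP R 0 1).

Lemma ge0_integral_normal_prob (m s : R) (F : R -> \bar R) :
  measurable_fun setT F -> (forall y, 0 <= F y) ->
  \int[normalP m s]_y F y = \int[mu]_y (F y * (normal_pdf m s y)%:E).
Proof.
move=> mF F0; apply: (@ge0_integral_density _ _ _ _ R mu (normalP m s) id) => //.
- exact: measurable_normal_pdf.
- by move=> t; exact: normal_pdf_ge0.
Qed.

Lemma normal_pdf1E (m x : R) :
  normal_pdf m 1 x = (normal_peak 1 * expR (- (x - m) ^+ 2 / 2))%R.
Proof. by rewrite normal_pdfE ?oner_neq0// /normal_fun expr1n. Qed.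

Lemma measurable_normal_pdfE (m : R) : measurable_fun setT (EFin \o normal_pdf m 1).
Proof. by apply/measurable_EFinP; exact: measurable_normal_pdf. Qed.

Lemma ge0_integral_normal_shift (m : R) (F : R -> \bar R) :
  measurable_fun setT F -> (forall y, 0 <= F y) ->
  \int[normalP m 1]_y F y = \int[gam]_y F (y + m)%R.
Proof.
move=> mF F0; have mFm : measurable_fun setT (fun y : R => F (y + m)%R).
  by apply: measurableT_comp => //; exact: measurable_funD.
rewrite (ge0_integral_normal_prob m 1 mF F0).
rewrite (ge0_integral_normal_prob 0 1 mFm (fun y => F0 _)).
rewrite -(@ge0_integral_translate _ m (fun y => F y * (normal_pdf m 1 y)%:E)).
- by apply: eq_integral => y _; rewrite !normal_pdf1E subr0 addrK.
- by apply: emeasurable_funM => //; exact: measurable_normal_pdfE.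
- by move=> y; rewrite mule_ge0// lee_fin normal_pdf_ge0.
Qed.

Lemma ge0_integral_normal_opp (F : R -> \bar R) :
  measurable_fun setT F -> (forall y, 0 <= F y) ->
  \int[gam]_y F (- y)%R = \int[gam]_y F y.
Proof.
move=> mF F0; have mFN : measurable_fun setT (fun y : R => F (- y)%R).
  exact: measurableT_comp.
rewrite (ge0_integral_normal_prob 0 1 mF F0).
rewrite (ge0_integral_normal_prob 0 1 mFN (fun y => F0 _)).
rewrite -(@ge0_integral_opp _ (fun y => F y * (normal_pdf 0 1 y)%:E)).
- by apply: eq_integral => y _; rewrite !normal_pdf1E !subr0 sqrrN.
- by apply: emeasurable_funM => //; exact: measurable_normal_pdfE.
- by move=> y; rewrite mule_ge0// lee_fin normal_pdf_ge0.
Qed.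

(** Completing the square. *)
Lemma ge0_integral_normal_tilt (s : R) (F : R -> \bar R) :
  measurable_fun setT F -> (forall y, 0 <= F y) ->
  \int[gam]_y (F y * (expR (s * y))%:E) =
  (expR (s ^+ 2 / 2))%:E * \int[gam]_y F (y + s)%R.
Proof.
move=> mF F0; rewrite -(ge0_integral_normal_shift s mF F0).
have mFe : measurable_fun setT (fun y : R => F y * (expR (s * y))%:E).
  apply: emeasurable_funM => //; apply/measurable_EFinP.
  by apply: measurableT_comp => //; exact: measurable_funM.
have Fe0 y : 0 <= F y * (expR (s * y))%:E.
  by rewrite mule_ge0// lee_fin expR_ge0.
rewrite (ge0_integral_normal_prob s 1 mF F0).
rewrite (ge0_integral_normal_prob 0 1 mFe Fe0).
rewrite -ge0_integralZl//=; last 2 first.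
- by apply: emeasurable_funM => //; exact: measurable_normal_pdfE.
- by move=> y _; rewrite mule_ge0// lee_fin normal_pdf_ge0.
apply: eq_integral => y _; rewrite muleCA -muleA; congr *%E.
rewrite -!EFinM !normal_pdf1E; congr EFin.
rewrite mulrCA [RHS]mulrCA; congr *%R; rewrite -!expRD; congr expR.
by field.
Qed.

Lemma gam2_int2 (F : R * R -> \bar R) :
  measurable_fun setT F -> (forall y, 0 <= F y) ->
  \int[gam2]_z F z =
  int2 (fun z => F z * (normal_peak 1 ^+ 2 * expR (- (z.1 ^+ 2 + z.2 ^+ 2) / 2))%:E).
Proof.
move=> mF F0; rewrite fubini_tonelli1//= ge0_integral_normal_prob//; last 2 first.
- exact: measurable_fun_fubini_tonelli_F.
- by move=> x; exact: integral_ge0.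
apply: eq_integral => x _ /=; rewrite /fubini_F.
have mFx : measurable_fun setT (fun y : R => F (x, y)) by exact: measurableT_comp.
rewrite ge0_integral_normal_prob// -ge0_integralZr//; last 3 first.
- by apply: emeasurable_funM => //; exact: measurable_normal_pdfE.
- by move=> y _; rewrite mule_ge0// lee_fin normal_pdf_ge0.
- by rewrite lee_fin normal_pdf_ge0.
apply: eq_integral => y _; rewrite -muleA; congr *%E.
rewrite -EFinM !normal_pdf1E !subr0; congr EFin.
rewrite mulrACA -expr2 -expRD; congr (_ * expR _)%R.
by field.
Qed.

Lemma ge0_integral_gam2_rotate (c s : R) (F : R * R -> \bar R) :
  (c ^+ 2 + s ^+ 2 = 1)%R -> s != 0%R ->
  measurable_fun setT F -> (forall z, 0 <= F z) ->
  \int[gam2]_z F (c * z.1 + s * z.2, - s * z.1 + c * z.2)%R = \int[gam2]_z F z.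
Proof.
move=> cs s0 mF F0.
pose rho (z : R * R) := (normal_peak 1 ^+ 2 * expR (- (z.1 ^+ 2 + z.2 ^+ 2) / 2))%R.
have mrho : measurable_fun setT (EFin \o rho).
  apply/measurable_EFinP/measurable_funM => //; apply: measurableT_comp => //.
  apply: measurable_funM => //; apply: measurableT_comp => //.
  by apply: measurable_funD; exact: measurable_funX.
have mFr : measurable_fun setT (fun z => F z * (rho z)%:E).
  exact: emeasurable_funM.
have rho0 z : (0 <= rho z)%R by rewrite mulr_ge0 ?expR_ge0// sqr_ge0.
have Fr0 z : 0 <= F z * (rho z)%:E by rewrite mule_ge0// lee_fin.
pose rot z : R * R := (c * z.1 + s * z.2, - s * z.1 + c * z.2)%R.
have mFrot : measurable_fun setT (fun z : R * R => F (rot z)).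
  apply: measurableT_comp => //.
  by apply: measurable_fun_pair; apply: measurable_funD => //; exact: measurable_funM.
rewrite (gam2_int2 mF F0) (gam2_int2 mFrot (fun z => F0 (rot z))).
rewrite -(int2_rotate cs s0 mFr Fr0); congr int2; apply/funext => z /=.
congr (_ * (_ * expR (- _ / 2))%:E).
transitivity ((c ^+ 2 + s ^+ 2) * (z.1 ^+ 2 + z.2 ^+ 2))%R; first by rewrite cs mul1r.
by rewrite /=; ring.
Qed.

End normal_law.

(** * Gaussian moments *)

Section gaussian_moments.
Context {R : realType}.
Local Notation mu := (@lebesgue_measure R).
Local Notation gam := (@normalP R 0 1).
Local Notation gam2 := (@normalP R 0 1 \x @normalP R 0 1)%E.

Lemma integral_gam_expR (s : R) :
  (\int[gam]_y (expR (s * y))%:E = (expR (s ^+ 2 / 2))%:E)%E.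
Proof.
have := @ge0_integral_normal_tilt R s (fun=> 1%E) (measurable_cst _) (fun=> lee01).
under eq_integral do rewrite mul1e.
by move=> ->; rewrite integral_cst// mul1e [X in (_ * X)%E]probability_setT mule1.
Qed.

Lemma integrable_gam_expR (s : R) : gam.-integrable setT (EFin \o (fun y => expR (s * y))).
Proof.
apply/integrableP; split.
  by apply/measurable_EFinP; apply: measurableT_comp => //; exact: measurable_funM.
under eq_integral do rewrite /= ger0_norm ?expR_ge0//.
by rewrite integral_gam_expR ltry.
Qed.

(** Exponential moments are explicit, so they provide integrability of powers. *)
Lemma normrX_le_expR (n : nat) (z : R) :
  `|z| ^+ n.+1 <= n.+1%:R ^+ n.+1 * (expR (1 * z) + expR (-1 * z)).
Proof.
have n0 : (0 : R) < n.+1%:R by rewrite ltr0n.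
have -> : `|z| ^+ n.+1 = n.+1%:R ^+ n.+1 * (`|z| / n.+1%:R) ^+ n.+1.
  by rewrite -exprMn mulrC divfK// gt_eqF.
rewrite ler_wpM2l ?exprn_ge0 ?ler0n//.
apply: (@le_trans _ _ (expR `|z|)).
  have -> : expR `|z| = expR (`|z| / n.+1%:R) ^+ n.+1.
    by rewrite -expRM_natl mulrC divfK// gt_eqF.
  rewrite lerXn2r ?nnegrE ?expR_ge0 ?divr_ge0//.
  by apply: le_trans (expR_ge1Dx _); rewrite lerDr.
rewrite mul1r mulN1r.
by case: (ger0P z) => z0; rewrite ?lerDl ?lerDr expR_ge0.
Qed.

Lemma integrable_gamX (n : nat) : gam.-integrable setT (EFin \o (fun z => z ^+ n)).
Proof.
case: n => [|n].
  under [_ \o _]eq_fun do rewrite /= expr0.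
  exact: (rintegrable_cst gam 1).
pose g (z : measurableTypeR R) : R := n.+1%:R ^+ n.+1 * (expR (1 * z) + expR (-1 * z)).
apply: (rintegrable_le (g := g)); first exact: measurable_funX.
- by move=> z; rewrite normrX; exact: normrX_le_expR.
- by apply/rintegrableZ/rintegrableD; exact: integrable_gam_expR.
Qed.

Definition gmom (n : nat) : R := \int[gam]_z z ^+ n.

Lemma gmom0 : gmom 0 = 1.
Proof.
rewrite -[RHS](Rintegral_probability_cst gam); apply: eq_Rintegral => z _.
by rewrite expr0.
Qed.

Lemma gmom_odd n : odd n -> gmom n = 0.
Proof.
move=> on.
have opp (F : measurableTypeR R -> \bar R) : measurable_fun setT F ->
    (forall y, 0 <= F y)%E -> (\int[gam]_z F (- z)%R = \int[gam]_y F y)%E.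
  exact: ge0_integral_normal_opp.
have := Rintegral_transfer opp (integrable_gamX n).
rewrite -/(gmom n).
have -> : \int[gam]_z (- z) ^+ n = - gmom n.
  rewrite -mulN1r -RintegralZl//; last exact: integrable_gamX.
  by apply: eq_Rintegral => z _; rewrite exprNn -signr_odd on expr1.
by lra.
Qed.

(** The second moment is read off the normalising constant [s] of the tilted
densities [exp (- (s^-2 - 1) z^2 / 2)]: the tangent line bound for [exp] gives an
inequality for every [s > 0], which is an equality at [s = 1]. Comparing the two
sides near [s = 1] determines the second moment without integration by parts. *)
Lemma gmom2_tangent (s : R) : 0 < s -> 1 - (s ^- 2 - 1) / 2 * gmom 2 <= s.
Proof.
move=> s0; pose f (z : measurableTypeR R) : R := expR (- (s ^- 2 - 1) * z ^+ 2 / 2).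
have mf : measurable_fun setT (EFin \o f).
  apply/measurable_EFinP; apply: measurableT_comp => //.
  by apply: measurable_funM => //; apply: measurable_funM => //; exact: measurable_funX.
have intf : (\int[gam]_z (f z)%:E = s%:E)%E.
  rewrite (@ge0_integral_normal_prob R 0 1 (EFin \o f))//; last first.
    by move=> z; rewrite lee_fin expR_ge0.
  transitivity (\int[mu]_z (s%:E * (normal_pdf 0 s z)%:E))%E; last first.
    rewrite integralZl//; last exact: integrable_normal_pdf.
    by rewrite integral_normal_pdf mule1.
  apply: eq_integral => z _ /=; rewrite -!EFinM; congr EFin.
  rewrite normal_pdf1E normal_pdfE ?gt_eqF// /normal_fun subr0 /normal_peak.
  rewrite expr1n mul1r -mulrnAr sqrtrM ?sqr_ge0// sqrtr_sqr gtr0_norm//.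
  rewrite invfM !mulrA mulfV ?gt_eqF// mul1r [f z * _]mulrC -mulrA; congr (_ * _).
  rewrite /f.
  rewrite -expRD; congr expR; field.
  by rewrite gt_eqF.
have intg : gam.-integrable setT (EFin \o (fun z => 1 - (s ^- 2 - 1) / 2 * z ^+ 2)).
  apply: rintegrableB; first exact: rintegrable_cst.
  by apply: rintegrableZ; exact: integrable_gamX.
have fi : gam.-integrable setT (EFin \o f).
  apply/integrableP; split => //.
  by under eq_integral do rewrite /= ger0_norm ?expR_ge0//; rewrite intf ltry.
have := le_Rintegral measurableT intg fi.
rewrite [X in _ <= X](_ : _ = s); last by rewrite /Rintegral intf.
rewrite [X in X <= _](_ : _ = 1 - (s ^- 2 - 1) / 2 * gmom 2).
  apply=> z _; apply: le_trans (expR_ge1Dx _) .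
  by rewrite le_eqVlt; apply/orP; left; apply/eqP; ring.
rewrite RintegralB//; last 2 first.
- exact: rintegrable_cst.
- by apply: rintegrableZ; exact: integrable_gamX.
by rewrite Rintegral_probability_cst RintegralZl//; exact: integrable_gamX.
Qed.

Lemma gmom2 : gmom 2 = 1.
Proof.
set m := gmom 2.
have H s : 0 < s -> (s - 1) * (m * (s + 1) - 2 * s ^+ 2) <= 0 .
  move=> s0; have := gmom2_tangent s0; rewrite -/m => h.
  have : 0 <= s ^+ 2 * 2 * (s - (1 - (s ^- 2 - 1) / 2 * m)).
    by rewrite mulr_ge0 ?subr_ge0// mulr_ge0 ?sqr_ge0.
  rewrite (_ : _ * _ = - ((s - 1) * (m * (s + 1) - 2 * s ^+ 2))); last first.
    by field; rewrite gt_eqF.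
  by rewrite oppr_ge0.
(* After division by [s - 1], of either sign, [H] compares [m] with
   [2 * s ^+ 2 / (s + 1)]; let [s] tend to 1 from both sides. *)
apply/eqP; rewrite eq_le; apply/andP; split.
- apply/ler_addgt0Pr => e e0.
  have e10 : 0 < 1 + Num.min 1 (e / 4) by rewrite addr_gt0// lt_min ltr01 divr_gt0.
  have := H _ e10; set t := Num.min _ _.
  have t0 : 0 < t by rewrite lt_min ltr01 divr_gt0.
  have t1 : t <= 1 by rewrite ge_min lexx.
  have te : t <= e / 4 by rewrite ge_min lexx orbT.
  rewrite addrAC subrr add0r pmulr_rle0//; nra.
- apply/ler_addgt0Pr => e e0.
  pose t := Num.min (2^-1) (e / 4).
  have t0 : 0 < t by rewrite lt_min invr_gt0 ltr0n divr_gt0.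
  have t1 : t <= 2^-1 by rewrite ge_min lexx.
  have te : t <= e / 4 by rewrite ge_min lexx orbT.
  have e10 : 0 < 1 - t by lra.
  have := H _ e10.
  rewrite addrAC subrr add0r nmulr_rle0 ?oppr_lt0//; nra.
Qed.

(** Monomials are kept as a list of data (coefficient, exponents), so that products
of polynomials and their Gaussian means are obtained by computation. *)
Definition poly2 (s : seq (R * nat * nat)) (z : R * R) : R :=
  \sum_(t <- s) t.1.1 * (z.1 ^+ t.1.2 * z.2 ^+ t.2).

Lemma integrable_poly2_Rintegral s :
  gam2.-integrable setT (EFin \o poly2 s) /\
  \int[gam2]_z poly2 s z = \sum_(t <- s) t.1.1 * (gmom t.1.2 * gmom t.2).
Proof.
elim: s => [|t s [IHi IHe]].
  rewrite big_nil (_ : poly2 [::] = cst 0); last first.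
    by apply/funext => z; rewrite /poly2 big_nil.
  by split; [exact: integrable0|rewrite /Rintegral integral0].
have iM := integrable_prodM (integrable_gamX t.1.2) (integrable_gamX t.2).
have iZ := rintegrableZ t.1.1 iM.
rewrite (_ : poly2 (t :: s) = (fun z => t.1.1 * (z.1 ^+ t.1.2 * z.2 ^+ t.2))
    \+ poly2 s); last by apply/funext => z; rewrite /poly2 big_cons.
split.
  exact: rintegrableD.
rewrite RintegralD// RintegralZl// big_cons IHe; congr (_ * _ + _).
exact: (Rintegral_prodM (integrable_gamX _) (integrable_gamX _)).
Qed.

(** If x and y are independent N(0, 1), so is (x + y) / sqrt 2; comparing fourth
moments gives m4 = (2 m4 + 6 m2^2) / 4. *)
Lemma gmom4 : gmom 4 = 3.
Proof.
pose c : R := (Num.sqrt 2)^-1.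
have c2 : c ^+ 2 = 2^-1 by rewrite /c exprVn sqr_sqrtr.
have c0 : c != 0 by rewrite invr_eq0 sqrtr_eq0 -ltNge.
have cc : c ^+ 2 + c ^+ 2 = 1 by rewrite c2; lra.
have [i1 e1] := integrable_poly2_Rintegral [:: (1, 4%N, 0%N)].
pose s : seq (R * nat * nat) := [:: (c ^+ 4, 4%N, 0%N); (4 * c ^+ 4, 3%N, 1%N);
   (6 * c ^+ 4, 2%N, 2%N); (4 * c ^+ 4, 1%N, 3%N); (c ^+ 4, 0%N, 4%N)].
have [i2 e2] := integrable_poly2_Rintegral s.
have rot (F : measurableTypeR R * measurableTypeR R -> \bar R) :
    measurable_fun setT F -> (forall y, 0 <= F y)%E ->
    (\int[gam2]_z F (c * z.1 + c * z.2, - c * z.1 + c * z.2)%R =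
     \int[gam2]_z F z)%E.
  exact: ge0_integral_gam2_rotate.
have := Rintegral_transfer rot i1.
rewrite e1 (_ : (fun t => _) = poly2 s); last first.
  by apply/funext => z; rewrite /poly2 /s !big_cons !big_nil/=; ring.
rewrite e2 /s !big_cons !big_nil/= !gmom0 !(gmom_odd (n := 1))// !(gmom_odd (n := 3))// gmom2.
have -> : c ^+ 4 = 4^-1 by rewrite -[4%N]/(2 * 2)%N exprM c2; field.
lra.
Qed.

Lemma gam2_poly2 s (v : R) : \sum_(t <- s) t.1.1 * (gmom t.1.2 * gmom t.2) = v ->
  \int[gam2]_z poly2 s z = v.
Proof. by move=> <-; have [] := integrable_poly2_Rintegral s. Qed.

Lemma integrable_poly2 s : gam2.-integrable setT (EFin \o poly2 s).
Proof. by have [] := integrable_poly2_Rintegral s. Qed.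

End gaussian_moments.

(** * Lindeberg's replacement argument *)

Section gaussian_smoothing.
Context {R : realType}.
Local Notation gam := (@normalP R 0 1).
Local Notation gam2 := (@normalP R 0 1 \x @normalP R 0 1)%E.
Implicit Types f : R -> R.

(** Bounded functions with a uniform third-order Taylor bound. The derivatives
are carried as data, so that averaging over a Gaussian shift preserves the class
without any differentiation under the integral sign. *)
Definition taylor3 (B K : R) f f1 f2 :=
  [/\ [/\ measurable_fun setT f, measurable_fun setT f1 & measurable_fun setT f2],
      [/\ forall x, `|f x| <= B, forall x, `|f1 x| <= B & forall x, `|f2 x| <= B]
    & forall x h, `|f (x + h) - f x - f1 x * h - f2 x * (h ^+ 2 / 2)| <= K * `|h| ^+ 3].

(** The heat semigroup at time [s ^+ 2]. *)
Definition gmean f (s w : R) : R := \int[gam]_z f (w + s * z).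

Section bounded.
Variables (f : R -> R) (B : R).
Hypotheses (mf : measurable_fun setT f) (fB : forall x, `|f x| <= B).

Lemma integrable_gmean s w : gam.-integrable setT (EFin \o (fun z => f (w + s * z))).
Proof.
apply: (@rintegrable_bounded _ _ _ _ B) => //.
by apply: measurableT_comp => //; exact: measurable_funD.
Qed.

Lemma gmean_bounded s w : `|gmean f s w| <= B.
Proof. by apply: ler_norm_Rintegral => //; exact: integrable_gmean. Qed.

Let measurable_affine2 a b w : measurable_fun setT
  (fun z : measurableTypeR R * measurableTypeR R => f (w + b * z.1 + a * z.2)).
Proof.
apply: measurableT_comp => //; apply: measurable_funD; last exact: measurable_funM.
by apply: measurable_funD => //; exact: measurable_funM.
Qed.

Lemma measurable_gmean s : measurable_fun setT (gmean f s).
Proof.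
have := @measurable_Rintegral_snd _ _ _ _ R gam gam
  (fun z => f (0 + 1 * z.1 + s * z.2)) B (measurable_affine2 _ _ _) (fun=> fB _).
by rewrite (_ : (fun x => _) = gmean f s)//; apply/funext => w /=;
  rewrite add0r mul1r.
Qed.

Lemma gmean0 w : gmean f 0 w = f w.
Proof.
rewrite /gmean -[RHS](Rintegral_probability_cst gam).
by apply: eq_Rintegral => z _; rewrite mul0r addr0.
Qed.

(** A sum of two independent centred Gaussians is Gaussian: rotate the plane. *)
Lemma gmean_gmean a b w : 0 <= b ->
  gmean (gmean f a) b w = gmean f (Num.sqrt (a ^+ 2 + b ^+ 2)) w.
Proof.
move=> b0; have [->|a0] := eqVneq a 0.
  rewrite expr0n/= add0r sqrtr_sqr ger0_norm//.
  by apply: eq_Rintegral => z _; rewrite gmean0.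
set c := Num.sqrt _.
have c2 : c ^+ 2 = a ^+ 2 + b ^+ 2 by rewrite sqr_sqrtr// addr_ge0 ?sqr_ge0.
have c0 : c != 0.
  by rewrite -sqrf_eq0 c2 paddr_eq0 ?sqr_ge0// !sqrf_eq0 negb_and a0.
rewrite /gmean.
rewrite (@Rintegral_fubini_bounded _ _ _ _ R gam gam
  (fun z => f (w + b * z.1 + a * z.2)) B (measurable_affine2 _ _ _) (fun=> fB _)).
have cs1 : (b / c) ^+ 2 + (a / c) ^+ 2 = 1.
  by rewrite !expr_div_n -mulrDl [X in X / _]addrC -c2 divff// sqrf_eq0.
have ac0 : a / c != 0 by rewrite mulf_neq0// invr_eq0.
have rot (F : measurableTypeR R * measurableTypeR R -> \bar R) :
    measurable_fun setT F -> (forall y, 0 <= F y)%E ->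
    (\int[gam2]_z F (b / c * z.1 + a / c * z.2, - (a / c) * z.1 + b / c * z.2)%R =
     \int[gam2]_z F z)%E.
  exact: ge0_integral_gam2_rotate.
have i1 := integrable_prodM (integrable_gmean c w) (rintegrable_cst gam 1).
have := Rintegral_transfer rot i1.
rewrite (Rintegral_prodM (integrable_gmean c w) (rintegrable_cst gam 1)).
rewrite Rintegral_probability_cst mulr1 => <-.
apply: eq_Rintegral => z _ /=; rewrite mulr1 -addrA; congr (f (w + _)).
by field.
Qed.

End bounded.

Section taylor.
Variables (B K : R) (f f1 f2 : R -> R).
Hypothesis fT : taylor3 B K f f1 f2.

Lemma taylor3_gmean s : taylor3 B K (gmean f s) (gmean f1 s) (gmean f2 s).
Proof.
have [[mf mf1 mf2] [fB f1B f2B] fK] := fT.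
split; [by split; apply: measurable_gmean; eassumption|
        by split=> x; exact: gmean_bounded|].
move=> x h.
have i0 := integrable_gmean mf fB s (x + h).
have i1 := integrable_gmean mf fB s x.
have i2 := rintegrableZ h (integrable_gmean mf1 f1B s x).
have i3 := rintegrableZ (h ^+ 2 / 2) (integrable_gmean mf2 f2B s x).
rewrite (_ : _ - _ = \int[gam]_z (f (x + h + s * z) - f (x + s * z) -
    h * f1 (x + s * z) - (h ^+ 2 / 2) * f2 (x + s * z))); last first.
  rewrite (RintegralB measurableT (rintegrableB (rintegrableB i0 i1) i2) i3).
  rewrite (RintegralB measurableT (rintegrableB i0 i1) i2).
  rewrite (RintegralB measurableT i0 i1).
  rewrite (RintegralZl _ measurableT (integrable_gmean mf1 f1B s x)).
  rewrite (RintegralZl _ measurableT (integrable_gmean mf2 f2B s x)).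
  by rewrite /gmean [_ * h]mulrC [_ * (h ^+ 2 / 2)]mulrC.
apply: ler_norm_Rintegral.
  by do 3!apply: rintegrableB => //.
move=> z; have := fK (x + s * z) h.
by rewrite [_ * h]mulrC [_ * (h ^+ 2 / 2)]mulrC (addrAC x).
Qed.

Definition gabs3 : R := \int[gam]_z `|z| ^+ 3.

Lemma integrable_gabs3 : gam.-integrable setT (EFin \o (fun z : R => `|z| ^+ 3)).
Proof.
have := integrable_norm (integrable_gamX (R := R) 3).
by apply: eq_integrable => // z _ /=; rewrite normrX.
Qed.

(** The first-order Taylor term has mean zero and the second moment of N(0, 1) is
one, so a Gaussian perturbation is seen only through its variance. *)
Lemma gmean_expansion s w : 0 <= s ->
  `|gmean f s w - f w - f2 w * (s ^+ 2 / 2)| <= K * gabs3 * s ^+ 3.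
Proof.
move=> s0; have [[mf mf1 mf2] [fB f1B f2B] fK] := fT.
have i0 := integrable_gmean mf fB s w.
have i1 := rintegrable_cst gam (f w).
have i2 := rintegrableZ (f1 w * s) (integrable_gamX (R := R) 1).
have i3 := rintegrableZ (f2 w * (s ^+ 2 / 2)) (integrable_gamX (R := R) 2).
rewrite (_ : _ - _ = \int[gam]_z (f (w + s * z) - f w -
    f1 w * s * z ^+ 1 - f2 w * (s ^+ 2 / 2) * z ^+ 2)); last first.
  rewrite (RintegralB measurableT (rintegrableB (rintegrableB i0 i1) i2) i3).
  rewrite (RintegralB measurableT (rintegrableB i0 i1) i2).
  rewrite (RintegralB measurableT i0 i1).
  rewrite (RintegralZl _ measurableT (integrable_gamX 1)).
  rewrite (RintegralZl _ measurableT (integrable_gamX 2)).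
  rewrite -!/(gmom _) gmom2 (gmom_odd (n := 1))// Rintegral_probability_cst.
  by rewrite /gmean mulr0 mulr1 subr0.
have i4 := rintegrableZ (K * s ^+ 3) integrable_gabs3.
have ib := rintegrableB (rintegrableB (rintegrableB i0 i1) i2) i3.
apply: le_trans (le_normr_Rintegral measurableT ib) _.
have -> : K * gabs3 * s ^+ 3 = \int[gam]_z (K * s ^+ 3 * `|z| ^+ 3).
  by rewrite (RintegralZl _ measurableT integrable_gabs3) -/gabs3; ring.
apply: ler_Rintegral => //; first exact: integrable_norm.
move=> z; have := fK w (s * z).
rewrite normrM (ger0_norm s0) => H.
have e : K * s ^+ 3 * `|z| ^+ 3 = K * (s * `|z|) ^+ 3 by ring.
rewrite e.
apply: le_trans _ H; rewrite /= le_eqVlt; apply/orP; left; apply/eqP.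
by congr (`|_|); ring.
Qed.

End taylor.

End gaussian_smoothing.

Section lindeberg.
Context d d' (T : measurableType d) (E : measurableType d') (R : realType)
  (P : probability T R) (mu : probability E R).
Context (I : finType) (V : I -> T -> E).
Hypotheses (mV : forall j, measurable_fun setT (V j)) (iidV : iid P mu V).
Variables (psi : I -> E -> R) (tau M : I -> R).
Hypothesis mpsi : forall j, measurable_fun setT (psi j).
Hypothesis tau0 : forall j, 0 <= tau j.
Hypothesis psi3i : forall j, mu.-integrable setT (EFin \o (fun v => `|psi j v| ^+ 3)).
Hypothesis psiM : forall j, \int[mu]_v `|psi j v| ^+ 3 <= M j.
Hypothesis psi1 : forall j, \int[mu]_v psi j v = 0.
Hypothesis psi2 : forall j, \int[mu]_v psi j v ^+ 2 = tau j ^+ 2.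
Local Notation S := (psum V psi).

Let integrable_psiX k j : (k <= 3)%N -> mu.-integrable setT (EFin \o (fun v => psi j v ^+ k)).
Proof.
move=> k3; apply: (rintegrable_le (g := fun v => 1 + `|psi j v| ^+ 3)).
- exact: measurable_funX.
- move=> v; rewrite normrX; have [h|h] := leP `|psi j v| 1.
    by rewrite (le_trans (exprn_ile1 _ (normr_ge0 _) h))// lerDl exprn_ge0.
  by rewrite (le_trans (ler_weXn2l _ k3)) ?(ltW h)// lerDr.
- by apply: rintegrableD => //; exact: rintegrable_cst.
Qed.

Let mS r : measurable_fun setT (S r).
Proof. exact: measurable_psum. Qed.

Let law r : probability R R :=
  distribution P (mfun_Sub (mem_set (mS r)) : {mfun T >-> R}).

Let indepS r i : uniq r -> i \notin r ->
  forall A C, measurable A -> measurable C ->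
    (P (S r @^-1` A `&` V i @^-1` C) = law r A * mu C)%E.
Proof. by move=> ur ir A C mA mC; exact: psum_indep. Qed.

Section step.
Variables (B K : R) (f f1 f2 : R -> R).
Hypothesis fT : taylor3 B K f f1 f2.

(** One summand is traded for a Gaussian of the same variance. The summand is
independent of the partial sum, so the first-order terms vanish and the
second-order ones agree; the third-order errors remain. *)
Lemma lindeberg_step r i : uniq r -> i \notin r ->
  `|\int[P]_t f (S (i :: r) t) - \int[P]_t gmean f (tau i) (S r t)|
    <= K * (M i + @gabs3 R * tau i ^+ 3).
Proof.
move=> ur ir; have [[mf mf1 mf2] [fB f1B f2B] fK] := fT.
have K0 : 0 <= K.
  by have := le_trans (normr_ge0 _) (fK 0 1); rewrite normr1 expr1n mulr1.
pose X t := psi i (V i t).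
have mX : measurable_fun setT X by exact: measurableT_comp.
have bl (g : R -> R) : measurable_fun setT g -> (forall x, `|g x| <= B) ->
    (law r).-integrable setT (EFin \o g).
  by move=> mg gB; exact: (@rintegrable_bounded _ _ _ _ B).
have bP (g : R -> R) : measurable_fun setT g -> (forall x, `|g x| <= B) ->
    P.-integrable setT (EFin \o (fun t => g (S r t))).
  move=> mg gB; apply: (@rintegrable_bounded _ _ _ _ B) => //.
  exact: measurableT_comp.
have ifSX : P.-integrable setT (EFin \o (fun t => f (S r t + X t))).
  apply: (@rintegrable_bounded _ _ _ _ B) => //.
  by apply: measurableT_comp => //; exact: measurable_funD.
have [if1 ef1] := independent_prodM (mS r) (mV i) (indepS ur ir)
  (bl _ mf1 f1B) (integrable_psiX i (k := 1) isT).
have [if2 ef2] := independent_prodM (mS r) (mV i) (indepS ur ir)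
  (bl _ mf2 f2B) (integrable_psiX i (k := 2) isT).
have [_ ef2'] := independent_prodM (mS r) (mV i) (indepS ur ir)
  (bl _ mf2 f2B) (rintegrable_cst mu 1).
have [i3 e3] := independent_prodM (mS r) (mV i) (indepS ur ir)
  (rintegrable_cst (law r) 1) (psi3i i).
have i2' := rintegrableZ 2^-1 if2.
have Ef : `|\int[P]_t f (S (i :: r) t) - \int[P]_t f (S r t) -
    \int[P]_t f2 (S r t) * (tau i ^+ 2 / 2)| <= K * M i.
  have -> : \int[P]_t f (S (i :: r) t) = \int[P]_t f (S r t + X t).
    by apply: eq_Rintegral => t _; rewrite /psum big_cons addrC.
  have -> : \int[P]_t f2 (S r t) * (tau i ^+ 2 / 2) =
      \int[P]_t (2^-1 * (f2 (S r t) * psi i (V i t) ^+ 2)).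
    rewrite (RintegralZl _ measurableT if2) ef2 psi2.
    have -> : \int[P]_t f2 (S r t) = \int[law r]_x f2 x.
      rewrite -[RHS]mulr1 -[X in _ = _ * X](Rintegral_probability_cst mu) -ef2'.
      by apply: eq_Rintegral => t _; rewrite mulr1.
    by ring.
  have ib := rintegrableB (rintegrableB (rintegrableB ifSX (bP _ mf fB)) if1) i2'.
  rewrite (_ : _ - _ = \int[P]_t (f (S r t + X t) - f (S r t) -
     f1 (S r t) * psi i (V i t) ^+ 1 - 2^-1 * (f2 (S r t) * psi i (V i t) ^+ 2))); last first.
    rewrite (RintegralB measurableT
      (rintegrableB (rintegrableB ifSX (bP _ mf fB)) if1) i2').
    rewrite (RintegralB measurableT (rintegrableB ifSX (bP _ mf fB)) if1).
    rewrite (RintegralB measurableT ifSX (bP _ mf fB)) ef1.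
    rewrite (_ : \int[mu]_y psi i y ^+ 1 = 0) ?mulr0 ?subr0//.
    by rewrite -[RHS](psi1 i); apply: eq_Rintegral => v _.
  apply: le_trans (le_normr_Rintegral measurableT ib) _.
  apply: (@le_trans _ _ (\int[P]_t (K * (1 * `|psi i (V i t)| ^+ 3)))).
    apply: ler_Rintegral.
    - exact: integrable_norm.
    - exact: rintegrableZ.
    move=> t; rewrite mul1r; have := fK (S r t) (X t); rewrite -/(X t).
    apply: le_trans; rewrite le_eqVlt; apply/orP; left; apply/eqP.
    by congr (`|_|); ring.
  rewrite (RintegralZl _ measurableT i3) e3 Rintegral_probability_cst mul1r.
  exact: ler_wpM2l.
have ig : P.-integrable setT (EFin \o (fun t => gmean f (tau i) (S r t))).
  apply: bP; first exact: measurable_gmean fB _.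
  by move=> x; exact: gmean_bounded.
have i2t := rintegrableZ (tau i ^+ 2 / 2) (bP _ mf2 f2B).
have Eg : `|\int[P]_t gmean f (tau i) (S r t) - \int[P]_t f (S r t) -
    \int[P]_t f2 (S r t) * (tau i ^+ 2 / 2)| <= K * @gabs3 R * tau i ^+ 3.
  have -> : \int[P]_t f2 (S r t) * (tau i ^+ 2 / 2) =
      \int[P]_t (tau i ^+ 2 / 2 * f2 (S r t)).
    by rewrite (RintegralZl _ measurableT (bP _ mf2 f2B)) mulrC.
  rewrite -(RintegralB measurableT ig (bP _ mf fB)).
  rewrite -(RintegralB measurableT (rintegrableB ig (bP _ mf fB)) i2t).
  apply: ler_norm_Rintegral; first exact: rintegrableB (rintegrableB ig (bP _ mf fB)) i2t.
  move=> t; have := gmean_expansion fT (S r t) (tau0 i).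
  by rewrite [_ * (tau i ^+ 2 / 2)]mulrC.
rewrite mulrDr mulrA; apply: le_trans (lerD Ef Eg).
set a := \int[P]_t f (S (i :: r) t); set b := \int[P]_t f (S r t).
set c := _ * (tau i ^+ 2 / 2); set e := \int[P]_t _.
rewrite (_ : a - e = (a - b - c) - (e - b - c)); last by ring.
exact: ler_normB.
Qed.

End step.

(** The Gaussians that replace the summands merge into one by the semigroup
property [gmean_gmean], and [taylor3] is stable under [gmean], so that the same
constant [K] serves at each replacement. *)
Theorem lindeberg B K f f1 f2 r : taylor3 B K f f1 f2 -> uniq r ->
  `|\int[P]_t f (S r t) - gmean f (Num.sqrt (\sum_(j <- r) tau j ^+ 2)) 0|
    <= K * \sum_(j <- r) (M j + @gabs3 R * tau j ^+ 3).
Proof.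
elim: r f f1 f2 => [|i r IH] f f1 f2 fT; have [[mf _ _] [fB _ _] _] := fT.
  move=> _; rewrite !big_nil sqrtr0 mulr0 gmean0 -[X in _ - X](Rintegral_probability_cst P).
  rewrite (_ : \int[P]_t f (S [::] t) = \int[P]_t f 0) ?subrr ?normr0//.
  by apply: eq_Rintegral => t _; rewrite /psum big_nil.
move=> /= /andP[ir ur].
have h1 := lindeberg_step fT ur ir.
have h2 := IH _ _ _ (taylor3_gmean fT (tau i)) ur.
rewrite !big_cons mulrDr; apply: le_trans (lerD h1 h2).
rewrite (gmean_gmean mf fB) ?sqrtr_ge0// sqr_sqrtr; last first.
  by apply: sumr_ge0 => j _; exact: sqr_ge0.
set a := \int[P]_t _; set b := \int[P]_t _; set c := gmean _ _ _.
by rewrite (_ : a - c = (a - b) + (b - c)) ?ler_normD//; ring.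
Qed.

End lindeberg.

(** * Smooth approximation of half-line indicators *)

Section taylor_from_derivatives.
Context {R : realType}.

Lemma mvt_bound (f df : R -> R) (C h : R) :
  (forall x : R, is_derive x 1 f (df x)) -> (forall s, `|s| <= `|h| -> `|df s| <= C) ->
  `|f h - f 0| <= C * `|h|.
Proof.
move=> fD dfC.
have cf : continuous f.
  move=> x; apply/differentiable_continuous/derivable1_diffP.
  by have [] := fD x.
have cw a b : {within `[a, b], continuous f} by exact: continuous_subspaceT.
have [h0|h0] := leP 0 h.
  have [c] := MVT_segment h0 (fun x _ => fD x) (cw _ _).
  rewrite in_itv/= => /andP[c0 ch] ->; rewrite subr0 normrM ler_wpM2r//.
  by apply: dfC; rewrite !ger0_norm.
have [c] := MVT_segment (ltW h0) (fun x _ => fD x) (cw _ _).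
rewrite in_itv/= => /andP[ch c0] e.
rewrite distrC e sub0r normrM normrN ler_wpM2r//.
by apply: dfC; rewrite ler0_norm// ltr0_norm// lerN2.
Qed.

Variables (f f1 f2 f3 : R -> R) (K : R).
Hypotheses (fD : forall x : R, is_derive x 1 f (f1 x))
  (f1D : forall x : R, is_derive x 1 f1 (f2 x))
  (f2D : forall x : R, is_derive x 1 f2 (f3 x)) (f3K : forall x, `|f3 x| <= K).

Lemma is_derive_translate (g dg : R -> R) (x s : R) :
  (forall y : R, is_derive y 1 g (dg y)) ->
  is_derive s 1 (fun s => g (x + s)) (dg (x + s)).
Proof.
move=> gD.
have tD : is_derive s 1 (cst x + id) (0 + 1) by exact: is_deriveD.
have := @is_derive1_comp _ g (cst x + id) s (dg (x + s)) (0 + 1) (gD _) tD.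
by rewrite add0r mulr1.
Qed.

(** The mean value inequality is applied three times, from the third derivative
down, each time on the remainder of the previous order. *)
Lemma taylor3_bound x h :
  `|f (x + h) - f x - f1 x * h - f2 x * (h ^+ 2 / 2)| <= K * `|h| ^+ 3.
Proof.
have K0 : 0 <= K by apply: le_trans (f3K 0).
have s2 s : `|f2 (x + s) - f2 x| <= K * `|s|.
  have := @mvt_bound (fun s => f2 (x + s)) (fun s => f3 (x + s)) K s
    (fun s => is_derive_translate _ _ f2D) (fun s _ => f3K _).
  by rewrite addr0.
have s1 s : `|f1 (x + s) - f1 x - f2 x * s| <= K * `|s| * `|s|.
  have D (t : R) : is_derive t 1 (fun t => f1 (x + t) - f2 x * t) (f2 (x + t) - f2 x).
    have D1 := is_derive_translate x t f1D.
    have D2 : is_derive t 1 (f2 x \*: id) (f2 x *: 1) by exact: is_deriveZ.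
    have := is_deriveB D1 D2; rewrite scaler1; exact.
  have := @mvt_bound _ _ (K * `|s|) s D _.
  rewrite addr0 mulr0 subr0 addrAC; apply.
  by move=> t ts; apply: le_trans (s2 t) _; rewrite ler_wpM2l.
have D (t : R) : is_derive t 1 (fun t => f (x + t) - f1 x * t - f2 x * (t ^+ 2 / 2))
    (f1 (x + t) - f1 x - f2 x * t).
  have D1 := is_derive_translate x t fD.
  have D2 : is_derive t 1 (f1 x \*: id) (f1 x *: 1) by exact: is_deriveZ.
  have D3 : is_derive t 1 ((f2 x / 2) \*: (id ^+ 2)) ((f2 x / 2) *: ((2%:R * t ^+ 1) *: 1)).
    exact: is_deriveZ.
  have := is_deriveB (is_deriveB D1 D2) D3.
  rewrite (_ : _ - _ - (_ *: _) = f1 (x + t) - f1 x - f2 x * t); last first.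
    by rewrite !scaler1 -mulr_algl scaler1 expr1; field.
  rewrite (_ : _ - _ - _ = (fun t => f (x + t) - f1 x * t - f2 x * (t ^+ 2 / 2)))//.
  apply/funext => y /=; rewrite /GRing.add /GRing.opp /=; congr (_ - _ - _).
  have -> : (f2 x / 2) *: (id ^+ 2) y = (f2 x / 2) * y ^+ 2 by [].
  by field.
have := @mvt_bound _ _ (K * `|h| * `|h|) h D _.
rewrite addr0 mulr0 expr0n/= mul0r mulr0 !subr0.
rewrite (_ : f (x + h) - f x - f1 x * h - _ =
  f (x + h) - f1 x * h - f2 x * (h ^+ 2 / 2) - f x); last by ring.
have -> : K * `|h| ^+ 3 = K * `|h| * `|h| * `|h| by ring.
apply.
move=> s sh; apply: le_trans (s1 s) _.
by rewrite ler_pM ?mulr_ge0// ler_wpM2l.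
Qed.

End taylor_from_derivatives.

Section logistic.
Context {R : realType}.

Definition logistic (u : R) : R := (1 + expR (- u))^-1.

Let den_gt0 u : 0 < 1 + expR (- u) :> R.
Proof. by rewrite addr_gt0// expR_gt0. Qed.

Lemma logistic_gt0 u : 0 < logistic u.
Proof. by rewrite invr_gt0. Qed.

Lemma logistic_lt1 u : logistic u < 1.
Proof. by rewrite invf_lt1// ltrDl expR_gt0. Qed.

Lemma logistic_le u v : u <= v -> logistic u <= logistic v.
Proof. by move=> uv; rewrite lef_pV2 ?posrE// lerD2l ler_expR lerN2. Qed.

Lemma logisticN u : logistic (- u) = 1 - logistic u.
Proof.
rewrite /logistic opprK; apply: (mulfI (lt0r_neq0 (den_gt0 u))).
rewrite mulrBr mulfV ?gt_eqF// mulr1 mulrC expRN.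
have e0 := lt0r_neq0 (expR_gt0 u).
have := lt0r_neq0 (den_gt0 (- u)); rewrite opprK => h.
by field; rewrite h e0.
Qed.

Lemma logistic_ge (e : R) : 0 < e -> 1 - e <= logistic (- ln e).
Proof.
move=> e0; rewrite /logistic opprK lnK ?posrE// -[leRHS]mul1r.
by rewrite ler_pdivlMr ?addr_gt0//; nra.
Qed.

Lemma measurable_logistic : measurable_fun setT logistic.
Proof.
apply: continuous_measurable_fun => u; apply: cvgV; first by rewrite gt_eqF.
apply: cvgD; first exact: cvg_cst.
apply: (@continuous_comp _ _ _ -%R expR); first exact: opp_continuous.
exact: continuous_expR.
Qed.

Let is_derive_logistic (u : R) :
  is_derive u 1 logistic (logistic u - logistic u * logistic u).
Proof.
have D1 : is_derive u 1 (expR \o -%R) (expR (- u) * -1).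
  by apply: is_derive1_comp; exact: is_deriveNid.
have D2 : is_derive u 1 (cst 1 + (expR \o -%R)) (0 + expR (- u) * -1).
  exact: is_deriveD.
have n0 : (cst 1 + (expR \o -%R)) u != 0 by rewrite gt_eqF//; exact: den_gt0.
have D := is_deriveV n0 D2.
have -> : logistic u - logistic u * logistic u =
    - ((1 + expR (- u)) ^- 2) * (0 + expR (- u) * -1).
  by rewrite /logistic; field; rewrite gt_eqF.
exact: D.
Qed.

Let l1 u : R := logistic u - logistic u * logistic u.
Let l2 u : R := l1 u - 2 * (logistic u * l1 u).
Let l3 u : R := l2 u - 2 * (logistic u * l2 u + l1 u * l1 u).

Let l1D (u : R) : is_derive u 1 l1 (l2 u).
Proof.
have D := is_deriveB (is_derive_logistic u)
  (is_deriveM (is_derive_logistic u) (is_derive_logistic u)).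
have -> : l2 u = l1 u - (logistic u * l1 u + logistic u * l1 u).
  by rewrite /l2; ring.
exact: D.
Qed.

Let l2D (u : R) : is_derive u 1 l2 (l3 u).
Proof.
have D1 := is_deriveM (is_derive_logistic u) (l1D u).
have D2 : is_derive u 1 (2 \*: (logistic * l1))
  (2 *: (logistic u *: l2 u + l1 u *: (logistic u - logistic u * logistic u))).
  exact: is_deriveZ.
have D := is_deriveB (l1D u) D2.
have -> : l3 u = l2 u - 2 * (logistic u * l2 u + l1 u * l1 u) by [].
exact: D.
Qed.

Let l1_bound u : 0 <= l1 u <= 1.
Proof.
have := logistic_gt0 u; have := logistic_lt1 u; rewrite /l1 => h1 h0.
by apply/andP; split; nra.
Qed.

Let l2_bound u : `|l2 u| <= 1.
Proof.
have /andP[] := l1_bound u; have := logistic_gt0 u; have := logistic_lt1 u.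
rewrite /l2 => h1 h0 h2 h3; rewrite ler_norml; apply/andP; split; nra.
Qed.

Let l3_bound u : `|l3 u| <= 6.
Proof.
have /andP[] := l1_bound u; have := logistic_gt0 u; have := logistic_lt1 u.
have := l2_bound u; rewrite ler_norml => /andP[].
rewrite /l3; set a := logistic u; set b := l1 u; set c := l2 u.
move=> h1 h2 h3 h4 h5 h6; have : `|a * c| <= 1.
  by rewrite normrM -[leRHS]mulr1 ler_pM// ler_norml; apply/andP; split; lra.
rewrite ler_norml => /andP[h7 h8]; have h9 : 0 <= b * b <= 1.
  by apply/andP; split; nra.
by move/andP: h9 => [h9 h10]; rewrite ler_norml; apply/andP; split; lra.
Qed.

(** Smoothed indicator of a half-line: all derivatives of the logistic function
are polynomials in itself, hence bounded. *)
Lemma taylor3_logistic (a t k : R) : 0 < a ->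
  exists B f1 f2, taylor3 B (6 / a ^+ 3) (fun x => logistic ((x - t) / a + k)) f1 f2.
Proof.
move=> a0; pose u (x : R) := (x - t) / a + k.
exists (1 + a^-1 + a^-2), (fun x => l1 (u x) / a), (fun x => l2 (u x) / a ^+ 2).
have ai : 0 <= a^-1 by rewrite invr_ge0 ltW.
have ai2 : 0 <= a^-2 by rewrite invr_ge0 exprn_ge0// ltW.
have mu : measurable_fun setT u.
  by apply: measurable_funD => //; apply: measurable_funM => //; exact: measurable_funB.
have ml : measurable_fun setT (fun x => logistic (u x)).
  by apply: measurableT_comp => //; exact: measurable_logistic.
have ml1 : measurable_fun setT (fun x => l1 (u x)).
  by apply: measurable_funB => //; exact: measurable_funM.
have ml2 : measurable_fun setT (fun x => l2 (u x)).
  by apply: measurable_funB => //; apply: measurable_funM => //; exact: measurable_funM.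
split; first by split => //; exact: measurable_funM.
  split=> x.
  - have h := logistic_lt1 (u x); have h0 := logistic_gt0 (u x).
    by rewrite -/(u x) (ger0_norm (ltW h0)); lra.
  - have /andP[h0 h1] := l1_bound (u x).
    rewrite ger0_norm ?divr_ge0// ?ltW//.
    have : l1 (u x) / a <= a^-1 by rewrite -[leRHS]mul1r ler_wpM2r.
    by lra.
  - rewrite normrM (ger0_norm ai2).
    have : `|l2 (u x)| / a ^+ 2 <= a^-2 by rewrite -[leRHS]mul1r ler_wpM2r// l2_bound.
    by lra.
move=> x h.
have H := taylor3_bound is_derive_logistic l1D l2D l3_bound (u x) (h / a).
have a00 := lt0r_neq0 a0.
rewrite -/(u x) -/(u (x + h)).
have -> : u (x + h) = u x + h / a by rewrite /u; ring.
have -> : 6 / a ^+ 3 * `|h| ^+ 3 = 6 * `|h / a| ^+ 3.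
  by rewrite normrM (ger0_norm ai); field.
have -> : l1 (u x) / a * h = l1 (u x) * (h / a) by ring.
have -> : l2 (u x) / a ^+ 2 * (h ^+ 2 / 2) = l2 (u x) * ((h / a) ^+ 2 / 2).
  by field.
exact: H.
Qed.

End logistic.

Section tail_comparison.
Context {R : realType}.
Local Notation gam := (@normalP R 0 1).

Definition tail_ind (t x : R) : R := (t < x)%R%:R.

Lemma tail_indE t : tail_ind t = \1_(`]t, +oo[%classic).
Proof.
by apply/funext => x; rewrite /tail_ind indicE mem_setE in_itv/= andbT.
Qed.

Lemma measurable_tail_ind t : measurable_fun setT (tail_ind t).
Proof. by rewrite tail_indE; exact: measurable_indic. Qed.

Lemma tail_ind_norm t x : `|tail_ind t x| <= 1.
Proof. by rewrite /tail_ind; case: (t < x); rewrite ?normr1 ?normr0. Qed.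

Lemma Rintegral_indic d (T : measurableType d) (P : probability T R) (A : set T) :
  measurable A -> \int[P]_x (\1_A x : R) = fine (P A).
Proof. by move=> mA; rewrite /Rintegral integral_indic// setIT. Qed.

Lemma integrable_tail d (T : measurableType d) (P : probability T R) (W : T -> R) t :
  measurable_fun setT W -> P.-integrable setT (EFin \o (fun w => tail_ind t (W w))).
Proof.
move=> mW; apply: (@rintegrable_bounded _ _ _ _ 1); last by move=> w; exact: tail_ind_norm.
by apply: measurableT_comp => //; exact: measurable_tail_ind.
Qed.

Lemma tail_prob d (T : measurableType d) (P : probability T R) (W : T -> R) t :
  measurable_fun setT W ->
  \int[P]_w tail_ind t (W w) = fine (P (W @^-1` `]t, +oo[)).
Proof.
move=> mW; rewrite -Rintegral_indic; last by rewrite -[X in measurable X]setTI; exact: mW.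
by apply: eq_Rintegral => w _; rewrite tail_indE.
Qed.

Lemma normal_peak1_le1 : normal_peak 1 <= 1 :> R.
Proof.
have h : 1 <= pi *+ 2 :> R by have := @pi_ge2 R; rewrite -mulr_natr; lra.
have h1 : 1 <= Num.sqrt (pi *+ 2) :> R.
  by rewrite -[leLHS]sqrtr1 ler_sqrt// (le_trans _ h).
by rewrite /normal_peak expr1n mul1r invf_le1// (lt_le_trans _ h1).
Qed.

Lemma gauss_interval (a b : R) : a <= b -> fine (gam `]a, b]%classic) <= b - a.
Proof.
move=> ab; rewrite -lee_fin fineK ?fin_num_measure//.
apply: (@le_trans _ _ (\int[@lebesgue_measure R]_(x in `]a, b]) 1)%E).
  rewrite /normalP /= /normal_prob; apply: ge0_le_integral => //.
  - by move=> x _; rewrite lee_fin normal_pdf_ge0.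
  - by apply: measurable_funTS; exact: measurable_normal_pdfE.
  move=> x _; rewrite lee_fin.
  by apply: le_trans normal_peak1_le1; apply: normal_pdf_ub; exact: oner_neq0.
rewrite integral_cst//= mul1e lebesgue_measure_itv/=; case: ifP => //.
by rewrite lee_fin subr_ge0.
Qed.

(** The normal density is at most 1, so the tail function is 1-Lipschitz. *)
Lemma gauss_tail_shift (t h : R) : 0 <= h ->
  \int[gam]_x tail_ind (t - h) x <= \int[gam]_x tail_ind t x + h.
Proof.
move=> h0; have it u := integrable_tail gam u (@measurable_id _ _ setT).
have -> : \int[gam]_x tail_ind (t - h) x =
    \int[gam]_x (tail_ind t x + \1_(`](t - h), t]%classic) x).
  apply: eq_Rintegral => x _; rewrite /tail_ind indicE mem_setE in_itv/=.
  have [tx|xt] := ltP t x; last by rewrite andbT add0r.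
  by rewrite andbF addr0 (le_lt_trans _ tx)// gerBl.
have ii : gam.-integrable setT (EFin \o (\1_(`](t - h), t]%classic) : R -> R)).
  by apply: integrable_indic.
rewrite (RintegralD measurableT (it t) ii) lerD2l.
rewrite (Rintegral_indic gam)//; apply: le_trans (gauss_interval _) _.
  by rewrite gerBl.
by rewrite subKr.
Qed.

(** Distance to N(0, 1) seen by smooth test functions. The error is proportional to
the third-order constant [K], which is the form delivered by [lindeberg]. *)
Definition smooth_close d (T : measurableType d) (P : probability T R)
    (W : T -> R) (th : R) :=
  forall B K f f1 f2, taylor3 B K f f1 f2 ->
    `|\int[P]_w f (W w) - \int[gam]_x f x| <= K * th.

Section smoothing.
Context d (T : measurableType d) (P : probability T R) (W : T -> R).
Hypothesis mW : measurable_fun setT W.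

(** Logistic steps of width [a], shifted by [k * a] to the left and to the right,
bracket the indicator up to [eta]; the shift costs [2 * k * a] in Gaussian mass. *)
Lemma tail_smoothing (th eta a t : R) : smooth_close P W th ->
  0 < eta < 1 -> 0 < a ->
  `|\int[P]_w tail_ind t (W w) - \int[gam]_x tail_ind t x|
    <= 2 * (- ln eta) * a + 2 * eta + 6 / a ^+ 3 * th.
Proof.
move=> Wth /andP[eta0 eta1] a0; set k := - ln eta.
have k0 : 0 < k by rewrite oppr_gt0 ln_lt0// eta0.
have lk : 1 - eta <= logistic k by exact: logistic_ge.
have lNk : logistic (- k) <= eta by rewrite logisticN; lra.
pose f c x := logistic ((x - t) / a + c).
have fT c := taylor3_logistic t c a0.
have cl c : `|\int[P]_w f c (W w) - \int[gam]_x f c x| <= 6 / a ^+ 3 * th.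
  by have [B [f1 [f2 fT']]] := fT c; exact: Wth fT'.
have mf c : measurable_fun setT (f c).
  by have [B [f1 [f2 [[]]]]] := fT c.
have f01 c x : 0 < f c x < 1 by rewrite logistic_gt0 logistic_lt1.
have iP c : P.-integrable setT (EFin \o (fun w => f c (W w))).
  apply: (@rintegrable_bounded _ _ _ _ 1); first exact: measurableT_comp.
  by move=> w; have /andP[h0 h1] := f01 c (W w); rewrite ger0_norm ltW.
have iG c : gam.-integrable setT (EFin \o f c).
  apply: (@rintegrable_bounded _ _ _ _ 1); first exact: mf.
  by move=> w; have /andP[h0 h1] := f01 c w; rewrite ger0_norm ltW.
have itP u := integrable_tail P u mW.
have itG u := integrable_tail gam u (@measurable_id _ _ setT).
have up x : tail_ind t x <= f k x + eta.
  rewrite /tail_ind; have /andP[h0 _] := f01 k x; case: ltP => [tx|_]; last first.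
    by rewrite addr_ge0 ?ltW.
  have : logistic k <= f k x by apply: logistic_le; rewrite lerDr divr_ge0 ?subr_ge0 ?ltW.
  rewrite /=; lra.
have up' x : f k x <= tail_ind (t - 2 * k * a) x + eta.
  rewrite /tail_ind; have /andP[_ h1] := f01 k x; case: ltP => [_|xt].
    by rewrite /=; lra.
  rewrite add0r (le_trans _ lNk)//; apply: logistic_le.
  by rewrite -lerBrDr ler_pdivrMr//; lra.
have lo x : f (- k) x <= tail_ind t x + eta.
  rewrite /tail_ind; have /andP[_ h1] := f01 (- k) x; case: ltP => [_|xt].
    by rewrite /=; lra.
  rewrite add0r (le_trans _ lNk)//; apply: logistic_le.
  by rewrite gerDr pmulr_lle0 ?invr_gt0// subr_le0.
have lo' x : tail_ind (t + 2 * k * a) x <= f (- k) x + eta.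
  rewrite /tail_ind; have /andP[h0 _] := f01 (- k) x; case: ltP => [tx|_]; last first.
    by rewrite addr_ge0 ?ltW.
  have : logistic k <= f (- k) x.
    by apply: logistic_le; rewrite -lerBlDr opprK ler_pdivlMr//; lra.
  rewrite /=; lra.
have ka0 : 0 <= 2 * k * a by rewrite !mulr_ge0// ltW.
have ec (Q : probability T R) : \int[Q]_w eta = eta by exact: Rintegral_probability_cst.
have ecG : \int[gam]_w eta = eta by exact: Rintegral_probability_cst.
have h1 := ler_Rintegral (itP t) (rintegrableD (iP k) (rintegrable_cst P eta)) (fun w => up (W w)).
have h2 := ler_Rintegral (iG k) (rintegrableD (itG _) (rintegrable_cst gam eta)) up'.
have h3 := ler_Rintegral (iP (- k)) (rintegrableD (itP t) (rintegrable_cst P eta)) (fun w => lo (W w)).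
have h4 := ler_Rintegral (itG _) (rintegrableD (iG (- k)) (rintegrable_cst gam eta)) lo'.
rewrite (RintegralD measurableT (iP k) (rintegrable_cst P eta)) ec in h1.
rewrite (RintegralD measurableT (itG _) (rintegrable_cst gam eta)) ecG in h2.
rewrite (RintegralD measurableT (itP t) (rintegrable_cst P eta)) ec in h3.
rewrite (RintegralD measurableT (iG (- k)) (rintegrable_cst gam eta)) ecG in h4.
have h5 := gauss_tail_shift t ka0.
have h6 := gauss_tail_shift (t + 2 * k * a) ka0; rewrite addrK in h6.
have := cl k; have := cl (- k); move: ka0 h1 h2 h3 h4 h5 h6.
move: (\int[P]_w f k (W w)) (\int[gam]_x f k x) (\int[P]_w f (- k) (W w))
  (\int[gam]_x f (- k) x) (\int[P]_w tail_ind t (W w)) (\int[gam]_x tail_ind t x)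
  (\int[gam]_x tail_ind (t - 2 * k * a) x) (\int[gam]_x tail_ind (t + 2 * k * a) x)
  (2 * k * a) (6 / a ^+ 3 * th) => p1 p2 p3 p4 p5 p6 p7 p8 p9 p10.
move=> h0 h1 h2 h3 h4 h5 h6; rewrite !ler_norml => /andP[h7 h8] /andP[h9 h10].
clear -h0 h1 h2 h3 h4 h5 h6 h7 h8 h9 h10.
by apply/andP; split; lra.
Qed.

End smoothing.

(** In [tail_smoothing], choose [eta], then the width [a], and only then the
closeness [th0]: the result is uniform in the law and in the half-line. *)
Lemma kolmogorov_close (e : R) : 0 < e -> exists2 th0 : R, 0 < th0 &
  forall d (T : measurableType d) (P : probability T R) (W : T -> R) (th : R),
    measurable_fun setT W -> smooth_close P W th -> th <= th0 ->
    forall t, `|\int[P]_w tail_ind t (W w) - \int[gam]_x tail_ind t x| <= e.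
Proof.
move=> e0; pose eta := Num.min (e / 8) 2^-1.
have eta0 : 0 < eta by rewrite lt_min divr_gt0//= invr_gt0.
have eta1 : eta <= 2^-1 by rewrite ge_min lexx orbT.
have eta2 : eta <= e / 8 by rewrite ge_min lexx.
have etal : eta < 1 by lra.
pose k := - ln eta; have k0 : 0 < k by rewrite oppr_gt0 ln_lt0// eta0.
have k1 : 0 < k + 1 by lra.
pose a := e / (8 * (k + 1)); have a0 : 0 < a by rewrite divr_gt0// mulr_gt0.
have ka : 2 * k * a <= e / 4.
  have -> : 2 * k * a = (e / 4) * (k / (k + 1)) by rewrite /a; field; rewrite gt_eqF.
  by rewrite ler_piMr ?divr_ge0 ?ltW// ltr_pdivrMr// mul1r ltrDl.
exists (a ^+ 3 * e / 12); first by rewrite divr_gt0// mulr_gt0// exprn_gt0.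
move=> d T P W th mW Wth thl t.
have eta01 : 0 < eta < 1 by rewrite eta0 etal.
apply: le_trans (tail_smoothing mW t Wth eta01 a0) _.
have : 6 / a ^+ 3 * th <= e / 2.
  have -> : e / 2 = 6 / a ^+ 3 * (a ^+ 3 * e / 12) by field; rewrite gt_eqF.
  by rewrite ler_wpM2l// divr_ge0// exprn_ge0// ltW.
rewrite -/k; lra.
Qed.

(** Layer-cake formula: a [0, 1]-valued variable is the average of its tails. *)
Lemma ler_expectation_tail d1 d2 (T1 : measurableType d1) (T2 : measurableType d2)
    (P1 : probability T1 R) (P2 : probability T2 R) (X1 : T1 -> R) (X2 : T2 -> R)
    (e : R) :
  measurable_fun setT X1 -> measurable_fun setT X2 ->
  (forall t, 0 <= X1 t <= 1) -> (forall t, 0 <= X2 t <= 1) -> 0 <= e ->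
  (forall r, 0 <= r < 1 ->
     \int[P1]_t tail_ind r (X1 t) <= \int[P2]_t tail_ind r (X2 t) + e) ->
  \int[P1]_t X1 t <= \int[P2]_t X2 t + e.
Proof.
move=> mX1 mX2 X1b X2b e0 H.
have i1 : P1.-integrable setT (EFin \o X1).
  by apply: (@rintegrable_bounded _ _ _ _ 1) => // t; have /andP[h0 h1] := X1b t; rewrite ger0_norm.
have i2 : P2.-integrable setT (EFin \o X2).
  by apply: (@rintegrable_bounded _ _ _ _ 1) => // t; have /andP[h0 h1] := X2b t; rewrite ger0_norm.
pose Y1 : {RV P1 >-> R} := mfun_Sub (mem_set mX1).
pose Y2 : {RV P2 >-> R} := mfun_Sub (mem_set mX2).
have E1 : (\int[P1]_t X1 t)%:E = (\int[@lebesgue_measure R]_(r in `[0%R, +oo[) ccdf Y1 r)%E.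
  rewrite -ge0_expectation_ccdf; last by move=> t; have /andP[] := X1b t.
  by rewrite expectation_def EFin_Rintegral.
have E2 : (\int[P2]_t X2 t)%:E = (\int[@lebesgue_measure R]_(r in `[0%R, +oo[) ccdf Y2 r)%E.
  rewrite -ge0_expectation_ccdf; last by move=> t; have /andP[] := X2b t.
  by rewrite expectation_def EFin_Rintegral.
rewrite -lee_fin EFinD E1 E2.
have mc d (T : measurableType d) (P : probability T R) (Y : {RV P >-> R}) :
    measurable_fun (`[0%R, +oo[%classic : set (measurableTypeR R)) (ccdf Y).
  by apply: measurable_funTS; exact: ccdf_measurable.
have mI : measurable_fun (`[0%R, +oo[%classic : set (measurableTypeR R))
    (fun r => (e * \1_(`[0%R, 1%R]%classic) r)%:E).
  by apply: measurable_funTS; apply/measurable_EFinP; apply: measurable_funM.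
apply: (@le_trans _ _ (\int[@lebesgue_measure R]_(r in `[0%R, +oo[)
    (ccdf Y2 r + (e * \1_(`[0%R, 1%R]%classic) r)%:E))%E).
  apply: ge0_le_integral => //.
  - by apply: emeasurable_funD => //; exact: (mc _ _ P2 Y2).
  - move=> r; rewrite /= in_itv/= andbT => r0.
    have cfin d (T : measurableType d) (P : probability T R) (Y : {RV P >-> R}) :
        ccdf Y r = (\int[P]_t tail_ind r (Y t))%:E.
      by rewrite tail_prob// fineK// fin_num_measure//; exact: measurable_funPTI.
    have [r1|r1] := ltP r 1.
      rewrite !cfin -EFinD lee_fin; apply: le_trans (H r _) _; first by rewrite r0 r1.
      by rewrite lerD2l indicE mem_setE in_itv/= r0 (ltW r1) mulr1.
    rewrite (_ : ccdf Y1 r = 0%E); last first.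
      rewrite cfin (_ : (fun t => _) = (fun=> 0)) ?Rintegral_probability_cst//.
      apply/funext => t; rewrite /tail_ind ltNge (le_trans _ r1)//.
      by have /andP[] := X1b t.
    by rewrite adde_ge0// lee_fin mulr_ge0.
rewrite ge0_integralD//; last by move=> r _; rewrite lee_fin mulr_ge0.
rewrite leeD2l//.
under eq_integral do rewrite EFinM.
rewrite ge0_integralZl//; last first.
  by apply: measurable_funTS; apply/measurable_EFinP.
rewrite integral_indic// (_ : _ `&` _ = `[0%R, 1%R]%classic); last first.
  by apply/setIidPl => x /=; rewrite !in_itv/= andbT => /andP[].
have mu01 : lebesgue_measure (`[0, 1]%classic : set R) = 1%E.
  by rewrite lebesgue_measure_itv/= lte_fin ltr01 -EFinD subr0.
by rewrite [X in (_ * X)%E]mu01 mule1.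
Qed.

Definition accept_fun (m s x : R) : R := Num.min 1 (expR (m + s * x)).

Lemma accept_fun01 m s x : 0 <= accept_fun m s x <= 1.
Proof. by rewrite /accept_fun le_min ler01 expR_ge0 ge_min lexx. Qed.

Lemma measurable_accept_fun m s : measurable_fun setT (accept_fun m s).
Proof.
apply: measurable_minr => //; apply: measurableT_comp => //.
by apply: measurable_funD => //; exact: measurable_funM.
Qed.

(** The acceptance function is increasing, so each of its upper level sets is a
half-line; this makes the estimate uniform in the mean [m] and the scale [s]. *)
Lemma accept_fun_close d (T : measurableType d) (P : probability T R) (W : T -> R)
    (m s e : R) : measurable_fun setT W -> 0 < s -> 0 <= e ->
  (forall t, `|\int[P]_w tail_ind t (W w) - \int[gam]_x tail_ind t x| <= e) ->
  `|\int[P]_w accept_fun m s (W w) - \int[gam]_x accept_fun m s x| <= e.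
Proof.
move=> mW s0 e0 H.
have tE r x : 0 < r < 1 ->
    tail_ind r (accept_fun m s x) = tail_ind ((ln r - m) / s) x.
  move=> /andP[r0 r1]; rewrite /tail_ind /accept_fun lt_min r1/=.
  by rewrite -{1}(lnK r0) ltr_expR -ltrBlDl ltr_pdivrMr// mulrC.
have tE0 x : tail_ind 0 (accept_fun m s x) = 1.
  by rewrite /tail_ind /accept_fun lt_min ltr01 expR_gt0.
have ma := measurable_accept_fun m s.
have maW : measurable_fun setT (fun w => accept_fun m s (W w)).
  exact: measurableT_comp.
have tails r : 0 <= r < 1 -> `|\int[P]_w tail_ind r (accept_fun m s (W w)) -
    \int[gam]_x tail_ind r (accept_fun m s x)| <= e.
  move=> /andP[r0 r1]; move: r0; rewrite le_eqVlt => /predU1P[<-|r0].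
    under [X in `|X - _|]eq_Rintegral do rewrite tE0.
    under [X in `|_ - X|]eq_Rintegral do rewrite tE0.
    by rewrite !Rintegral_probability_cst subrr normr0.
  have r01 : 0 < r < 1 by rewrite r0 r1.
  under [X in `|X - _|]eq_Rintegral do rewrite (tE _ _ r01).
  by under [X in `|_ - X|]eq_Rintegral do rewrite (tE _ _ r01).
have a01 := accept_fun01 m s.
have h1 := @ler_expectation_tail _ _ _ _ P gam _ _ e maW ma (fun w => a01 (W w)) a01 e0.
have h2 := @ler_expectation_tail _ _ _ _ gam P _ _ e ma maW a01 (fun w => a01 (W w)) e0.
rewrite ler_norml; apply/andP; split.
- rewrite lerBrDr addrC lerBlDr; apply: h2 => r /tails.
  by rewrite ler_norml => /andP[]; lra.
- rewrite lerBlDl; apply: h1 => r /tails.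
  by rewrite ler_norml => /andP[]; lra.
Qed.

(** Split at the point where the exponent vanishes: above it the function is 1,
and below it the exponential factor shifts the Gaussian ([ge0_integral_normal_tilt]). *)
Lemma gauss_accept_fun (m s : R) : 0 < s ->
  \int[gam]_x accept_fun m s x =
  normal_cdf (m / s) + expR (m + s ^+ 2 / 2) * normal_cdf (- s - m / s).
Proof.
move=> s0; pose A : set (measurableTypeR R) := `]-oo, (- (m / s))]%classic.
pose B : set (measurableTypeR R) := `](- (m / s)), +oo[%classic.
have mA : measurable A by exact: measurable_itv.
have mB : measurable B by exact: measurable_itv.
have iE : gam.-integrable setT (EFin \o (fun x : R => \1_A x * expR (s * x))).
  have mE : measurable_fun setT (fun x : R => expR (s * x)).
    by apply: measurableT_comp => //; exact: measurable_funM.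
  apply: (rintegrable_le _ _ (integrable_gam_expR s)).
    by apply: measurable_funM; [exact: measurable_indic|exact: mE].
  move=> x; rewrite indicE; case: (x \in A).
    by rewrite mul1r ger0_norm// expR_ge0.
  by rewrite mul0r normr0 expR_ge0.
have iB : gam.-integrable setT (EFin \o (\1_B : R -> R)) by exact: integrable_indic.
have cE u : \int[gam]_x (\1_(`]-oo, u]%classic) x : R) = normal_cdf u.
  by rewrite (Rintegral_indic gam).
have -> : \int[gam]_x accept_fun m s x =
    \int[gam]_x (\1_B x + expR m * (\1_A x * expR (s * x))).
  apply: eq_Rintegral => x _; rewrite /accept_fun !indicE !mem_setE !in_itv/= andbT.
  rewrite -[_ < x]negbK -leNgt; have xE : (x <= - (m / s)) = (m + s * x <= 0).
    by rewrite -mulNr ler_pdivlMr// -subr_le0 opprK addrC mulrC.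
  rewrite xE -expR_le1; case: leP => h /=.
    by rewrite add0r mul1r -expRD.
  by rewrite mul0r mulr0 addr0.
rewrite (RintegralD measurableT iB (rintegrableZ (expR m) iE)).
rewrite (RintegralZl _ measurableT iE) expRD -mulrA; congr (_ + _ * _).
- rewrite (Rintegral_indic gam)// /normal_cdf; congr fine.
  have opp := @ge0_integral_normal_opp R (EFin \o \1_(`]-oo, (m / s)[%classic)).
  transitivity (gam `]-oo, (m / s)[%classic); last first.
    rewrite /normalP /= /normal_prob integral_itv_bndo_bndc//.
    by apply: measurable_funTS; exact: measurable_normal_pdfE.
  transitivity (\int[gam]_x ((\1_(`]-oo, (m / s)[%classic) x : R)%:E))%E; last first.
    by rewrite integral_indic// setIT.
  rewrite -opp; [|exact/measurable_EFinP|by move=> y; rewrite lee_fin].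
  transitivity (\int[gam]_x ((\1_B x : R)%:E))%E; first by rewrite integral_indic// setIT.
  apply: eq_integral => x _ /=; rewrite !indicE !mem_setE !in_itv/= andbT.
  by rewrite ltrNl.
- have yE y : (y + s <= - (m / s)) = (y <= - s - m / s).
    by apply/idP/idP => h; lra.
  rewrite -cE /Rintegral; under eq_integral do rewrite EFinM.
  rewrite (@ge0_integral_normal_tilt R s (EFin \o \1_A)); last 2 first.
  + exact/measurable_EFinP.
  + by move=> y; rewrite lee_fin.
  rewrite fineM//; last first.
    rewrite (_ : (fun y => _) = (fun y => (\1_(`]-oo, (- s - m / s)]%classic) y : R)%:E)).
      by rewrite integral_indic// setIT fin_num_measure.
    apply/funext => y /=; rewrite !indicE !mem_setE !in_itv/=.
    by rewrite yE.
  congr (_ * fine _); apply: eq_integral => y _ /=.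
  by rewrite !indicE !mem_setE !in_itv/= yE.
Qed.

End tail_comparison.

(** * Orthogonal invariance of Gaussian families *)

Section orthogonal_invariance.
Context d (T : measurableType d) (R : realType) (P : probability T R) (n : nat).
Local Notation gam := (@normalP R 0 1).
Local Notation family := ('I_n -> T -> measurableTypeR R).

Lemma gam2_rotate_box (c s : R) (B C : set (measurableTypeR R)) :
  c ^+ 2 + s ^+ 2 = 1 -> s != 0 -> measurable B -> measurable C ->
  (gam \x gam)%E [set z | B (c * z.1 + s * z.2) /\ C (- s * z.1 + c * z.2)] =
  (gam B * gam C)%E.
Proof.
move=> cs s0 mB mC.
pose F (z : measurableTypeR R * measurableTypeR R) : \bar R := (\1_(B `*` C) z)%:E.
have mBC : measurable (B `*` C) by exact: measurableX.
have mF : measurable_fun setT F by apply/measurable_EFinP; exact: measurable_indic.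
have F0 z : (0 <= F z)%E by rewrite lee_fin.
pose rot (z : measurableTypeR R * measurableTypeR R) :
  measurableTypeR R * measurableTypeR R := (c * z.1 + s * z.2, - s * z.1 + c * z.2).
have mrot : measurable_fun setT rot.
  by apply: measurable_fun_pair; apply: measurable_funD; exact: measurable_funM.
pose D := rot @^-1` (B `*` C).
have mD : measurable D by rewrite -[X in measurable X]setTI; exact: mrot.
have := ge0_integral_gam2_rotate cs s0 mF F0.
have -> : (\int[gam \x gam]_z F z = gam B * gam C)%E.
  by rewrite /F integral_indic// setIT; exact: product_measure1E.
move=> <-; transitivity (\int[gam \x gam]_z ((\1_D z : R)%:E))%E.
  by rewrite (@integral_indic _ _ _ (gam \x gam)%E setT measurableT D mD) setIT.
by apply: eq_integral => z _; rewrite /F !indicE.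
Qed.

(** One formula for both objects that get rotated: the random family, and the rows
of the matrix acting on it. *)
Definition givens_row (i j : 'I_n) (c s : R) (V : lmodType R) (Z : 'I_n -> V) k : V :=
  if k == i then c *: Z i + s *: Z j
  else if k == j then - s *: Z i + c *: Z j else Z k.

Definition flip_row (i : 'I_n) (V : lmodType R) (Z : 'I_n -> V) k : V :=
  if k == i then - Z i else Z k.

Section family.
Variable Z : family.
Hypotheses (mZ : forall k, measurable_fun setT (Z k)) (iidZ : iid P gam Z).

Lemma iid_givens (i j : 'I_n) (c s : R) : i != j -> c ^+ 2 + s ^+ 2 = 1 -> s != 0 ->
  iid P gam (fun k w => givens_row i j c s (fun l => Z l w : R^o) k : measurableTypeR R).
Proof.
move=> ij cs s0 B mB.
pose A := [set t | forall k, (k != i) && (k != j) -> B k (Z k t)].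
pose D := [set z : measurableTypeR R * measurableTypeR R |
  B i (c * z.1 + s * z.2) /\ B j (- s * z.1 + c * z.2)].
have mA : measurable A.
  exact: (@measurable_iid_box _ _ _ _ _ Z mZ B (fun k => (k != i) && (k != j))).
have PA : P A = (\prod_(k | (k != i) && (k != j)) gam (B k))%E.
  exact: (iid_sub iidZ (fun k => (k != i) && (k != j)) mB).
have mD : measurable D.
  have mr1 : measurable_fun setT (fun z : measurableTypeR R * measurableTypeR R =>
      c * z.1 + s * z.2 : measurableTypeR R).
    by apply: measurable_funD; exact: measurable_funM.
  have mr2 : measurable_fun setT (fun z : measurableTypeR R * measurableTypeR R =>
      - s * z.1 + c * z.2 : measurableTypeR R).
    by apply: measurable_funD; exact: measurable_funM.
  rewrite (_ : D = (fun z : measurableTypeR R * measurableTypeR R =>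
      c * z.1 + s * z.2 : measurableTypeR R) @^-1` (B i) `&`
     (fun z : measurableTypeR R * measurableTypeR R =>
      - s * z.1 + c * z.2 : measurableTypeR R) @^-1` (B j))//.
  by apply: measurableI; rewrite -[X in measurable X]setTI; [exact: mr1|exact: mr2].
transitivity (P (A `&` [set t | D (Z i t, Z j t)])).
  congr (P _); apply/seteqP; split => t /=.
    move=> H; split.
      by move=> k /andP[ki kj]; have := H k; rewrite /givens_row (negbTE ki) (negbTE kj).
    split; first by have := H i; rewrite /givens_row eqxx.
    by have := H j; rewrite /givens_row eq_sym (negbTE ij) eqxx.
  move=> [At [Di Dj]] k; rewrite /givens_row; case: (eqVneq k i) => [->//|ki].
  by case: (eqVneq k j) => [->//|kj]; apply: At; rewrite ki.
rewrite (joint_law_on_event (mu1 := gam) (mu2 := gam) (mZ i) (mZ j) mA _ mD).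
  rewrite (gam2_rotate_box cs s0 (mB i) (mB j)) PA.
  rewrite [RHS](bigD1 i)//= [X in _ = (_ * X)%E](bigD1 j) ?(eq_sym j)//=.
  by rewrite [RHS]muleA [LHS]muleC.
move=> B1 C1 mB1 mC1.
pose B' k := if k == i then B1 else if k == j then C1 else B k.
have mB' k : measurable (B' k) by rewrite /B'; case: ifP => // _; case: ifP.
transitivity (P [set t | forall k, B' k (Z k t)]).
  congr (P _); apply/seteqP; split => t /=.
    move=> [At [Zi Zj]] k; rewrite /B'; case: (eqVneq k i) => [->//|ki].
    by case: (eqVneq k j) => [->//|kj]; apply: At; rewrite ki.
  move=> H; split; last split.
  - by move=> k /andP[ki kj]; have := H k; rewrite /B' (negbTE ki) (negbTE kj).
  - by have := H i; rewrite /B' eqxx.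
  - by have := H j; rewrite /B' eq_sym (negbTE ij) eqxx.
rewrite (iidZ mB') PA (bigD1 i)//= [X in (_ * X)%E = _](bigD1 j) ?(eq_sym j)//=.
rewrite {1 2}/B' eqxx (eq_sym j) (negbTE ij) eqxx muleA muleC; congr (_ * _)%E.
by apply: eq_bigr => k /andP[ki kj]; rewrite /B' (negbTE ki) (negbTE kj).
Qed.

Lemma iid_flip (i : 'I_n) :
  iid P gam (fun k w => flip_row i (fun l => Z l w : R^o) k : measurableTypeR R).
Proof.
move=> B mB; pose Bi : set (measurableTypeR R) := -%R @^-1` (B i).
have mBi : measurable Bi.
  have mN : measurable_fun setT (-%R : measurableTypeR R -> measurableTypeR R) by [].
  by rewrite -[X in measurable X]setTI; exact: mN.
have gBi : gam Bi = gam (B i).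
  have := @ge0_integral_normal_opp R (EFin \o \1_(B i)).
  rewrite [X in _ -> _ -> _ = X]integral_indic// setIT => <-//.
  - transitivity (\int[gam]_y (\1_Bi y : R)%:E)%E; first by rewrite integral_indic// setIT.
    by apply: eq_integral => y _; rewrite /= !indicE.
  - by apply/measurable_EFinP; apply: measurable_indic; exact: mB.
  - by move=> y; rewrite lee_fin.
pose B' k := if k == i then Bi else B k.
have mB' k : measurable (B' k) by rewrite /B'; case: ifP.
transitivity (P [set t | forall k, B' k (Z k t)]).
  congr (P _); apply/seteqP; split => t /= H k; have := H k;
    by rewrite /B' /flip_row; case: (eqVneq k i) => [->|].
rewrite (iidZ mB'); apply: eq_bigr => k _; rewrite /B'.
by case: (eqVneq k i) => [->|].
Qed.

End family.

Definition linfam (A : 'M[R]_n) (Z : family) : family :=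
  fun k w => \sum_l A k l * Z l w.

Definition gauss_stable (A : 'M[R]_n) := forall Z : family,
  (forall k, measurable_fun setT (Z k)) -> iid P gam Z -> iid P gam (linfam A Z).

Lemma measurable_linfam A (Z : family) : (forall k, measurable_fun setT (Z k)) ->
  forall k, measurable_fun setT (linfam A Z k).
Proof.
by move=> mZ k; apply: measurable_sum => l; apply: measurable_funM => //; exact: mZ.
Qed.

Definition givens (i j : 'I_n) (c s : R) (A : 'M[R]_n) : 'M[R]_n :=
  \matrix_(k, l) givens_row i j c s (fun k => A k l : R^o) k.

Definition flip (i : 'I_n) (A : 'M[R]_n) : 'M[R]_n :=
  \matrix_(k, l) flip_row i (fun k => A k l : R^o) k.

(** Undo the rotation: [A] is the inverse rotation of its rotated version. *)
Lemma stable_givens i j c s A : i != j -> c ^+ 2 + s ^+ 2 = 1 -> s != 0 ->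
  gauss_stable (givens i j c s A) -> gauss_stable A.
Proof.
move=> ij cs s0 H Z mZ iZ.
have cs' : c ^+ 2 + (- s) ^+ 2 = 1 by rewrite sqrrN.
have s0' : - s != 0 by rewrite oppr_eq0.
have := iid_givens (measurable_linfam (givens i j c s A) mZ) (H Z mZ iZ) ij cs' s0'.
congr (iid P gam _); apply/funext => k; apply/funext => w.
rewrite /givens_row /linfam opprK; have ji : (j == i) = false by rewrite eq_sym (negbTE ij).
have Ei l : givens i j c s A i l = c * A i l + s * A j l.
  by rewrite mxE /givens_row eqxx.
have Ej l : givens i j c s A j l = - s * A i l + c * A j l.
  by rewrite mxE /givens_row ji eqxx.
case: (eqVneq k i) => [->|ki].
  rewrite -[LHS]/(c * _ + - s * _) !mulr_sumr -big_split/=; apply: eq_bigr => l _.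
  rewrite Ei Ej.
  transitivity ((c ^+ 2 + s ^+ 2) * (A i l * Z l w)); first by ring.
  by rewrite cs mul1r.
case: (eqVneq k j) => [->|kj].
  rewrite -[LHS]/(s * _ + c * _) !mulr_sumr -big_split/=; apply: eq_bigr => l _.
  rewrite Ei Ej.
  transitivity ((c ^+ 2 + s ^+ 2) * (A j l * Z l w)); first by ring.
  by rewrite cs mul1r.
by apply: eq_bigr => l _; rewrite mxE /givens_row (negbTE ki) (negbTE kj).
Qed.

Lemma stable_flip i A : gauss_stable (flip i A) -> gauss_stable A.
Proof.
move=> H Z mZ iZ.
have := iid_flip (H Z mZ iZ) i.
congr (iid P gam _); apply/funext => k; apply/funext => w.
rewrite /flip_row /linfam; case: (eqVneq k i) => [->|ki].
  rewrite -[LHS]mulN1r mulr_sumr; apply: eq_bigr => l _.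
  by rewrite mxE /flip_row eqxx mulN1r mulNr opprK.
by apply: eq_bigr => l _; rewrite mxE /flip_row (negbTE ki).
Qed.

Lemma gramE (A : 'M[R]_n) l m : (A^T *m A) l m = \sum_k A k l * A k m.
Proof. by rewrite mxE; apply: eq_bigr => k _; rewrite mxE. Qed.

Lemma gram_givens i j c s A : i != j -> c ^+ 2 + s ^+ 2 = 1 ->
  (givens i j c s A)^T *m givens i j c s A = A^T *m A.
Proof.
move=> ij cs; apply/matrixP => l m; rewrite !gramE.
have ji : j != i by rewrite eq_sym.
rewrite (bigD1 i)//= (bigD1 j)//= [RHS](bigD1 i)//= [X in _ = _ + X](bigD1 j)//=.
rewrite !addrA; congr (_ + _); last first.
  by apply: eq_bigr => k /andP[ki kj]; rewrite !mxE /givens_row (negbTE ki) (negbTE kj).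
rewrite !mxE /givens_row !eqxx (negbTE ji) /GRing.scale/=.
transitivity ((c ^+ 2 + s ^+ 2) * (A i l * A i m + A j l * A j m)); first by ring.
by rewrite cs mul1r.
Qed.

Lemma gram_flip i A : (flip i A)^T *m flip i A = A^T *m A.
Proof.
apply/matrixP => l m; rewrite !gramE; apply: eq_bigr => k _.
by rewrite !mxE /flip_row; case: ifP => // /eqP ->; rewrite mulrNN.
Qed.

(** Givens elimination: rotations in coordinate planes, followed by sign changes,
reduce the matrix to the identity, and each of them preserves the Gaussian law of
the family. Orthonormality of the columns takes care of the entries above the
diagonal. *)
Theorem orthogonal_stable (A : 'M[R]_n) : A^T *m A = 1%:M -> gauss_stable A.
Proof.
(* The first [m] columns already agree with those of the identity. *)
suff main e m : (n - m = e)%N -> forall B : 'M[R]_n, B^T *m B = 1%:M ->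
    (forall q l : 'I_n, (q < m)%N -> B l q = (l == q)%:R) -> gauss_stable B.
  by move=> AA; apply: (main n 0%N (subn0 n) A AA).
elim: e m => [|e IH] m nm B BB Bcol.
  have -> : B = 1%:M.
    by apply/matrixP => l q; rewrite Bcol ?mxE// (leq_trans (ltn_ord q))// -subn_eq0 nm.
  move=> Z mZ; congr (iid P gam _); apply/funext => k; apply/funext => w.
  rewrite /linfam (bigD1 k)//= big1 ?addr0 => [|l lk]; rewrite mxE ?eqxx ?mul1r//.
  by rewrite eq_sym (negbTE lk) mul0r.
have mn : (m < n)%N by rewrite -subn_gt0 nm.
pose k : 'I_n := Ordinal mn.
have nm' : (n - m.+1 = e)%N by rewrite subnS nm.
(* Within column [k], induct on the number of nonzero entries below the diagonal. *)
suff inner c (C : 'M[R]_n) : (#|[set l : 'I_n | (k < l)%N && (C l k != 0)%R]%SET| <= c)%N ->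
    C^T *m C = 1%:M ->
    (forall q l : 'I_n, (q < m)%N -> C l q = (l == q)%:R) -> gauss_stable C.
  exact: inner (leqnn _) BB Bcol.
elim: c C => [|c IHc] C.
  rewrite leqn0 cards_eq0 => /eqP C0 CC Ccol.
  have Clk (l : 'I_n) : l != k -> C l k = 0.
    move=> lk; have [kl|] := ltnP k l.
      apply/eqP; have := finset.in_set0 l; rewrite -C0 inE kl/= => /negbT.
      by rewrite negbK.
    rewrite leq_eqVlt => /orP[/eqP lk'|lk'].
      by move: lk; rewrite (val_inj lk') eqxx.
    have := congr1 (fun X : 'M[R]_n => X l k) CC; rewrite gramE mxE (negbTE lk).
    rewrite (bigD1 l)//= big1 ?addr0 => [|p pl]; rewrite (Ccol l _ lk').
      by rewrite eqxx mul1r.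
    by rewrite (negbTE pl) mul0r.
  have Ckk : C k k ^+ 2 = 1.
    have := congr1 (fun X : 'M[R]_n => X k k) CC; rewrite gramE mxE eqxx.
    rewrite (bigD1 k)//= big1 ?addr0 ?expr2// => p pk.
    by rewrite Clk// mul0r.
  have finish (D : 'M[R]_n) : D^T *m D = 1%:M -> D k k = 1 ->
      (forall l, l != k -> D l k = 0) ->
      (forall q l : 'I_n, (q < m)%N -> D l q = (l == q)%:R) -> gauss_stable D.
    move=> DD Dkk Dlk Dcol; apply: (IH m.+1 nm' D DD) => q l.
    rewrite ltnS leq_eqVlt => /orP[/eqP qm|]; last exact: Dcol.
    have -> : q = k by exact: val_inj.
    by case: (eqVneq l k) => [->//|lk]; exact: Dlk.
  move/eqP: Ckk; rewrite sqrf_eq1 => /orP[/eqP C1|/eqP CN1]; first exact: finish.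
  apply: (@stable_flip k); apply: finish.
  - by rewrite gram_flip.
  - by rewrite mxE /flip_row eqxx CN1 opprK.
  - by move=> l lk; rewrite mxE /flip_row (negbTE lk) Clk.
  - move=> q l qm; rewrite mxE /flip_row; case: (eqVneq l k) => [->|_]; last exact: Ccol.
    have kq : (k == q) = false.
      by apply/negbTE; rewrite -(inj_eq val_inj)/= gtn_eqF.
    by rewrite Ccol// kq oppr0.
move=> Ccard CC Ccol.
have [C0|[l]] := set_0Vmem [set l : 'I_n | (k < l)%N && (C l k != 0)%R]%SET.
  by apply: IHc => //; rewrite C0 cards0.
rewrite inE => /andP[kl Clk].
have kl' : k != l by rewrite -(inj_eq val_inj) ltn_eqF.
have lk' : (l == k) = false by rewrite eq_sym (negbTE kl').
pose r := Num.sqrt (C k k ^+ 2 + C l k ^+ 2).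
have r2 : r ^+ 2 = C k k ^+ 2 + C l k ^+ 2 by rewrite sqr_sqrtr// addr_ge0 ?sqr_ge0.
have r0 : r != 0.
  by rewrite -sqrf_eq0 r2 paddr_eq0 ?sqr_ge0// negb_and orbC sqrf_eq0 Clk.
pose a := C k k / r; pose b := C l k / r.
have ab : a ^+ 2 + b ^+ 2 = 1.
  by rewrite !expr_div_n -mulrDl -r2 divff// sqrf_eq0.
have b0 : b != 0 by rewrite mulf_neq0// invr_eq0.
apply: (stable_givens kl' ab b0); apply: IHc; last first.
- move=> q p qm; have qk : (k == q) = false.
    by apply/negbTE; rewrite -(inj_eq val_inj)/= gtn_eqF.
  have ql : (l == q) = false.
    apply/negbTE; rewrite -(inj_eq val_inj)/= gtn_eqF//.
    exact: (ltn_trans qm kl).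
  rewrite mxE /givens_row !Ccol// qk ql !scaler0 addr0.
  case: (eqVneq p k) => [->|_]; first by rewrite qk.
  by case: (eqVneq p l) => [->|_]; rewrite ?ql.
- by rewrite gram_givens.
- rewrite -ltnS; apply: leq_trans Ccard; apply: proper_card.
  apply/properP; split.
    apply/fintype.subsetP => p; rewrite !inE => /andP[kp]; rewrite kp mxE /givens_row.
    have -> : (p == k) = false by apply/negbTE; rewrite -(inj_eq val_inj) gtn_eqF.
    by case: (eqVneq p l) => [->|].
  exists l; first by rewrite inE kl Clk.
  rewrite inE kl/= negbK mxE /givens_row lk' eqxx /GRing.scale/=.
  by apply/eqP; rewrite /a /b; field.
Qed.

End orthogonal_invariance.

(** * Functions of a matrix in its eigenbasis *)

Section functions_of_a_matrix.
Context (R : realType) (n : nat) (Q : 'M[R]_n).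
Hypothesis QQ : Q^T *m Q = 1%:M.
Implicit Types (a b : 'I_n -> R) (u v : 'cV[R]_n).

Definition fmx a : 'M[R]_n := Q *m diag_mx (\row_k a k) *m Q^T.
Definition coef (k : 'I_n) u : R := ((col k Q)^T *m u) 0 0.

Let QQ' : Q *m Q^T = 1%:M. Proof. exact: mulmx1C. Qed.

Lemma coefE k u : coef k u = (Q^T *m u) k 0.
Proof.
rewrite /coef tr_col !mxE; apply: eq_bigr => j _; by rewrite !mxE.
Qed.

Lemma coefD k u v : coef k (u + v) = coef k u + coef k v.
Proof. by rewrite !coefE mulmxDr mxE. Qed.

Lemma coefB k u v : coef k (u - v) = coef k u - coef k v.
Proof. by rewrite !coefE mulmxBr !mxE. Qed.

Lemma coefZ k c u : coef k (c *: u) = c * coef k u.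
Proof. by rewrite !coefE -scalemxAr mxE. Qed.

Lemma fmxM a b : fmx a *m fmx b = fmx (fun k => a k * b k).
Proof.
rewrite /fmx !mulmxA -(mulmxA _ Q^T Q) QQ mulmx1 -(mulmxA Q) mulmx_diag.
by congr (_ *m diag_mx _ *m _); apply/rowP => k; rewrite !mxE.
Qed.

Lemma fmxB a b : fmx a - fmx b = fmx (fun k => a k - b k).
Proof.
rewrite /fmx -mulmxBl -mulmxBr -raddfB; congr (_ *m diag_mx _ *m _).
by apply/rowP => k; rewrite !mxE.
Qed.

Lemma fmxD a b : fmx a + fmx b = fmx (fun k => a k + b k).
Proof.
rewrite /fmx -mulmxDl -mulmxDr -raddfD; congr (_ *m diag_mx _ *m _).
by apply/rowP => k; rewrite !mxE.
Qed.

Lemma fmxT a : (fmx a)^T = fmx a.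
Proof. by rewrite /fmx !trmx_mul trmxK tr_diag_mx mulmxA. Qed.

Lemma fmx1 : fmx (fun=> 1) = 1%:M.
Proof.
rewrite /fmx (_ : \row_k 1 = const_mx 1); last by apply/rowP => k; rewrite !mxE.
by rewrite diag_const_mx mulmx1.
Qed.

Lemma eq_fmx a b : a =1 b -> fmx a = fmx b.
Proof. by move=> ab; congr fmx; apply/funext. Qed.

Lemma fmxV a : (forall k, a k != 0) ->
  fmx a \in unitmx /\ invmx (fmx a) = fmx (fun k => (a k)^-1).
Proof.
move=> a0; have e : fmx (fun k => (a k)^-1) *m fmx a = 1%:M.
  by rewrite fmxM -fmx1; apply: eq_fmx => k; rewrite mulVf.
have [_ ua] := mulmx1_unit e; split => //.
by rewrite -[LHS]mul1mx -e mulmxK.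
Qed.

Lemma det_fmx a : \det (fmx a) = \prod_k a k.
Proof.
rewrite /fmx !det_mulmx mulrAC -det_mulmx QQ' det1 mul1r det_diag.
by apply: eq_bigr => k _; rewrite mxE.
Qed.

Lemma trQ_fmx a : Q^T *m fmx a = diag_mx (\row_k a k) *m Q^T.
Proof. by rewrite /fmx !mulmxA QQ mul1mx. Qed.

Lemma coef_fmx k a u : coef k (fmx a *m u) = a k * coef k u.
Proof.
by rewrite !coefE mulmxA trQ_fmx -mulmxA mul_diag_mx !mxE.
Qed.

Lemma quad_fmx a u : (u^T *m fmx a *m u) 0 0 = \sum_k a k * coef k u ^+ 2.
Proof.
rewrite (_ : _ *m u = (Q^T *m u)^T *m (diag_mx (\row_k a k) *m (Q^T *m u))).
  rewrite mxE; apply: eq_bigr => k _.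
  by rewrite coefE; move: (Q^T *m u) => v; rewrite mul_diag_mx !mxE mulrCA -expr2.
by rewrite /fmx trmx_mul trmxK !mulmxA.
Qed.

Lemma fmx_col a k : fmx a *m col k Q = a k *: col k Q.
Proof.
rewrite colE /fmx -!mulmxA (mulmxA Q^T) QQ mul1mx scalemxAr; congr (_ *m _).
apply/colP => j; rewrite mul_diag_mx !mxE eqxx andbT.
by case: eqVneq => [->//|_]; rewrite !mulr0.
Qed.

Lemma coef_col k : coef k (col k Q) = 1.
Proof. by rewrite coefE colE mulmxA QQ mul1mx mxE !eqxx. Qed.

Lemma col_neq0 k : col k Q != 0.
Proof.
apply/eqP => c0; have := coef_col k; rewrite c0 coefE mulmx0 mxE => /eqP.
by rewrite eq_sym oner_eq0.
Qed.

Lemma fmx_eigen a k (c : R) : fmx a *m col k Q = c *: col k Q -> a k = c.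
Proof.
by rewrite fmx_col => /(congr1 (coef k)); rewrite !coefZ coef_col !mulr1.
Qed.

(** Positive semidefinite square roots are unique: if [w] is the defect
[S q - s q] on an eigenvector [q], then [S w + s w = 0], and pairing with [w]
gives a sum of two nonnegative terms, one of which is [s] times the square norm
of [w]. *)
Lemma sqrt_fmx_coef (S : 'M[R]_n) (s : 'I_n -> R) k u : 0 < s k ->
  is_sqrtmx S (fmx (fun k => s k ^+ 2)) -> coef k (S *m u) = s k * coef k u.
Proof.
move=> s0 [[Ssym Spos] SS].
have ST : S^T = S.
  move/is_hermitianmxP: Ssym; rewrite expr0 scale1r => {2}->.
  by apply/matrixP => i j; rewrite !mxE.
suff e : S *m col k Q = s k *: col k Q.
  by rewrite /coef mulmxA -{1}ST -trmx_mul e linearZ/= -scalemxAl mxE.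
pose w := S *m col k Q - s k *: col k Q.
have w0 : S *m w + s k *: w = 0.
  rewrite /w mulmxBr mulmxA SS fmx_col -scalemxAr scalerBr scalerA -expr2.
  by rewrite addrA subrK subrr.
have : (w^T *m S *m w) 0 0 + s k * (w^T *m w) 0 0 = 0.
  have := congr1 (fun X : 'cV[R]_n => (w^T *m X) 0 0) w0.
  by rewrite mulmxDr mulmx0 -scalemxAr mulmxA !mxE.
have ww : (w^T *m w) 0 0 = \sum_j w j 0 ^+ 2.
  by rewrite mxE; apply: eq_bigr => j _; rewrite mxE expr2.
have ww0 : 0 <= (w^T *m w) 0 0 by rewrite ww; apply: sumr_ge0 => j _; exact: sqr_ge0.
have sww0 : 0 <= s k * (w^T *m w) 0 0 by apply: mulr_ge0 => //; exact: ltW.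
move=> /eqP; rewrite paddr_eq0 ?Spos// => /andP[_].
rewrite mulf_eq0 gt_eqF//= ww psumr_eq0 => [/allP wj|j _]; last exact: sqr_ge0.
have : w = 0.
  apply/colP => j; have := wj j (mem_index_enum _); rewrite /= sqrf_eq0 => /eqP ->.
  by rewrite mxE.
by move/eqP; rewrite subr_eq0 => /eqP.
Qed.

(** The normalising constant does not depend on the mean, so it drops out of the
acceptance ratio. *)
Lemma mvnormal_pdf_fmx (c : 'I_n -> R) : (forall k, 0 < c k) ->
  exists2 N : R, 0 < N & forall m x, mvnormal_pdf m (fmx c) x =
    N * expR (- (\sum_k (coef k x - coef k m) ^+ 2 / c k) / 2).
Proof.
move=> c0; exists (Num.sqrt ((2 * pi) ^+ n * \det (fmx c)))^-1.
  rewrite invr_gt0 sqrtr_gt0 mulr_gt0// ?exprn_gt0 ?mulr_gt0 ?pi_gt0//.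
  by rewrite det_fmx prodr_gt0.
move=> m' x'; rewrite /mvnormal_pdf; congr (_ * expR (- _ / 2)).
have [_ ->] := @fmxV c (fun k => lt0r_neq0 (c0 k)).
by rewrite quad_fmx; apply: eq_bigr => k _; rewrite coefB mulrC.
Qed.

End functions_of_a_matrix.

(** * The acceptance ratio in the eigenbasis *)

Section ar_coordinates.
Context (R : realType) (n : nat) (D : ar_data R n).
Hypotheses (hs : splitting_hyp D) (hp : spectral_hyp D).
Local Notation Q := (dQ D).
Local Notation lam := (dlam D).
Local Notation lamt := (dlamt D).
Local Notation G := (dGk D).
Local Notation coef := (coef Q).

Let QQ : Q^T *m Q = 1%:M := Q_orth hp.

Lemma ar_functions : exists Mk Nk : 'I_n -> R,
  [/\ dM D = fmx Q Mk, dN D = fmx Q Nk, (forall k, Mk k - Nk k = lamt k ^+ 2),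
      (forall k, 0 < Mk k + Nk k) & (forall k, Nk k = G k * Mk k)].
Proof.
have [f Mf] := M_fun hp; have [h Nh] := N_fun hp.
pose Mk k := f (lam k ^+ 2); pose Nk k := h (lam k ^+ 2).
have ME : dM D = fmx Q Mk by [].
have NE : dN D = fmx Q Nk by [].
exists Mk, Nk; split => //.
- move=> k; apply: (fmx_eigen QQ (a := fun k => Mk k - Nk k)).
  by rewrite -fmxB -ME -NE; exact: calA_eig hp k.
- move=> k; have [_ pos] := MTN_posdef hs; have := pos _ (col_neq0 QQ k).
  rewrite ME NE fmxT fmxD quad_fmx (bigD1 k)//= coef_col// expr1n mulr1.
  rewrite big1 ?addr0// => j jk; rewrite coefE colE mulmxA QQ mul1mx mxE (negbTE jk).
  by rewrite expr0n mulr0.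
- move=> k; apply: (fmx_eigen QQ); rewrite -NE.
  have e := itG_eig hp k; have := congr1 (mulmx (dM D)) e.
  rewrite /itG -scalemxAr !mulmxA mulmxV ?(M_unit hs)// mul1mx ME fmx_col//.
  by rewrite scalerA.
Qed.

(** The product of the eigenvalues of M - N and M^T + N is (1 - G_k^2) times the
square of the eigenvalue of M. *)
Lemma g_gt0 k : 0 < g_ D k.
Proof.
have [Mk [Nk [_ _ MN MNp NG]]] := ar_functions.
have h1 : 0 < Mk k - Nk k by rewrite MN exprn_gt0// (lamt_gt0 hp).
have h2 := MNp k; have m0 : 0 < Mk k by lra.
rewrite /g_; rewrite NG in h1 h2; have h3 := mulr_gt0 h1 h2.
have m2 : 0 < Mk k ^+ 2 by rewrite exprn_gt0.
rewrite -(pmulr_rgt0 _ m2); apply: le_lt_trans (le_refl _) _.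
by move: h3; congr (0 < _); ring.
Qed.

Definition scale_y k : R := Num.sqrt (g_ D k) / lamt k.

Lemma scale_y_gt0 k : 0 < scale_y k.
Proof. by rewrite divr_gt0 ?sqrtr_gt0 ?g_gt0 ?(lamt_gt0 hp). Qed.

Lemma scale_y2 k : scale_y k ^+ 2 = g_ D k / lamt k ^+ 2.
Proof. by rewrite expr_div_n sqr_sqrtr// ltW// g_gt0. Qed.

Lemma invA_fmx : invmx (dA D) = fmx Q (fun k => (lam k ^+ 2)^-1).
Proof.
have l0 k : lam k ^+ 2 != 0 by rewrite sqrf_eq0 gt_eqF// (lam_gt0 hp).
by have [_ <-] := fmxV QQ l0; rewrite {1}(A_spectral hp).
Qed.

Lemma ar_matrices : exists Mk : 'I_n -> R,
  [/\ invmx (calA D) = fmx Q (fun k => (lamt k ^+ 2)^-1),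
      invmx (dM D) = fmx Q (fun k => (Mk k)^-1),
      itG D = fmx Q G & (forall k, (1 - G k) * Mk k = lamt k ^+ 2)].
Proof.
have [Mk [Nk [ME NE MN MNp NG]]] := ar_functions.
have M0 k : Mk k != 0.
  have h1 : 0 < Mk k - Nk k by rewrite MN exprn_gt0// (lamt_gt0 hp).
  by have h2 := MNp k; apply: lt0r_neq0; lra.
have [_ iM] := fmxV QQ M0.
exists Mk; split.
- have l0 k : Mk k - Nk k != 0 by rewrite MN sqrf_eq0 gt_eqF// (lamt_gt0 hp).
  rewrite /calA ME NE fmxB; have [_ ->] := fmxV QQ l0.
  by apply: eq_fmx => k; rewrite MN.
- by rewrite ME.
- by rewrite /itG ME NE iM fmxM//; apply: eq_fmx => k; rewrite NG mulrC mulfK.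
- by move=> k; rewrite mulrBl mul1r -NG MN.
Qed.

Lemma prop_covE : prop_cov D = fmx Q (fun k => scale_y k ^+ 2).
Proof.
have [Mk [e1 e2 e3 _]] := ar_matrices.
rewrite /prop_cov e1 e3 fmxT !fmxM// fmxB; apply: eq_fmx => k.
by rewrite scale_y2 /g_; ring.
Qed.

Lemma m_coef k : m_ D k = coef k (invmx (dA D) *m db D).
Proof. by rewrite /m_ /coef mulmxA. Qed.

Lemma coef_prop_mean k x :
  coef k (prop_mean D x) = G k * coef k x + (1 - G k) * m_tilde D k.
Proof.
have [Mk [e1 e2 e3 e4]] := ar_matrices.
rewrite /prop_mean coefD e2 e3 !coef_fmx//; congr (_ + _).
rewrite /m_tilde -mulmxA e1 -/(coef k _) coef_fmx// mulrA; congr (_ * _).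
have l0 : lamt k ^+ 2 != 0 by rewrite sqrf_eq0 gt_eqF// (lamt_gt0 hp).
have := l0; rewrite -e4 mulf_eq0 negb_or => /andP[h1 h2].
by rewrite invfM mulrA mulfV// mul1r.
Qed.

(** Standardised coordinates: the equilibrium law of x, and the proposal noise. *)
Definition xcoord k (x : 'cV[R]_n) : R := lam k * (coef k x - m_ D k).
Definition ycoord k (x y : 'cV[R]_n) : R :=
  (coef k y - (G k * coef k x + (1 - G k) * m_tilde D k)) / scale_y k.

(** The contribution of the k-th eigendirection to the logarithm of the acceptance
ratio, see [logratioE]. *)
Definition logratio k (z : R * R) : R :=
  T0 D k + T1 D k * z.1 + T2 D k * z.2 + T3 D k * z.1 ^+ 2 + T4 D k * z.2 ^+ 2
  + T5 D k * (z.1 * z.2).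

(** The proposed displacement along q_k, see [coef_jump]. *)
Definition jump k (z : R * R) : R :=
  - (g_tilde D k * r_hat D k) - g_tilde D k / lam k * z.1 + scale_y k * z.2.

Lemma coef_jump k x y : coef k (y - x) = jump k (xcoord k x, ycoord k x y).
Proof.
rewrite coefB /jump /xcoord /ycoord /g_tilde /r_hat /=.
have l0 := lt0r_neq0 (lam_gt0 hp k); have s0 := lt0r_neq0 (scale_y_gt0 k).
by field; rewrite l0 s0.
Qed.

Lemma logratioE k (x y : 'cV[R]_n) :
  - (lam k ^+ 2 * (coef k y - m_ D k) ^+ 2) / 2
  - (coef k x - (G k * coef k y + (1 - G k) * m_tilde D k)) ^+ 2 / scale_y k ^+ 2 / 2
  + lam k ^+ 2 * (coef k x - m_ D k) ^+ 2 / 2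
  + (coef k y - (G k * coef k x + (1 - G k) * m_tilde D k)) ^+ 2 / scale_y k ^+ 2 / 2
  = logratio k (xcoord k x, ycoord k x y).
Proof.
have l0 := lt0r_neq0 (lam_gt0 hp k); have t0 := lt0r_neq0 (lamt_gt0 hp k).
have s0 := lt0r_neq0 (scale_y_gt0 k); have g0 := g_gt0 k.
have hy : coef k y =
    G k * coef k x + (1 - G k) * m_tilde D k + scale_y k * ycoord k x y.
  by rewrite /ycoord; field.
have hx : coef k x = m_ D k + xcoord k x / lam k by rewrite /xcoord; field.
rewrite hy hx {hy hx}; move: (xcoord k x) (ycoord k x y) => u v.
have rt : Num.sqrt (1 + r_tilde D k) = lam k / lamt k.
  have -> : 1 + r_tilde D k = (lam k / lamt k) ^+ 2 by rewrite /r_tilde; field.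
  by rewrite sqrtr_sqr gtr0_norm// divr_gt0 ?(lam_gt0 hp) ?(lamt_gt0 hp).
rewrite /logratio /T0 /T1 /T2 /T3 /T4 /T5 rt /=.
have -> : 1 + r_tilde D k = (lam k / lamt k) ^+ 2 by rewrite /r_tilde; field.
rewrite /r_ /r_hat /g_tilde.
have gE : g_ D k = 1 - G k ^+ 2 by [].
have mE : m_ D k = r_hat D k + m_tilde D k by rewrite /r_hat subrK.
have s2 := scale_y2 k.
have sE : Num.sqrt (g_ D k) = scale_y k * lamt k by rewrite /scale_y divfK.
rewrite sE {sE}; move: (scale_y k) s0 s2 => s s0 s2.
(* [X] and [Y] are the deviations of state and proposal from the proposal mean
   [m_tilde]. The proposal is reversible for N(m_tilde, 1 / lamt^2), so only the
   ratio of the target to that law is left. *)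
pose X := r_hat D k + u / lam k; pose Y := G k * X + s * v.
transitivity (- (lam k ^+ 2 - lamt k ^+ 2) / 2 * (Y ^+ 2 - X ^+ 2)
   + lam k ^+ 2 * r_hat D k * (Y - X)).
  have -> : (m_ D k + u / lam k - (G k * (G k * (m_ D k + u / lam k) +
      (1 - G k) * m_tilde D k + s * v) + (1 - G k) * m_tilde D k)) ^+ 2 / s ^+ 2 / 2 =
      (s * v) ^+ 2 / s ^+ 2 / 2 + lamt k ^+ 2 / 2 * (X ^+ 2 - Y ^+ 2).
    have -> : lamt k ^+ 2 / 2 * (X ^+ 2 - Y ^+ 2) =
        (1 - G k ^+ 2) * (X ^+ 2 - Y ^+ 2) / s ^+ 2 / 2.
      by rewrite s2 gE; field; rewrite t0 -gE gt_eqF.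
    by rewrite -!mulrDl; congr (_ / _ / _); rewrite /Y /X mE; ring.
  by rewrite /Y /X mE; field; rewrite ?s0 ?l0 ?t0.
have YE : Y ^+ 2 = G k ^+ 2 * X ^+ 2 + 2 * G k * X * s * v +
    (1 - G k ^+ 2) / lamt k ^+ 2 * v ^+ 2.
  by rewrite -gE -s2 /Y; ring.
rewrite YE /Y /X gE; rewrite -/(r_hat D k); move: (r_hat D k) => rh.
by field; rewrite l0 t0.
Qed.

Lemma MH_acceptE (x y : 'cV[R]_n) :
  MH_accept (target_pdf D) (proposal_pdf D) x y =
  Num.min 1 (expR (\sum_k logratio k (xcoord k x, ycoord k x y))).
Proof.
have l2 k : 0 < (lam k ^+ 2)^-1 by rewrite invr_gt0 exprn_gt0// (lam_gt0 hp).
have s2 k : 0 < scale_y k ^+ 2 by rewrite exprn_gt0// scale_y_gt0.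
have [N1 N10 p1] := mvnormal_pdf_fmx QQ l2.
have [N2 N20 p2] := mvnormal_pdf_fmx QQ s2.
rewrite /MH_accept /target_pdf /proposal_pdf prop_covE {2 4}invA_fmx !p1 !p2.
congr Num.min; set a := expR _; set b := expR _; set c := expR _; set e := expR _.
transitivity (a * b / (c * e)).
  have [c0 e0] : c != 0 /\ e != 0 by rewrite !gt_eqF// expR_gt0.
  by field; rewrite c0 e0 !gt_eqF.
rewrite -expRD -expRD -expRN -expRD; congr expR.
have split4 (A B C E : 'I_n -> R) :
    \sum_k (- A k / 2 - B k / 2 + C k / 2 + E k / 2) =
    - (\sum_k A k) / 2 - (\sum_k B k) / 2 + (\sum_k C k) / 2 + (\sum_k E k) / 2.
  by rewrite -!sumrN !mulr_suml -!sumrN -!big_split.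
under [in RHS]eq_bigr do rewrite -logratioE.
rewrite split4 opprD -!mulNr !opprK.
have tE z : \sum_k (coef k z - coef k (invmx (dA D) *m db D)) ^+ 2 / (lam k ^+ 2)^-1 =
    \sum_k lam k ^+ 2 * (coef k z - m_ D k) ^+ 2.
  by apply: eq_bigr => k _; rewrite invrK mulrC m_coef.
have qE z z' : \sum_k (coef k z - coef k (prop_mean D z')) ^+ 2 / scale_y k ^+ 2 =
    \sum_k (coef k z - (G k * coef k z' + (1 - G k) * m_tilde D k)) ^+ 2 / scale_y k ^+ 2.
  by apply: eq_bigr => k _; rewrite coef_prop_mean.
by rewrite !tE !qE; ring.
Qed.

End ar_coordinates.

(** * The law of the standardised coordinates *)

Section coordinates_law.
Context (R : realType) (n : nat).
Local Notation gam := (@normalP R 0 1).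
Local Notation gam2 := (@normalP R 0 1 \x @normalP R 0 1)%E.
Local Notation cVn := 'cV[R]_n.

Lemma measurable_cV_coord (k : 'I_n) :
  measurable_fun setT (fun v : cVn => v k 0 : measurableTypeR R).
Proof.
move=> _ B mB; rewrite setTI; apply: sub_sigma_algebra.
case: n k => [[] []//|m k].
rewrite -bigcup_mkord_ord; exists k; first exact: ltn_ord.
by exists B => //; rewrite inord_val setTI.
Qed.

Lemma measurable_coef (Q : 'M[R]_n) k :
  measurable_fun setT (fun v : cVn => coef Q k v : measurableTypeR R).
Proof.
have -> : (fun v : cVn => coef Q k v) = (fun v : cVn => \sum_j Q j k * v j 0).
  by apply/funext => v; rewrite coefE mxE; apply: eq_bigr => j _; rewrite mxE.
apply: measurable_sum => j; apply: measurable_funM => //.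
exact: measurable_cV_coord.
Qed.

Context d (T : measurableType d) (P : probability T R).

(** Any factor L with L L^T = A^-1 is allowed in the definition of a normal vector;
it differs from the symmetric one by an orthogonal matrix. *)
Lemma gaussian_family (Z : {RV P >-> cVn}) (A : 'M[R]_n) :
  is_std_normal Z -> A^T *m A = 1%:M ->
  iid P gam (fun k w => (A *m Z w) k 0 : measurableTypeR R).
Proof.
move=> Zn AA.
have mZ k : measurable_fun setT (fun w => Z w k 0 : measurableTypeR R).
  by apply: (measurableT_comp (measurable_cV_coord k)).
have iZ : iid P gam (fun k w => Z w k 0 : measurableTypeR R) by exact: Zn.
have := orthogonal_stable AA mZ iZ; congr (iid P gam _).
by apply/funext => k; apply/funext => w; rewrite mxE.
Qed.

Context (D : ar_data R n).
Hypotheses (hs : splitting_hyp D) (hp : spectral_hyp D).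
Variables (x y : {RV P >-> cVn}).
Hypotheses (xN : is_normal x (invmx (dA D) *m db D) (invmx (dA D)))
  (yP : is_proposal D x y).
Local Notation Q := (dQ D).

Definition coords k w : measurableTypeR R * measurableTypeR R :=
  (xcoord D k (x w), ycoord D k (x w) (y w)).

Lemma measurable_xcoord k :
  measurable_fun setT (fun v : cVn => xcoord D k v : measurableTypeR R).
Proof.
apply: measurable_funM => //; apply: measurable_funB => //.
exact: measurable_coef.
Qed.

Lemma iid_xcoord : iid P gam (fun k w => xcoord D k (x w) : measurableTypeR R).
Proof.
have QQ := Q_orth hp; have [L [Z [LL Zn xE]]] := xN.
pose A := diag_mx (\row_k dlam D k) *m Q^T *m L.
have AA : A^T *m A = 1%:M.
  apply: mulmx1C; rewrite /A !trmx_mul tr_diag_mx trmxK !mulmxA.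
  rewrite -(mulmxA _ L) LL (invA_fmx hp) -(mulmxA _ Q^T) (trQ_fmx QQ).
  rewrite !mulmxA -(mulmxA _ Q^T) QQ mulmx1 !mulmx_diag.
  apply/matrixP => i j; rewrite !mxE; case: eqVneq => [->|_]; last by rewrite mulr0n.
  by rewrite !mulr1n; field; rewrite gt_eqF// (lam_gt0 hp).
have := gaussian_family Zn AA; congr (iid P gam _).
apply/funext => k; apply/funext => w.
rewrite /xcoord xE coefD -(m_coef D) addrAC subrr add0r coefE /A -!mulmxA mul_diag_mx !mxE.
by congr (_ * _); rewrite mulmxA.
Qed.

Lemma proposal_noise : exists xi : {RV P >-> cVn},
  [/\ independent_RV x xi,
      iid P gam (fun k w => coef Q k (xi w) : measurableTypeR R) &
      forall k w, ycoord D k (x w) (y w) = coef Q k (xi w)].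
Proof.
have QQ := Q_orth hp; have [S [xi [Ssqrt xiN xxi yE]]] := yP.
exists xi; split => //.
  have [L [Z [LL Zn xE]]] := xiN; pose A := Q^T *m L.
  have AA : A^T *m A = 1%:M.
    rewrite /A trmx_mul trmxK mulmxA -(mulmxA _ Q) (mulmx1C QQ) mulmx1.
    exact: mulmx1C.
  have := gaussian_family Zn AA; congr (iid P gam _).
  apply/funext => k; apply/funext => w.
  by rewrite xE add0r coefE mulmxA.
move=> k w; rewrite /ycoord yE coefD (coef_prop_mean hs hp) addrAC subrr add0r.
have s0 := scale_y_gt0 hs hp k; rewrite (prop_covE hs hp) in Ssqrt.
by rewrite (sqrt_fmx_coef QQ _ s0 Ssqrt) mulrAC mulfV ?mul1r// gt_eqF.
Qed.

Lemma measurable_coords k : measurable_fun setT (coords k).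
Proof.
apply: measurable_fun_pair.
  by apply: (measurableT_comp (measurable_xcoord k)).
have [xi [_ _ e]] := proposal_noise; under eq_fun do rewrite e.
by apply: (measurableT_comp (measurable_coef Q k)).
Qed.

(** Independence of the state and of the noise gives boxes; [iid_pair] turns them
into events of the plane. *)
Lemma iid_coords : iid P gam2 coords.
Proof.
have [xi [xxi iidxi e]] := proposal_noise.
have -> : coords = (fun k w => (xcoord D k (x w), coef Q k (xi w))).
  by apply/funext => k; apply/funext => w; rewrite /coords e.
apply: iid_pair => [k|k|B C mB mC].
- by apply: (measurableT_comp (measurable_xcoord k)).
- by apply: (measurableT_comp (measurable_coef Q k)).
pose B' := [set v : cVn | forall k, true -> B k (xcoord D k v)].
pose C' := [set v : cVn | forall k, true -> C k (coef Q k v)].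
have mB' : measurable B'.
  exact: (@measurable_iid_box _ _ _ _ _ (fun k v => xcoord D k v) measurable_xcoord B (fun=> true) mB).
have mC' : measurable C'.
  exact: (@measurable_iid_box _ _ _ _ _ (fun k v => coef Q k v) (measurable_coef Q) C (fun=> true) mC).
transitivity (P (x @^-1` B' `&` xi @^-1` C')).
  congr (P _); apply/seteqP; split => w /=.
    by move=> H; split => k _; have [] := H k.
  by move=> [H1 H2] k; split; [exact: H1|exact: H2].
rewrite xxi// big_split/=; congr (_ * _)%E.
  rewrite -(iid_xcoord mB); congr (P _); apply/seteqP; split => w /= H k => [|_];
    exact: H.
rewrite -(iidxi C mC); congr (P _); apply/seteqP; split => w /= H k => [|_];
  exact: H.
Qed.

Lemma measurable_logratio k : measurable_fun setT
  (logratio D k : measurableTypeR R * measurableTypeR R -> R).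
Proof.
have mf : measurable_fun setT (fst : measurableTypeR R * measurableTypeR R -> R) by [].
have ms : measurable_fun setT (snd : measurableTypeR R * measurableTypeR R -> R) by [].
apply: measurable_funD.
  apply: measurable_funD.
    apply: measurable_funD.
      apply: measurable_funD.
        by apply: measurable_funD => //; exact: measurable_funM.
      exact: measurable_funM.
    by apply: measurable_funM => //; exact: measurable_funX.
  by apply: measurable_funM => //; exact: measurable_funX.
by apply: measurable_funM => //; exact: measurable_funM.
Qed.

Lemma measurable_jump k : measurable_fun setT
  (jump D k : measurableTypeR R * measurableTypeR R -> R).
Proof.
have mf : measurable_fun setT (fst : measurableTypeR R * measurableTypeR R -> R) by [].
have ms : measurable_fun setT (snd : measurableTypeR R * measurableTypeR R -> R) by [].
by apply: measurable_funD; [apply: measurable_funB => //|]; apply: measurable_funM.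
Qed.

Variable x' : {RV P >-> cVn}.
Hypothesis x'S : MH_step (target_pdf D) (proposal_pdf D) x y x'.

Definition accept (r : seq 'I_n) w : R :=
  Num.min 1 (expR (psum coords (logratio D) r w)).

(** Rejected proposals do not contribute, and the acceptance event may be replaced
by its conditional probability given (x, y) under the integral. *)
Lemma MH_expectation k :
  ('E_P[fun w => (((eigvec D k)^T *m (x' w - x w)) 0 0 ^+ 2)%R] =
   \int[P]_w (jump D k (coords k w) ^+ 2 * accept (index_enum 'I_n) w)%:E)%E.
Proof.
have [acc [macc accy accx accP]] := x'S.
have mxy : measurable_fun setT (fun w => (x w, y w)) by exact: measurable_fun_pair.
have mpre (B : set (cVn * cVn)) : measurable B -> measurable [set w | B (x w, y w)].
  by move=> mB; rewrite -[X in measurable X]setTI; exact: mxy.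
pose xy : {mfun T >-> (cVn * cVn)%type} := mfun_Sub (mem_set mxy).
pose push := pushforward (mrestr P macc) xy : {measure set (cVn * cVn) -> \bar R}.
pose nu : {measure set (cVn * cVn) -> \bar R} := push mxy.
pose F (z : cVn * cVn) : \bar R := (coef Q k (z.2 - z.1) ^+ 2)%:E.
have mF : measurable_fun setT F.
  apply/measurable_EFinP; apply: measurable_funX.
  rewrite (_ : (fun z => _) = (fun z : cVn * cVn => coef Q k z.2 - coef Q k z.1)).
    apply: measurable_funB.
      by apply: (measurableT_comp (measurable_coef Q k)).
    by apply: (measurableT_comp (measurable_coef Q k)).
  by apply/funext => z; rewrite coefB.
have F0 z : (0 <= F z)%E by rewrite lee_fin sqr_ge0.
have alphaE w : MH_accept (target_pdf D) (proposal_pdf D) (x w) (y w) =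
    accept (index_enum 'I_n) w.
  by rewrite (MH_acceptE hs hp).
have malpha : measurable_fun setT (accept (index_enum 'I_n)).
  apply: measurable_minr => //; apply: measurableT_comp => //.
  by apply: measurable_psum; [exact: measurable_coords|exact: measurable_logratio].
have nuE1 B : measurable B -> nu B = (\int[P]_(w in xy @^-1` B) (\1_acc w : R)%:E)%E.
  move=> mB; rewrite integral_indic//; last exact: mpre.
  by rewrite /nu /push /= /pushforward /mrestr setIC.
have nuE2 B : measurable B ->
    nu B = (\int[P]_(w in xy @^-1` B) (accept (index_enum 'I_n) w)%:E)%E.
  move=> mB; rewrite /nu /push /= /pushforward /mrestr setIC [LHS]accP//.
  by apply: eq_integral => w _; rewrite alphaE.
have mind : measurable_fun setT (\1_acc : T -> R) by exact: measurable_indic.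
have ind0 w : 0 <= (\1_acc w : R) by [].
have e1 := @ge0_integral_density _ _ _ _ R P nu xy mxy (\1_acc)
  mind ind0 nuE1 F mF F0.
have a0 w : 0 <= accept (index_enum 'I_n) w by rewrite le_min ler01 expR_ge0.
have e2 := @ge0_integral_density _ _ _ _ R P nu xy mxy _ malpha a0 nuE2 F mF F0.
rewrite unlock; transitivity (\int[P]_w (F (xy w) * (\1_acc w : R)%:E))%E.
  apply: eq_integral => w _; rewrite indicE; have [wa|wa] := boolP (w \in acc).
    by rewrite mule1 accy//; exact: set_mem.
  rewrite mule0 accx; first by rewrite subrr mulmx0 mxE expr0n.
  by move=> wa'; move: wa; rewrite notin_setE.
rewrite -e1 e2; apply: eq_integral => w _.
by rewrite /F EFinM /coords -(coef_jump hs hp).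
Qed.

End coordinates_law.

(** * Moments of the log-ratio and of the displacement *)

Section polynomial_moments.
Context {R : realType}.
Local Notation gam2 := (@normalP R 0 1 \x @normalP R 0 1)%E.
Local Notation mono := (R * nat * nat)%type.

(** [Nat.add], which reduces on numerals, keeps the exponents of a product explicit. *)
Definition pmul (s t : seq mono) : seq mono :=
  [seq (a.1.1 * b.1.1, Nat.add a.1.2 b.1.2, Nat.add a.2 b.2) | a <- s, b <- t].

Lemma poly2M (s t : seq mono) z : poly2 (pmul s t) z = poly2 s z * poly2 t z.
Proof.
rewrite /poly2 /pmul big_allpairs_dep mulr_suml; apply: eq_bigr => a _.
rewrite mulr_sumr; apply: eq_bigr => b _ /=.
by rewrite !plusE !exprD; ring.
Qed.

Lemma cauchy_schwarz d (T : measurableType d) (P : probability T R) (f g : T -> R) :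
  P.-integrable setT (EFin \o (fun t => f t ^+ 2)) ->
  P.-integrable setT (EFin \o (fun t => g t ^+ 2)) ->
  P.-integrable setT (EFin \o (fun t => f t * g t)) ->
  \int[P]_t (f t * g t) <=
  Num.sqrt (\int[P]_t f t ^+ 2) * Num.sqrt (\int[P]_t g t ^+ 2).
Proof.
move=> fi gi fgi; set A := \int[P]_t f t ^+ 2; set B := \int[P]_t g t ^+ 2.
set C := \int[P]_t (f t * g t).
have A0 : 0 <= A by apply: Rintegral_ge0 => t _; exact: sqr_ge0.
have quad (u : R) : 0 <= A * u ^+ 2 - 2 * C * u + B.
  have i1 := rintegrableZ (u ^+ 2) fi; have i2 := rintegrableZ (2 * u) fgi.
  have -> : A * u ^+ 2 - 2 * C * u + B = \int[P]_t (u ^+ 2 * f t ^+ 2 -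
      2 * u * (f t * g t) + g t ^+ 2).
    rewrite (RintegralD measurableT (rintegrableB i1 i2) gi).
    rewrite (RintegralB measurableT i1 i2) (RintegralZl _ measurableT fi).
    by rewrite (RintegralZl _ measurableT fgi) -/A -/B -/C; ring.
  apply: Rintegral_ge0 => t _.
  by have := sqr_ge0 (u * f t - g t); congr (0 <= _); ring.
have CAB : C ^+ 2 <= A * B.
  have [A1|A1] := eqVneq A 0.
    have C0 : C = 0.
      apply/eqP/negP => /negP C0; have := quad ((B + 1) / (2 * C)).
      rewrite A1 mul0r sub0r (_ : 2 * C * _ = B + 1); first by lra.
      by field.
    by rewrite A1 C0 expr0n mul0r.
  have Ap : 0 < A by rewrite lt_def A1.
  have := quad (C / A); rewrite -(pmulr_rge0 _ Ap).
  rewrite (_ : A * _ = A * B - C ^+ 2) ?subr_ge0//.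
  by field.
have B0 : 0 <= B by apply: Rintegral_ge0 => t _; exact: sqr_ge0.
rewrite -sqrtrM//; apply: le_trans (ler_norm _) _.
by rewrite -sqrtr_sqr ler_wsqrtr.
Qed.

End polynomial_moments.

Section ar_moments.
Context (R : realType) (n : nat) (D : ar_data R n).
Hypotheses (hs : splitting_hyp D) (hp : spectral_hyp D).
Local Notation gam2 := (@normalP R 0 1 \x @normalP R 0 1)%E.
Local Notation mono := (R * nat * nat)%type.
Variable k : 'I_n.

Definition logratio_poly : seq mono :=
  [:: (T0 D k, 0%N, 0%N); (T1 D k, 1%N, 0%N); (T2 D k, 0%N, 1%N);
      (T3 D k, 2%N, 0%N); (T4 D k, 0%N, 2%N); (T5 D k, 1%N, 1%N)].

Definition jump_poly : seq mono :=
  [:: (- (g_tilde D k * r_hat D k), 0%N, 0%N); (- (g_tilde D k / dlam D k), 1%N, 0%N);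
      (scale_y D k, 0%N, 1%N)].

Lemma logratio_polyE z : logratio D k z = poly2 logratio_poly z.
Proof. by rewrite /poly2 !big_cons big_nil /logratio /=; ring. Qed.

Lemma jump_polyE z : jump D k z = poly2 jump_poly z.
Proof. by rewrite /poly2 !big_cons big_nil /jump /=; ring. Qed.

Lemma logratioXE z : logratio D k z ^+ 2 = poly2 (pmul logratio_poly logratio_poly) z.
Proof. by rewrite poly2M -logratio_polyE expr2. Qed.

Lemma jumpX2E z : jump D k z ^+ 2 = poly2 (pmul jump_poly jump_poly) z.
Proof. by rewrite poly2M -jump_polyE expr2. Qed.

Lemma jumpX4E z : jump D k z ^+ 4 =
  poly2 (pmul (pmul jump_poly jump_poly) (pmul jump_poly jump_poly)) z.
Proof. by rewrite poly2M -jumpX2E; ring. Qed.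

Lemma integrable_logratio : gam2.-integrable setT (EFin \o logratio D k).
Proof.
rewrite (_ : logratio D k = poly2 logratio_poly); first exact: integrable_poly2.
by apply/funext => z; exact: logratio_polyE.
Qed.

Lemma integrable_logratioX : gam2.-integrable setT (EFin \o (fun z => logratio D k z ^+ 2)).
Proof. by under [X in EFin \o X]eq_fun do rewrite logratioXE; exact: integrable_poly2. Qed.

Lemma integrable_jumpX2 : gam2.-integrable setT (EFin \o (fun z => jump D k z ^+ 2)).
Proof. by under [X in EFin \o X]eq_fun do rewrite jumpX2E; exact: integrable_poly2. Qed.

Lemma integrable_jumpX4 : gam2.-integrable setT (EFin \o (fun z => jump D k z ^+ 4)).
Proof. by under [X in EFin \o X]eq_fun do rewrite jumpX4E; exact: integrable_poly2. Qed.

Lemma mean_logratio : \int[gam2]_z logratio D k z = mu D k.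
Proof.
under eq_Rintegral do rewrite logratio_polyE.
apply: gam2_poly2; rewrite !big_cons big_nil /= !gmom0 !(gmom_odd (n := 1))// !gmom2.
by rewrite /mu; ring.
Qed.

Lemma mean_logratioX : \int[gam2]_z logratio D k z ^+ 2 = sigma2 D k + mu D k ^+ 2.
Proof.
under eq_Rintegral do rewrite logratioXE.
apply: gam2_poly2; rewrite /pmul /logratio_poly /= !big_cons big_nil /=.
rewrite !gmom0 !(gmom_odd (n := 1))// !gmom2 !(gmom_odd (n := 3))// !gmom4.
by rewrite /mu /sigma2; ring.
Qed.

Lemma mean_jumpX2 : \int[gam2]_z jump D k z ^+ 2 = U1 D k.
Proof.
under eq_Rintegral do rewrite jumpX2E.
apply: gam2_poly2; rewrite /pmul /jump_poly /= !big_cons big_nil /=.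
rewrite !gmom0 !(gmom_odd (n := 1))// !gmom2.
rewrite /U1 -(scale_y2 hs hp); field.
exact: lt0r_neq0 (lam_gt0 hp k).
Qed.

Lemma mean_jumpX4 : \int[gam2]_z jump D k z ^+ 4 =
  g_tilde D k ^+ 4 * r_hat D k ^+ 4
    + 3 * (g_tilde D k ^+ 4 / dlam D k ^+ 4)
    + 3 * (g_ D k ^+ 2 / dlamt D k ^+ 4)
    + 6 * (g_tilde D k ^+ 4 * r_hat D k ^+ 2 / dlam D k ^+ 2)
    + 6 * (g_tilde D k ^+ 2 * g_ D k * r_hat D k ^+ 2 / dlamt D k ^+ 2)
    + 6 * (g_tilde D k ^+ 2 * g_ D k / (dlam D k ^+ 2 * dlamt D k ^+ 2)).
Proof.
have l0 := lt0r_neq0 (lam_gt0 hp k); have t0 := lt0r_neq0 (lamt_gt0 hp k).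
under eq_Rintegral do rewrite jumpX4E.
apply: gam2_poly2; rewrite /pmul /jump_poly /= !big_cons big_nil /=.
rewrite !gmom0 !(gmom_odd (n := 1))// !gmom2 !(gmom_odd (n := 3))// !gmom4.
have -> : g_ D k = scale_y D k ^+ 2 * dlamt D k ^+ 2 by rewrite (scale_y2 hs hp); field.
by field; rewrite l0 t0.
Qed.

Lemma mean_centred : \int[gam2]_z (logratio D k z - mu D k) = 0.
Proof.
rewrite (RintegralB measurableT integrable_logratio (rintegrable_cst _ _)).
by rewrite mean_logratio Rintegral_probability_cst subrr.
Qed.

Lemma mean_centredX : \int[gam2]_z (logratio D k z - mu D k) ^+ 2 = sigma2 D k.
Proof.
have i1 := rintegrableZ (2 * mu D k) integrable_logratio.
have e z : (logratio D k z - mu D k) ^+ 2 =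
    logratio D k z ^+ 2 - 2 * mu D k * logratio D k z + mu D k ^+ 2 by ring.
under eq_Rintegral do rewrite e.
rewrite (RintegralD measurableT (rintegrableB integrable_logratioX i1) (rintegrable_cst _ _)).
rewrite (RintegralB measurableT integrable_logratioX i1).
rewrite (RintegralZl _ measurableT integrable_logratio).
by rewrite mean_logratio mean_logratioX Rintegral_probability_cst; ring.
Qed.

Lemma sigma2_ge0 : 0 <= sigma2 D k.
Proof.
have := sqr_ge0 (T1 D k); have := sqr_ge0 (T2 D k); have := sqr_ge0 (T3 D k).
by have := sqr_ge0 (T4 D k); have := sqr_ge0 (T5 D k); rewrite /sigma2; lra.
Qed.

Definition dominating_poly : seq mono :=
  [:: (4, 0%N, 0%N); (3, 2%N, 0%N); (3, 0%N, 2%N)].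

(** Each coefficient T_1, ..., T_5 is at most the standard deviation, and each of
the polynomials they multiply is at most [dominating_poly]. All moments of the
centred log-ratio are thus bounded by powers of its standard deviation, with
constants common to all directions and dimensions. *)
Lemma centred_le z : `|logratio D k z - mu D k| <=
  Num.sqrt (sigma2 D k) * poly2 dominating_poly z.
Proof.
have sT (t : R) : t ^+ 2 <= sigma2 D k -> `|t| <= Num.sqrt (sigma2 D k).
  by move=> h; rewrite -sqrtr_sqr ler_wsqrtr.
have [h1 h2 h3] : [/\ T1 D k ^+ 2 <= sigma2 D k, T2 D k ^+ 2 <= sigma2 D k
    & T3 D k ^+ 2 <= sigma2 D k].
  have := sqr_ge0 (T1 D k); have := sqr_ge0 (T2 D k); have := sqr_ge0 (T3 D k).
  have := sqr_ge0 (T4 D k); have := sqr_ge0 (T5 D k); rewrite /sigma2.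
  by move=> *; split; lra.
have [h4 h5] : T4 D k ^+ 2 <= sigma2 D k /\ T5 D k ^+ 2 <= sigma2 D k.
  have := sqr_ge0 (T1 D k); have := sqr_ge0 (T2 D k); have := sqr_ge0 (T3 D k).
  have := sqr_ge0 (T4 D k); have := sqr_ge0 (T5 D k); rewrite /sigma2.
  by move=> *; split; lra.
move: (sT _ h1) (sT _ h2) (sT _ h3) (sT _ h4) (sT _ h5) => {h1 h2 h3 h4 h5 sT}.
rewrite /poly2 !big_cons big_nil /= /logratio /mu.
move: (Num.sqrt _) (T0 D k) (T1 D k) (T2 D k) (T3 D k) (T4 D k) (T5 D k).
move=> s t0 t1 t2 t3 t4 t5 h1 h2 h3 h4 h5; case: z => u v /=.
have bnd (a b c : R) : `|a| <= s -> `|b| <= c -> `|a * b| <= s * c.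
  by move=> h h'; rewrite normrM ler_pM.
have u1 : `|u| <= 1 + u ^+ 2.
  rewrite ler_norml; apply/andP; split.
    by have := sqr_ge0 (u + 1); rewrite sqrrD; have := sqr_ge0 u; lra.
  by have := sqr_ge0 (u - 1); rewrite sqrrB; have := sqr_ge0 u; lra.
have v1 : `|v| <= 1 + v ^+ 2.
  rewrite ler_norml; apply/andP; split.
    by have := sqr_ge0 (v + 1); rewrite sqrrD; have := sqr_ge0 v; lra.
  by have := sqr_ge0 (v - 1); rewrite sqrrB; have := sqr_ge0 v; lra.
have u2 : `|u ^+ 2 - 1| <= 1 + u ^+ 2.
  by rewrite ler_norml; apply/andP; split; have := sqr_ge0 u; lra.
have v2 : `|v ^+ 2 - 1| <= 1 + v ^+ 2.
  by rewrite ler_norml; apply/andP; split; have := sqr_ge0 v; lra.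
have uv : `|u * v| <= u ^+ 2 + v ^+ 2.
  rewrite ler_norml; apply/andP; split.
    have := sqr_ge0 (u + v); rewrite sqrrD.
    by have := sqr_ge0 u; have := sqr_ge0 v; lra.
  have := sqr_ge0 (u - v); rewrite sqrrB.
  by have := sqr_ge0 u; have := sqr_ge0 v; lra.
have b1 := bnd _ _ _ h1 u1; have b2 := bnd _ _ _ h2 v1; have b3 := bnd _ _ _ h3 u2.
have b4 := bnd _ _ _ h4 v2; have b5 := bnd _ _ _ h5 uv.
rewrite (_ : _ - _ = t1 * u + t2 * v + t3 * (u ^+ 2 - 1) + t4 * (v ^+ 2 - 1) + t5 * (u * v)); last by ring.
rewrite (_ : s * _ = s * (1 + u ^+ 2) + s * (1 + v ^+ 2) + s * (1 + u ^+ 2) +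
   s * (1 + v ^+ 2) + s * (u ^+ 2 + v ^+ 2)); last by ring.
do 4!(apply: le_trans (ler_normD _ _) _; apply: lerD => //).
Qed.

End ar_moments.
Arguments dominating_poly {R}.

(** * Separating one direction from the others *)

Section one_dimension.
Context (R : realType) (n : nat) (D : ar_data R n).
Hypotheses (hs : splitting_hyp D) (hp : spectral_hyp D).
Context d (T : measurableType d) (P : probability T R).
Variables (x y x' : {RV P >-> 'cV[R]_n}).
Hypotheses (xN : is_normal x (invmx (dA D) *m db D) (invmx (dA D)))
  (yP : is_proposal D x y)
  (x'S : MH_step (target_pdf D) (proposal_pdf D) x y x').
Variable k : 'I_n.
Local Notation gam := (@normalP R 0 1).
Local Notation gam2 := (@normalP R 0 1 \x @normalP R 0 1)%E.
Local Notation V := (coords D x y).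

Definition rest : seq 'I_n := [seq j <- index_enum 'I_n | j != k].

Let mV : forall j, measurable_fun setT (V j) := measurable_coords hs hp yP.
Let iV : iid P gam2 V := iid_coords hs hp xN yP.

Lemma rest_uniq : uniq rest.
Proof. by rewrite filter_uniq// index_enum_uniq. Qed.

Lemma notin_rest : k \notin rest.
Proof. by rewrite mem_filter eqxx. Qed.

Lemma coords_transfer j (F : measurableTypeR R * measurableTypeR R -> \bar R) :
  measurable_fun setT F -> (forall z, 0 <= F z)%E ->
  (\int[P]_t F (V j t) = \int[gam2]_z F z)%E.
Proof.
move=> mF F0; rewrite -[LHS](@ge0_integral_pushforward _ _ _ _ R _ (mV j) P setT)//.
apply: eq_measure_integral => B mB _.
exact: (iid_law iV j mB).
Qed.

Lemma accept01 r w : 0 <= accept D x y r w <= 1.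
Proof. by rewrite /accept le_min ler01 expR_ge0 ge_min lexx. Qed.

Lemma measurable_accept r : measurable_fun setT (accept D x y r).
Proof.
apply: measurable_minr => //; apply: measurableT_comp => //.
by apply: measurable_psum => // j; exact: measurable_logratio.
Qed.

(** U_3: the error made when the acceptance probability forgets the k-th
direction. *)
Definition remainder : R := \int[P]_w (jump D k (V k w) ^+ 2 *
  (accept D x y (index_enum 'I_n) w - accept D x y rest w)).

Let jump2P : P.-integrable setT (EFin \o (fun w => jump D k (V k w) ^+ 2)).
Proof.
have := integrable_transfer (mV k) (coords_transfer k) (integrable_jumpX2 D k).
exact.
Qed.

Let integrable_jump_accept r :
  P.-integrable setT (EFin \o (fun w => jump D k (V k w) ^+ 2 * accept D x y r w)).
Proof.
apply: (rintegrable_le _ _ jump2P).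
  apply: measurable_funM; last exact: measurable_accept.
  by apply: measurable_funX; apply: measurableT_comp (mV k); exact: measurable_jump.
move=> w; have /andP[a0 a1] := accept01 r w.
rewrite /= ger0_norm; last by rewrite mulr_ge0// sqr_ge0.
by apply: ler_piMr => //; exact: sqr_ge0.
Qed.

(** Without the k-th direction the acceptance probability is independent of the
displacement along q_k, so the expectation factors. *)
Lemma MH_expectation_split :
  ('E_P[fun w => (((eigvec D k)^T *m (x' w - x w)) 0 0 ^+ 2)%R] =
   (U1 D k * (\int[P]_w accept D x y rest w) + remainder)%R%:E)%E.
Proof.
rewrite (MH_expectation hs hp yP x'S) EFin_Rintegral; last exact: integrable_jump_accept.
congr EFin.
have mS : measurable_fun setT (psum V (logratio D) rest).
  by apply: measurable_psum => // j; exact: measurable_logratio.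
pose law : probability R R := distribution P (mfun_Sub (mem_set mS) : {mfun T >-> R}).
have ind A C : measurable A -> measurable C ->
    (P (psum V (logratio D) rest @^-1` A `&` V k @^-1` C) = law A * gam2 C)%E.
  move=> mA mC; apply: psum_indep => //; [|exact: rest_uniq|exact: notin_rest].
  by move=> j; exact: measurable_logratio.
have fi : law.-integrable setT (EFin \o (fun s => Num.min 1 (expR s))).
  apply: (@rintegrable_bounded _ _ _ _ 1); first exact: measurable_minr.
  by move=> s; rewrite ger0_norm ?ge_min ?lexx// le_min ler01 expR_ge0.
have [_ e] := independent_prodM mS (mV k) ind fi (integrable_jumpX2 D k).
have [_ e1] := independent_prodM mS (mV k) ind fi (rintegrable_cst gam2 1).
have eU : U1 D k * \int[P]_w accept D x y rest w =
    \int[P]_w (jump D k (V k w) ^+ 2 * accept D x y rest w).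
  rewrite -(mean_jumpX2 hs hp) mulrC.
  have -> : \int[P]_w accept D x y rest w = \int[law]_s Num.min 1 (expR s).
    rewrite -[RHS]mulr1 -[X in _ = _ * X](Rintegral_probability_cst gam2) -e1.
    by apply: eq_Rintegral => w _; rewrite mulr1.
  by rewrite -e; apply: eq_Rintegral => w _; rewrite mulrC.
rewrite eU /remainder -(RintegralD measurableT (integrable_jump_accept _)).
  by apply: eq_Rintegral => w _; rewrite -mulrDr [in RHS]addrC subrK.
under [X in EFin \o X]eq_fun do rewrite mulrBr.
exact: rintegrableB.
Qed.

Lemma ler_dist_min_expR (a b : R) :
  `|Num.min 1 (expR (a + b)) - Num.min 1 (expR b)| <= `|a|.
Proof.
wlog a0 : a b / 0 <= a => [H|].
  have [a0|a0] := leP 0 a; first exact: H.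
  have := H (- a) (a + b); rewrite oppr_ge0 normrN addrA addNr add0r distrC; apply.
  exact: ltW.
have h : expR b <= expR (a + b) by rewrite ler_expR lerDr.
rewrite (ger0_norm a0).
have e1 : expR b = expR (a + b) * expR (- a) by rewrite -expRD; congr expR; ring.
have e2 : 1 - a <= expR (- a) by exact: expR_ge1Dx.
have e4 : expR (- a) <= 1 by rewrite -expR0 ler_expR oppr_le0.
move: (expR_gt0 (a + b)) (expR_gt0 (- a)) e2 e4 h; rewrite e1.
move: (expR (a + b)) (expR (- a)) => A C A0 C0 e2 e4 h.
have [h1|h1] := leP 1 A; have [h2|h2] := leP 1 (A * C).
- by rewrite subrr normr0.
- have : C <= A * C by rewrite ler_peMl// ltW.
  by rewrite ger0_norm; lra.
- by have := le_lt_trans h2 (le_lt_trans h h1); rewrite ltxx.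
- have : A * (1 - C) <= 1 - C by rewrite ler_piMl ?subr_ge0// ltW.
  by rewrite ger0_norm ?subr_ge0// mulrBr mulr1; lra.
Qed.

Lemma psum_all w : psum V (logratio D) (index_enum 'I_n) w =
  logratio D k (V k w) + psum V (logratio D) rest w.
Proof. by rewrite /psum (bigD1 k)//= /rest big_filter. Qed.

(** Forgetting direction k changes the acceptance probability by at most the
absolute value of the k-th log-ratio; then Cauchy-Schwarz separates the fourth
moment of the displacement from the second moment of the log-ratio. *)
Lemma remainder_bound : `|remainder| <= U3_bound D k.
Proof.
have i2 := integrable_jumpX2 D k; have i4 := integrable_jumpX4 D k.
have iz := integrable_logratioX D k.
have mj := measurable_jump D k; have ml := measurable_logratio D k.
have ijz : gam2.-integrable setT (EFin \o (fun z => jump D k z ^+ 2 * `|logratio D k z|)).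
  apply: (rintegrable_le _ _ (rintegrableD i4 iz)).
    apply: measurable_funM; first exact: measurable_funX.
    exact: measurableT_comp.
  move=> z; rewrite /= ger0_norm; last by rewrite mulr_ge0// sqr_ge0.
  have := sqr_ge0 (jump D k z ^+ 2 - `|logratio D k z|); rewrite sqrrB real_normK ?num_real//.
  have := mulr_ge0 (sqr_ge0 (jump D k z)) (normr_ge0 (logratio D k z)).
  have -> : (jump D k z ^+ 2) ^+ 2 = jump D k z ^+ 4 by ring.
  have := sqr_ge0 (logratio D k z); have : 0 <= jump D k z ^+ 4 by rewrite exprn_even_ge0.
  by lra.
have iP := integrable_transfer (mV k) (coords_transfer k) ijz.
apply: (@le_trans _ _ (\int[P]_w (jump D k (V k w) ^+ 2 * `|logratio D k (V k w)|))).
  have ir : P.-integrable setT (EFin \o (fun w => jump D k (V k w) ^+ 2 *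
      (accept D x y (index_enum 'I_n) w - accept D x y rest w))).
    by under [X in EFin \o X]eq_fun do rewrite mulrBr; exact: rintegrableB.
  apply: le_trans (le_normr_Rintegral measurableT ir) _.
  apply: ler_Rintegral => //; first exact: integrable_norm.
  move=> w; rewrite normrM (ger0_norm (sqr_ge0 _)) ler_wpM2l ?sqr_ge0//.
  by rewrite /accept psum_all; exact: ler_dist_min_expR.
rewrite (Rintegral_transfer (coords_transfer k) ijz).
have en z : logratio D k z ^+ 2 = `|logratio D k z| ^+ 2.
  by rewrite real_normK ?num_real.
have ej z : jump D k z ^+ 4 = (jump D k z ^+ 2) ^+ 2 by ring.
rewrite /U3_bound -(mean_jumpX4 hs hp) -mean_logratioX mulrC.
under [X in _ <= Num.sqrt X * _]eq_Rintegral do rewrite ej.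
under [X in _ <= _ * Num.sqrt X]eq_Rintegral do rewrite en.
apply: cauchy_schwarz => //.
- by under [X in EFin \o X]eq_fun do rewrite -ej.
- by under [X in EFin \o X]eq_fun do rewrite -en.
Qed.

(** Bounds the third moment of any log-ratio with unit variance, by [centred_le]. *)
Definition lyapunov_cst : R :=
  \int[gam2]_z poly2 (pmul dominating_poly (pmul dominating_poly dominating_poly)) z.

Definition rest_noise w : R :=
  psum V (fun j z => (sigma_minus D k)^-1 * (logratio D j z - mu D j)) rest w.

Hypothesis sm0 : 0 < sigma_minus D k.

Lemma sigma_minus2 : sigma_minus D k ^+ 2 = \sum_(j < n | j != k) sigma2 D j.
Proof. by rewrite sqr_sqrtr// sumr_ge0// => j _; exact: sigma2_ge0. Qed.

Lemma measurable_rest_noise : measurable_fun setT rest_noise.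
Proof.
apply: measurable_psum => // j; apply: measurable_funM => //.
by apply: measurable_funB => //; exact: measurable_logratio.
Qed.

Lemma acceptE w : accept D x y rest w =
  accept_fun (mu_minus D k) (sigma_minus D k) (rest_noise w).
Proof.
rewrite /accept /accept_fun; congr (Num.min _ (expR _)).
rewrite /rest_noise /psum -mulr_sumr mulrA mulfV ?gt_eqF// mul1r.
rewrite sumrB /rest !big_filter -/(mu_minus D k).
by rewrite addrC subrK.
Qed.

(** The normalised variances sum to 1, so the third moments in Lindeberg's error
sum to at most a constant times the largest normalised standard deviation. *)
Lemma rest_noise_close (t : R) : 0 <= t ->
  (forall j, j != k -> sigma2 D j <= t ^+ 2 * sigma_minus D k ^+ 2) ->
  smooth_close P rest_noise ((lyapunov_cst + @gabs3 R) * t).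
Proof.
move=> t0 H B K f f1 f2 fT; pose s := sigma_minus D k.
have s0 : s != 0 by rewrite gt_eqF.
have si0 : 0 <= s^-1 by rewrite invr_ge0 ltW.
pose psi j (z : measurableTypeR R * measurableTypeR R) := s^-1 * (logratio D j z - mu D j).
pose tau j := Num.sqrt (sigma2 D j) / s.
have tau0 j : 0 <= tau j by rewrite mulr_ge0 ?sqrtr_ge0.
have K0 : 0 <= K.
  have [_ _ fK] := fT.
  by have := le_trans (normr_ge0 _) (fK 0 1); rewrite normr1 expr1n mulr1.
have mpsi j : measurable_fun setT (psi j).
  by apply: measurable_funM => //; apply: measurable_funB => //; exact: measurable_logratio.
pose dom3 := pmul dominating_poly (pmul (@dominating_poly R) dominating_poly).
have psile j z : `|psi j z| ^+ 3 <= tau j ^+ 3 * poly2 dom3 z.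
  rewrite !poly2M; set q := poly2 dominating_poly z.
  have -> : tau j ^+ 3 * (q * (q * q)) = (tau j * q) ^+ 3 by ring.
  rewrite lerXn2r ?nnegrE//.
    rewrite mulr_ge0// /q /poly2 !big_cons big_nil /=.
    by have := sqr_ge0 z.1; have := sqr_ge0 z.2; lra.
  rewrite normrM (ger0_norm si0) /tau mulrAC mulrC ler_wpM2r//.
  exact: centred_le.
have idom3 := integrable_poly2 dom3.
have i3 j : gam2.-integrable setT (EFin \o (fun z => `|psi j z| ^+ 3)).
  apply: (rintegrable_le _ _ (rintegrableZ (tau j ^+ 3) idom3)).
    by apply: measurable_funX; exact: measurableT_comp.
  by move=> z; rewrite ger0_norm.
have pM j : \int[gam2]_z `|psi j z| ^+ 3 <= lyapunov_cst * tau j ^+ 3.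
  rewrite mulrC -(RintegralZl _ measurableT idom3).
  by apply: ler_Rintegral => //; exact: rintegrableZ.
have icen j : gam2.-integrable setT (EFin \o (fun z => logratio D j z - mu D j)).
  by apply: rintegrableB; [exact: integrable_logratio|exact: rintegrable_cst].
have p1 j : \int[gam2]_z psi j z = 0.
  by rewrite (RintegralZl _ measurableT (icen j)) mean_centred mulr0.
have icen2 j : gam2.-integrable setT (EFin \o (fun z => (logratio D j z - mu D j) ^+ 2)).
  have e z : (logratio D j z - mu D j) ^+ 2 =
    logratio D j z ^+ 2 - 2 * mu D j * logratio D j z + mu D j ^+ 2 by ring.
  under [X in EFin \o X]eq_fun do rewrite e.
  apply: rintegrableD; last exact: rintegrable_cst.
  apply: rintegrableB; first exact: integrable_logratioX.
  by apply: rintegrableZ; exact: integrable_logratio.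
have p2 j : \int[gam2]_z psi j z ^+ 2 = tau j ^+ 2.
  under eq_Rintegral do rewrite exprMn.
  rewrite (RintegralZl _ measurableT (icen2 j)) mean_centredX.
  by rewrite /tau expr_div_n sqr_sqrtr ?sigma2_ge0// mulrC exprVn.
have := lindeberg mV iV mpsi tau0 i3 pM p1 p2 fT rest_uniq.
have -> : \sum_(j <- rest) tau j ^+ 2 = 1.
  rewrite /rest big_filter.
  under eq_bigr do rewrite expr_div_n sqr_sqrtr ?sigma2_ge0//.
  by rewrite -mulr_suml -sigma_minus2 divff// sqrf_eq0.
have -> : gmean f (Num.sqrt 1) 0 = \int[gam]_z f z.
  by apply: eq_Rintegral => z _; rewrite sqrtr1 mul1r add0r.
move=> h; apply: le_trans h _; rewrite ler_wpM2l//.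
have -> : \sum_(j <- rest) (lyapunov_cst * tau j ^+ 3 + @gabs3 R * tau j ^+ 3) =
    (lyapunov_cst + @gabs3 R) * \sum_(j <- rest) tau j ^+ 3.
  by rewrite mulr_sumr; apply: eq_bigr => j _; rewrite mulrDl.
apply: ler_wpM2l.
  rewrite addr_ge0//; last by apply: Rintegral_ge0 => z _; rewrite exprn_ge0.
  apply: Rintegral_ge0 => z _; rewrite !poly2M; set q := poly2 _ z.
  have q0 : 0 <= q.
    rewrite /q /poly2 !big_cons big_nil /=.
    by have := sqr_ge0 z.1; have := sqr_ge0 z.2; lra.
  by rewrite !mulr_ge0.
have tauj j : j != k -> tau j <= t.
  move=> jk; have sp : 0 < s by exact: sm0.
  have ts : 0 <= t * s by rewrite mulr_ge0// ltW.
  rewrite /tau ler_pdivrMr// -[leRHS](ger0_norm ts) -sqrtr_sqr ler_wsqrtr// exprMn.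
  exact: H.
have -> : t = t * \sum_(j <- rest) tau j ^+ 2.
  rewrite /rest big_filter.
  under eq_bigr do rewrite expr_div_n sqr_sqrtr ?sigma2_ge0//.
  by rewrite -mulr_suml -sigma_minus2 divff ?mulr1// sqrf_eq0.
rewrite mulr_sumr /rest !big_filter; apply: ler_sum => j jk.
by rewrite exprS ler_wpM2r ?sqr_ge0// tauj.
Qed.

Lemma accept_rest_close (t e : R) : 0 <= t -> 0 <= e ->
  (forall j, j != k -> sigma2 D j <= t ^+ 2 * sigma_minus D k ^+ 2) ->
  (forall th : R, smooth_close P rest_noise th ->
     th <= (lyapunov_cst + @gabs3 R) * t -> forall u,
     `|\int[P]_w tail_ind u (rest_noise w) - \int[gam]_x tail_ind u x| <= e) ->
  `|\int[P]_w accept D x y rest w - U2 D k| <= e.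
Proof.
move=> t0 e0 H K.
rewrite /U2 -(gauss_accept_fun _ sm0).
have -> : \int[P]_w accept D x y rest w =
    \int[P]_w accept_fun (mu_minus D k) (sigma_minus D k) (rest_noise w).
  by apply: eq_Rintegral => w _; rewrite acceptE.
apply: accept_fun_close => //; first exact: measurable_rest_noise.
exact: K (rest_noise_close t0 H) (lexx _).
Qed.

End one_dimension.

(** * Lyapunov's condition and the limit *)

Section lyapunov.
Context (R : realType).

(** The numerator of Lyapunov's ratio is at least its largest term, which is the
largest square to the power [1 + delta / 2]. *)
Lemma lyapunov_max_share (delta rho : R) n (t : 'I_n -> R) : 0 < delta -> 0 < rho ->
  lyapunov_ratio delta t <= rho `^ (1 + delta / 2) ->
  forall k, t k ^+ 2 <= rho * \sum_l t l ^+ 2.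
Proof.
move=> d0 rho0 H k; set S := \sum_l t l ^+ 2.
have SE : \sum_(l < n) `|t l| ^+ 2 = S.
  by apply: eq_bigr => l _; rewrite real_normK ?num_real.
have tS l : t l ^+ 2 <= S.
  by rewrite /S (bigD1 l)//= lerDl sumr_ge0// => j _; exact: sqr_ge0.
have S0 : 0 <= S by rewrite sumr_ge0// => j _; exact: sqr_ge0.
have [S1|S1] := eqVneq S 0.
  by rewrite S1 mulr0 -S1; exact: tS.
have Sp : 0 < S by rewrite lt_def S1.
have p0 : 0 < 1 + delta / 2 by rewrite addr_gt0// divr_gt0.
rewrite leNgt; apply/negP => lt.
have rS : 0 <= rho * S by rewrite mulr_ge0// ltW.
have := gt0_ltr_powR p0 rS (sqr_ge0 _) lt.
rewrite ltNge => /negP; apply.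
have -> : (t k ^+ 2) `^ (1 + delta / 2) = `|t k| `^ (2 + delta).
  rewrite -(real_normK (num_real (t k))) -powR_mulrn ?normr_ge0// -powRrM.
  by congr (_ `^ _); field.
rewrite (powRM _ (ltW rho0) S0).
have {}H : \sum_(l < n) `|t l| `^ (2 + delta) <= rho `^ (1 + delta / 2) * S `^ (1 + delta / 2).
  by move: H; rewrite /lyapunov_ratio SE ler_pdivrMr ?powR_gt0.
apply: le_trans H.
by rewrite (bigD1 k)//= lerDl sumr_ge0// => l _; exact: powR_ge0.
Qed.

(** Shares of the five families add up to a share of the total variance. Direction
k itself carries at most half of it, so leaving k out costs a factor 2. *)
Lemma sigma2_max_share n (D : ar_data R n) (rho : R) (k : 'I_n) :
  0 < rho -> rho <= 2^-1 ->
  (forall j, T1 D j ^+ 2 <= rho * \sum_l T1 D l ^+ 2) ->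
  (forall j, T2 D j ^+ 2 <= rho * \sum_l T2 D l ^+ 2) ->
  (forall j, T3 D j ^+ 2 <= rho * \sum_l T3 D l ^+ 2) ->
  (forall j, T4 D j ^+ 2 <= rho * \sum_l T4 D l ^+ 2) ->
  (forall j, T5 D j ^+ 2 <= rho * \sum_l T5 D l ^+ 2) ->
  forall j, sigma2 D j <= 2 * rho * sigma_minus D k ^+ 2.
Proof.
move=> rho0 rho1 H1 H2 H3 H4 H5 j; rewrite sigma_minus2.
set S := \sum_(l < n) sigma2 D l.
have share l : sigma2 D l <= rho * S.
  have -> : S = \sum_l T1 D l ^+ 2 + \sum_l T2 D l ^+ 2 + 2 * (\sum_l T3 D l ^+ 2) +
      2 * (\sum_l T4 D l ^+ 2) + \sum_l T5 D l ^+ 2.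
    by rewrite /S !mulr_sumr -!big_split.
  move: (H1 l) (H2 l) (H3 l) (H4 l) (H5 l); rewrite /sigma2.
  move: (\sum_l T1 D l ^+ 2) (\sum_l T2 D l ^+ 2) (\sum_l T3 D l ^+ 2)
    (\sum_l T4 D l ^+ 2) (\sum_l T5 D l ^+ 2) => s1 s2 s3 s4 s5.
  by lra.
have Sk : S = sigma2 D k + \sum_(l < n | l != k) sigma2 D l by rewrite /S (bigD1 k).
have := share k; have := share j; rewrite Sk.
have := sigma2_ge0 D k.
have : 0 <= \sum_(l < n | l != k) sigma2 D l.
  by rewrite sumr_ge0// => l _; exact: sigma2_ge0.
move: (\sum_(l < n | l != k) sigma2 D l) (sigma2 D k) (sigma2 D j) => s a b.
move=> s0 a0 hb ha; apply: le_trans hb _.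
have : a <= s by nra.
by nra.
Qed.

End lyapunov.

Theorem theorem4p2 (R : realType)
  (* data, one instance per dimension d *)
  (D : forall d : nat, ar_data R d)
  (* one step of the chain in each dimension: x is the current state,
     y the proposal, x' the next state *)
  (disp : nat -> measure_display)
  (Omega : forall d : nat, measurableType (disp d))
  (P : forall d : nat, probability (Omega d) R)
  (x y x' : forall d : nat, {RV (P d) >-> 'cV[R]_d})
  (delta : R) (i : nat)
  (Dsplit : forall d, splitting_hyp (D d))
  (Dspec : forall d, spectral_hyp (D d))
  (x_equilibrium : forall d,
     is_normal (x d) (invmx (dA (D d)) *m db (D d)) (invmx (dA (D d))))
  (y_proposal : forall d, is_proposal (D d) (x d) (y d))
  (x'_step : forall d,
     MH_step (target_pdf (D d)) (proposal_pdf (D d)) (x d) (y d) (x' d))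
  (delta_gt0 : 0 < delta)
  (lyap1 : lyapunov_ratio delta (T1 (D d)) @[d --> \oo] --> (0 : R))
  (lyap2 : lyapunov_ratio delta (T2 (D d)) @[d --> \oo] --> (0 : R))
  (lyap3 : lyapunov_ratio delta (T3 (D d)) @[d --> \oo] --> (0 : R))
  (lyap4 : lyapunov_ratio delta (T4 (D d)) @[d --> \oo] --> (0 : R))
  (lyap5 : lyapunov_ratio delta (T5 (D d)) @[d --> \oo] --> (0 : R))
  (sigma_minus_gt0 : \forall d \near \oo,
     forall k : 'I_d, k = i :> nat -> 0 < sigma_minus (D d) k) :
  exists eps U3 : nat -> R,
    eps d @[d --> \oo] --> (0 : R) /\
    \forall d \near \oo, forall k : 'I_d, k = i :> nat ->
      ('E_(P d)[fun w =>
           (((eigvec (D d) k)^T *m (x' d w - x d w)) 0 0 ^+ 2)%R] =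
         (U1 (D d) k * (U2 (D d) k + eps d) + U3 d)%R%:E)%E /\
      `|U3 d| <= U3_bound (D d) k.
Proof.
pose Ea d (k : 'I_d) := \int[P d]_w accept (D d) (x d) (y d) (rest k) w.
pose eps d := if insub i is Some k then Ea d (k : 'I_d) - U2 (D d) k else 0.
pose U3 d := if insub i is Some k then remainder (D d) (x d) (y d) (k : 'I_d) else 0.
have insE d (k : 'I_d) : k = i :> nat -> (insub i : option 'I_d) = Some k.
  by move=> <-; rewrite valK.
(* In dimensions [d <= i] there is no i-th direction, and both sequences are 0. *)
exists eps, U3; split; last first.
  apply: nearW => d k ki; rewrite /eps /U3 (insE _ _ ki); split.
    rewrite (MH_expectation_split (Dsplit d) (Dspec d) (x_equilibrium d)
      (y_proposal d) (x'_step d)).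
    by congr (_ * _ + _)%:E; rewrite addrC subrK.
  exact: (remainder_bound (Dsplit d) (Dspec d) (x_equilibrium d) (y_proposal d)).
apply/cvgrPdist_le => e e0; have [th0 th00 K] := @kolmogorov_close R e e0.
pose C := lyapunov_cst R + @gabs3 R.
pose t := th0 / (`|C| + 1).
have C1 : 0 < `|C| + 1 by rewrite ltr_wpDl.
have t0 : 0 < t by rewrite divr_gt0.
have Ct : C * t <= th0.
  rewrite /t mulrCA; apply: ler_piMr; first exact: ltW.
  rewrite ler_pdivrMr// mul1r.
  by rewrite (le_trans (ler_norm _))// lerDl.
(* [sigma2_max_share] turns the share [rho] into [2 * rho], to be at most
   [t ^+ 2], and it requires [rho <= 1 / 2]. *)
pose rho := Num.min 2^-1 (t ^+ 2 / 2).
have rho0 : 0 < rho by rewrite lt_min invr_gt0 ltr0n divr_gt0// exprn_gt0.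
have rho1 : rho <= 2^-1 by rewrite ge_min lexx.
have rho2 : 2 * rho <= t ^+ 2.
  by have : rho <= t ^+ 2 / 2 by [rewrite ge_min lexx orbT]; lra.
have rp0 : 0 < rho `^ (1 + delta / 2) by exact: powR_gt0.
have share (F : forall d, 'I_d -> R) :
    lyapunov_ratio delta (F d) @[d --> \oo] --> (0 : R) ->
    \forall d \near \oo, forall j, F d j ^+ 2 <= rho * \sum_l F d l ^+ 2.
  move=> /cvgrPdist_le /(_ _ rp0); apply: filterS => d.
  rewrite sub0r normrN => h; apply: lyapunov_max_share delta_gt0 rho0 _.
  exact: le_trans (ler_norm _) h.
near=> d; rewrite sub0r normrN /eps; case: insubP => [k _ ki|_]; last by rewrite normr0 ltW.
have sm0 : 0 < sigma_minus (D d) k.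
  have H : forall k : 'I_d, k = i :> nat -> 0 < sigma_minus (D d) k by near: d.
  exact: H.
have S2 : forall j, sigma2 (D d) j <= 2 * rho * sigma_minus (D d) k ^+ 2.
  apply: sigma2_max_share => //.
  - by near: d; exact: share lyap1.
  - by near: d; exact: share lyap2.
  - by near: d; exact: share lyap3.
  - by near: d; exact: share lyap4.
  - by near: d; exact: share lyap5.
apply: (accept_rest_close (Dsplit d) (Dspec d) (x_equilibrium d) (y_proposal d) sm0
  (ltW t0) (ltW e0)).
  by move=> j _; apply: le_trans (S2 j) _; rewrite ler_wpM2r// sqr_ge0.
move=> th Wth thl u; apply: (K _ _ _ _ th _ Wth (le_trans thl Ct)).
exact: (measurable_rest_noise (Dsplit d) (Dspec d) (y_proposal d)).
Unshelve. all: end_near.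
Qed.
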